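(* Let $n\geq3$. Given $m\in(1,\infty]$, there exist non-constant smooth radial functions $\phi=\phi(r)$ and $\psi=\psi(r)$ such that $$\left(\mathbb{R}^n,\ dr^2\oplus\psi^2(r)\,d\theta^2,\ e^{-\phi}\mathrm{dvol},\ m\right)$$ is a nontrivial quasi-Einstein smooth metric measure space with quasi-Einstein constant zero. Moreover, there is a unique such solution with $\phi(0)=1$ and characteristic constant $\mu=\frac1{m-1}$ (for $m=\infty$ this normalization means $\mu'=1$). With this choice, $$\psi^2(r)\sim\frac{n-2}{m+n-2}\,r^2\quad\text{as }r\to\infty,\ \text{when }m<\infty,$$ and $$\psi^2(r)\sim c(n)\,r\quad\text{as }r\to\infty,\ \text{when }m=\infty,$$ for some constant $c(n)>0$ depending only on $n$.
   Context: Here $r\in[0,\infty)$ is the radial coordinate on $\mathbb{R}^n$, $d\theta^2$ is the standard metric of sectional curvature one on $S^{n-1}$, and the metric $g=dr^2\oplus\psi^2(r)d\theta^2$ and function $\phi$ are required to be smooth on $\mathbb{R}^n$ (in particular $\psi(0)=0$, $\psi'(0)=1$, $\phi'(0)=0$, and $\psi>0$ for $r>0$). A smooth metric measure space $(M^n,g,e^{-\phi}\mathrm{dvol}_g,m)$, $m\in(1,\infty]$, is quasi-Einstein with quasi-Einstein constant zero if $\mathrm{Ric}_\phi^m:=\mathrm{Ric}+\nabla^2\phi-\frac1m d\phi\otimes d\phi=0$ ($\frac1m=0$ if $m=\infty$). It is nontrivial if $\phi$ is nonconstant. Let $R_\phi^m=R+2\Delta\phi-\frac{m+1}m|\nabla\phi|^2$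 (coefficient $1$ if $m=\infty$). For quasi-Einstein constant zero, the characteristic constant $\mu$ for $m<\infty$ is the constant with $R_\phi^m+m\mu e^{\frac2m\phi}=0$ (equivalently $\Delta\phi-|\nabla\phi|^2=-m\mu e^{2\phi/m}$), and for $m=\infty$ the constant $\mu'$ is defined by $R_\phi^\infty=-\mu'$ (equivalently $\Delta\phi-|\nabla\phi|^2=-\mu'$); $\mu'$ is the limit of $m\mu$ as $m\to\infty$. The notation $a(r)\sim b(r)$ means $a(r)/b(r)\to1$. *)

(* Defs.v *)
(* Rotationally symmetric quasi-Einstein metrics on R^n, over MathComp-Analysis.
   Points of R^n are row vectors 'rV[R]_n, and all tensor fields are given by
   their components in the global Cartesian coordinates of R^n. *)
From mathcomp Require Import all_boot all_order all_algebra.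
From mathcomp Require Import all_classical all_reals all_analysis.

Set Implicit Arguments.
Unset Strict Implicit.
Unset Printing Implicit Defensive.

Import Order.TTheory GRing.Theory Num.Theory.
Import numFieldNormedType.Exports.

Local Open Scope classical_set_scope.
Local Open Scope ring_scope.

Section Calculus.
Context {R : realType} {n : nat}.

Definition partial (i : 'I_n) (f : 'rV[R]_n -> R) : 'rV[R]_n -> R :=
  fun x => 'D_(delta_mx 0 i) f x.

Definition smooth (f : 'rV[R]_n -> R) : Prop :=
  forall s : seq 'I_n, let h := foldr partial f s in
    continuous h /\ forall (i : 'I_n) (x : 'rV[R]_n), derivable h x (delta_mx 0 i).

End Calculus.

Section RiemannianGeometry.
Context {R : realType} {n : nat}.
Implicit Types (g : 'rV[R]_n -> 'M[R]_n) (f phi : 'rV[R]_n -> R) (x : 'rV[R]_n).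

Definition riemannian_metric g : Prop :=
  [/\ forall i j : 'I_n, smooth (fun x => g x i j),
      forall x, (g x)^T = g x
    & forall x (v : 'rV[R]_n), v != 0 -> 0 < (v *m g x *m v^T) 0 0].

(* Gamma^k_{ij} *)
Definition christoffel g (k i j : 'I_n) x : R :=
  2^-1 * \sum_(l < n) invmx (g x) k l *
    (partial i (fun y => g y j l) x + partial j (fun y => g y i l) x
     - partial l (fun y => g y i j) x).

(* The coefficient of d_l in
   R(d_i, d_j) d_k = D_i (D_j d_k) - D_j (D_i d_k), D the Levi-Civita connection. *)
Definition riemann_curvature g (l i j k : 'I_n) x : R :=
  partial i (christoffel g l j k) x - partial j (christoffel g l i k) x
  + \sum_(p < n) (christoffel g p j k x * christoffel g l i p x
                  - christoffel g p i k x * christoffel g l j p x).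

Definition ricci g x : 'M[R]_n :=
  \matrix_(j, k) \sum_(i < n) riemann_curvature g i i j k x.

Definition hessian g f x : 'M[R]_n :=
  \matrix_(i, j) (partial i (partial j f) x
                  - \sum_(k < n) christoffel g k i j x * partial k f x).

(* The exterior derivative df, as a row of components *)
Definition differential f x : 'rV[R]_n := \row_i partial i f x.

Definition metric_trace g (T : 'rV[R]_n -> 'M[R]_n) x : R :=
  \sum_(i < n) \sum_(j < n) invmx (g x) i j * T x i j.

Definition scalar_curvature g : 'rV[R]_n -> R := metric_trace g (ricci g).

Definition laplacian g f : 'rV[R]_n -> R := metric_trace g (hessian g f).

Definition sq_norm_grad g f x : R :=
  (differential f x *m invmx (g x) *m (differential f x)^T) 0 0.

(* In the library +oo^-1 = 0, so that fine m^-1 is 1/m for every m in ]1, +oo]. *)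
Definition bakry_emery_ricci g phi (m : \bar R) x : 'M[R]_n :=
  ricci g x + hessian g phi x
  - fine m^-1%E *: ((differential phi x)^T *m differential phi x).

(* The coefficient (m + 1) / m is written 1 + 1/m. *)
Definition weighted_scalar_curvature g phi (m : \bar R) x : R :=
  scalar_curvature g x + 2 * laplacian g phi x
  - (1 + fine m^-1%E) * sq_norm_grad g phi x.

(* (R^n, g, e^{-phi} dvol_g, m) is a quasi-Einstein smooth metric measure space
   with quasi-Einstein constant zero. *)
Definition quasi_einstein_zero g phi (m : \bar R) : Prop :=
  [/\ riemannian_metric g, smooth phi, (1 < m)%E
    & forall x, bakry_emery_ricci g phi m x = 0].

Definition nontrivial phi : Prop := exists x y, phi x <> phi y.

(* mu in the case m < +oo; for m = +oo it is the constant mu', the limit of m mu. *)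
Definition characteristic_constant g phi (m : \bar R) (mu : R) : Prop :=
  match m with
  | r%:E => forall x, weighted_scalar_curvature g phi m x
                      + r * mu * expR (2 / r * phi x) = 0
  | +oo%E => forall x, weighted_scalar_curvature g phi m x = - mu
  | -oo%E => False
  end.

End RiemannianGeometry.

Section RotationalSymmetry.
Context {R : realType}.

Definition euclidean_norm n (x : 'rV[R]_n) : R :=
  Num.sqrt (\sum_(i < n) x 0 i ^+ 2).

Definition radial n (phi : R -> R) : 'rV[R]_n -> R :=
  fun x => phi (euclidean_norm x).

Definition dr_sq n (x : 'rV[R]_n) : 'M[R]_n :=
  (differential (@euclidean_norm n) x)^T *m differential (@euclidean_norm n) x.

(* The round metric of S^(n-1), i.e. the metric induced by the Euclidean one,
   pulled back to R^n \ {0} along x |-> x / |x|. *)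
Definition dtheta_sq n (x : 'rV[R]_n) : 'M[R]_n :=
  let theta (k : 'I_n) (y : 'rV[R]_n) := y 0 k / euclidean_norm y in
  \sum_(k < n) (differential (theta k) x)^T *m differential (theta k) x.

(* The polar expression makes sense for x != 0 only.  The identity is its only
   possible continuous extension to the origin: on each ray the radial unit
   vector has length one. *)
Definition rotational_metric n (psi : R -> R) (x : 'rV[R]_n) : 'M[R]_n :=
  if x == 0 then 1%:M
  else dr_sq x + psi (euclidean_norm x) ^+ 2 *: dtheta_sq x.

Definition nonconstant_radial (f : R -> R) : Prop :=
  exists r s : R, [/\ 0 <= r, 0 <= s & f r <> f s].

(* phi and psi are functions of r in [0, +oo[; their values at negative reals
   play no role.  That psi is smooth with psi'(0) = 1 and phi'(0) = 0 follows
   from the smoothness of the metric and of phi on R^n. *)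
Definition rotational_solution n (m : \bar R) (phi psi : R -> R) : Prop :=
  [/\ nonconstant_radial phi, nonconstant_radial psi,
      psi 0 = 0 /\ (forall r, 0 < r -> 0 < psi r),
      quasi_einstein_zero (@rotational_metric n psi) (@radial n phi) m
    & nontrivial (@radial n phi)].

Definition normalized_constant (m : \bar R) : R :=
  match m with r%:E => 1 / (r - 1) | _ => 1 end.

Definition normalized_solution n (m : \bar R) (phi psi : R -> R) : Prop :=
  [/\ rotational_solution n m phi psi, phi 0 = 1
    & characteristic_constant (@rotational_metric n psi) (@radial n phi) m
        (normalized_constant m)].

Definition asymptotic_at_infinity (a b : R -> R) : Prop :=
  a r / b r @[r --> +oo] --> (1 : R).

End RotationalSymmetry.

(* Main.v *)
(* In terms of s = r^2/2 the quasi-Einstein equations for l = (psi'/psi - 1/r)/r,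
   w = phi'/r and k = (1/psi^2 - 1/r^2) form a quadratic system with a regular
   singular point at s = 0, solved by a convergent power series; evenness in r makes
   the resulting metric and potential smooth on R^n.  The constraint (the radial
   Einstein equation) is a first integral, and the signs psi' > 0, phi' < 0 turn it
   into an a priori bound, so that the solution is global.  Conversely the even
   functions g_11 and phi on a coordinate axis yield a bounded solution of the same
   singular system, unique by a Gronwall argument with a singular coefficient.

   At infinity put L = psi'/psi, V = - phi' and K = 1/psi^2.  For m = oo, V increases
   to 1, L tends to 0 and L/K tends to n - 2, so (psi^2)' = 2 L/K tends to 2 (n - 2).
   For m < oo let N = n - 1 + m and H = (n - 1) L + V.  The volume-normalized mean
   curvature log(v^(2/N) H^2), with v'/v = H, is a Lyapunov function bounded below by
   the constraint; it forces L/H -> 1/N, then K/H^2 -> (N - 1)/((n - 2) N^2), while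
   (1/H)' -> 1/N. *)
Require Import Defs.
From mathcomp Require Import all_boot all_order all_algebra.
From mathcomp Require Import all_classical all_reals all_analysis.
From mathcomp Require Import ring lra zify.
Import Order.TTheory GRing.Theory Num.Theory.
Import numFieldNormedType.Exports.
Local Open Scope classical_set_scope.
Local Open Scope ring_scope.
Set Implicit Arguments.
Unset Strict Implicit.
Unset Printing Implicit Defensive.

(** With kappa = 1/m in [0, 1[ the normalization turns m = oo into kappa = 0, so one system serves
    all m. It consists of the tangential Einstein equation, the equation of the characteristic
    constant and the relation between psi and psi'. Its first integral vanishes because it obeys a
    linear equation with a negative exponent at the origin, where it is bounded; the radial equation
    is thus a consequence of the others. Existence at the singular point and continuation from
    regular points come from the same lemma on quadratic systems: the exponential weight, and at
    regular points also 1/s, are made unknowns to reach that form. At s = 0 no eigenvalue of the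
    singular linear part is a positive integer, so the recursion for the coefficients never breaks
    down. Since the radius of convergence depends only on the size of the data, the a priori bound
    allows steps of a fixed length. For finite m the convergence of L/H says nothing about its
    derivative, which enters the limit of K/H^2; that derivative satisfies a damped linear equation
    of its own. *)

Section DerivativeRules.
Context {R : realType} {V : normedModType R}.
Implicit Types (f g : V -> R) (x v : V) (a b c : R).

Lemma is_derive_addf f g x v a b :
  is_derive x v f a -> is_derive x v g b -> is_derive x v (fun y => f y + g y) (a + b).
Proof. exact: is_deriveD. Qed.

Lemma is_derive_oppf f x v a :
  is_derive x v f a -> is_derive x v (fun y => - f y) (- a).
Proof. exact: is_deriveN. Qed.

Lemma is_derive_mulf f g x v a b :
  is_derive x v f a -> is_derive x v g b ->
  is_derive x v (fun y => f y * g y) (a * g x + f x * b).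
Proof.
move=> fa gb; apply: (is_derive_eq (@is_deriveM _ _ f g x v a b fa gb)).
by rewrite addrC /GRing.scale/= (mulrC (g x)).
Qed.

Lemma is_derive_constf x v c : is_derive x v (fun _ => c) 0.
Proof. exact: is_derive_cst. Qed.

Lemma is_derive_invf f x v a : f x != 0 ->
  is_derive x v f a -> is_derive x v (fun y => (f y)^-1) (- a / f x ^+ 2).
Proof.
move=> fx0 [df <-]; apply: DeriveDef; first exact: derivableV.
by rewrite deriveV// /GRing.scale/= mulNr mulrC mulNr.
Qed.

(** A directional derivative is an ordinary derivative at 0 along a line. This yields the chain rule
    [is_derive_comp1] from derivability in the single direction [v], without differentiability of
    [f] at [x]. *)
Lemma is_derive_lineE f x v a :
  is_derive x v f a <-> is_derive (0 : R) (1 : R) (fun t : R => f (t *: v + x)) a.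
Proof.
have E : 'D_v f x = 'D_1 (fun t : R => f (t *: v + x)) (0 : R).
  rewrite /derive; apply: f_equal; apply: f_equal2 => //.
  apply/funext => t /=; rewrite addr0 scale0r add0r.
  by rewrite [X in _ = _ *: (f (X *: v + x) - _)]mulr1.
split=> -[df <-]; apply: DeriveDef.
- exact: (proj1 (derivable1P f x v) df).
- by rewrite E.
- exact: (proj2 (derivable1P f x v) df).
- by rewrite E.
Qed.

Lemma is_derive_comp1 f (h : R -> R) x v a b :
  is_derive (f x) 1 h b -> is_derive x v f a ->
  is_derive x v (fun y => h (f y)) (b * a).
Proof.
move=> hb /is_derive_lineE fa; apply/is_derive_lineE.
apply: (@is_derive1_comp _ h (fun t => f (t *: v + x))) fa.
by rewrite scale0r add0r.
Qed.

Lemma is_derive_expRf f x v a :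
  is_derive x v f a -> is_derive x v (fun y => expR (f y)) (expR (f x) * a).
Proof. by apply: is_derive_comp1; exact: is_derive_expR. Qed.

Lemma is_derive_exprf f x v a n :
  is_derive x v f a -> is_derive x v (fun y => f y ^+ n) (n%:R * f x ^+ n.-1 * a).
Proof.
move=> fa; elim: n => [|n IH]; first by rewrite !mul0r; exact: is_derive_constf.
have -> : (fun y => f y ^+ n.+1) = (fun y => f y * f y ^+ n).
  by apply/funext => y; rewrite exprS.
have -> : n.+1%:R * f x ^+ n.+1.-1 * a = a * f x ^+ n + f x * (n%:R * f x ^+ n.-1 * a).
  by case: n {IH} => [|n]; rewrite /= ?expr0 -?natr1 ?exprS; ring.
exact: is_derive_mulf.
Qed.

Lemma is_derive_eqf f x v a b : is_derive x v f a -> a = b -> is_derive x v f b.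
Proof. by move=> + <-. Qed.

Lemma is_derive_sumf (I : Type) (r : seq I) (f : I -> V -> R) (d : I -> R) x v :
  (forall i, is_derive x v (f i) (d i)) ->
  is_derive x v (fun y => \sum_(i <- r) f i y) (\sum_(i <- r) d i).
Proof.
move=> H; elim: r => [|i r IH].
  rewrite big_nil (_ : (fun _ => _) = fun=> 0); first exact: is_derive_constf.
  by apply/funext => y; rewrite big_nil.
rewrite big_cons (_ : (fun _ => _) = fun y => f i y + \sum_(j <- r) f j y).
  exact: is_derive_addf.
by apply/funext => y; rewrite big_cons.
Qed.

End DerivativeRules.

(** * The mean value theorem and monotonicity on the line *)

Section RealDerivatives.
Context {R : realType}.
Implicit Types (f df : R -> R) (x y a b : R).

Lemma is_derive_idf x : is_derive x 1 (fun y : R => y) 1.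
Proof. exact: is_derive_id. Qed.

Lemma is_derive_continuous f x a : is_derive x 1 f a -> {for x, continuous f}.
Proof. by move=> [/derivable1_diffP/differentiable_continuous]. Qed.

Lemma mean_value f df x y : x < y ->
  (forall z, x <= z <= y -> is_derive z 1 f (df z)) ->
  exists2 c, x < c < y & f y - f x = df c * (y - x).
Proof.
move=> xy H.
have [||c cxy E] := @MVT R f df x y xy.
- by move=> z /[!in_itv]/= /andP[xz zy]; apply: H; rewrite !ltW.
- apply: derivable_within_continuous => z /[!in_itv]/= zz.
  by have [] := H z zz.
- by exists c; rewrite // in_itv in cxy.
Qed.

Lemma derive_le0_le f df x y : x <= y ->
  (forall z, x <= z <= y -> is_derive z 1 f (df z)) ->
  (forall z, x <= z <= y -> df z <= 0) -> f y <= f x.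
Proof.
rewrite le_eqVlt => /orP[/eqP->//|xy] H H0.
have [c /andP[xc cy] E] := mean_value xy H.
by rewrite -subr_le0 E pmulr_lle0 ?subr_gt0 ?H0// !ltW.
Qed.

Lemma derive_ge0_le f df x y : x <= y ->
  (forall z, x <= z <= y -> is_derive z 1 f (df z)) ->
  (forall z, x <= z <= y -> 0 <= df z) -> f x <= f y.
Proof.
move=> xy H H0; rewrite -lerN2.
apply: (@derive_le0_le (fun z => - f z) (fun z => - df z)) => // z zz.
- exact/is_derive_oppf/H.
- by rewrite oppr_le0 H0.
Qed.

Lemma derive_eq0_cst f x y : x <= y ->
  (forall z, x <= z <= y -> is_derive z 1 f 0) -> f x = f y.
Proof.
move=> xy H; apply/le_anti.
by rewrite (derive_ge0_le xy H)// (derive_le0_le xy H).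
Qed.

End RealDerivatives.

(** The derivative is an evar assembled along the structure of the function; hypotheses are tried
    first, so that a derivative known from the context is used as it stands. What remains are the
    nonvanishing conditions of inverses and, for [derive_eq], one identity between derivatives. *)
Ltac derive_auto :=
  repeat (match goal with
  | |- is_derive _ _ _ _ => first
    [ eassumption
    | notypeclasses refine (is_derive_constf _ _ _)
    | notypeclasses refine (is_derive_idf _)
    | notypeclasses refine (is_derive_addf _ _)
    | notypeclasses refine (is_derive_oppf _)
    | notypeclasses refine (is_derive_mulf _ _)
    | notypeclasses refine (is_derive_exprf _ _)
    | notypeclasses refine (is_derive_expRf _)
    | notypeclasses refine (is_derive_invf _ _) ]
  end).

Ltac derive_eq := notypeclasses refine (is_derive_eqf _ _); [derive_auto|cbv beta].

(** * Power series *)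

Section PowerSeries.
Context {R : realType}.
Implicit Types (c d : nat -> R) (t r q B : R).

(** [1 - q ^+ j.+1] is [1 - q] times the sum of the powers [q ^+ i] for i <= j, each of which is at
    least [q ^+ j]. *)
Lemma succ_mul_expr_le q j : 0 <= q <= 1 -> j.+1%:R * q ^+ j * (1 - q) <= 1 - q ^+ j.+1.
Proof.
move=> /andP[q0 q1]; elim: j => [|j IH]; first by rewrite expr0 expr1 !mul1r.
have h : 0 <= (1 - q) * (1 - q ^+ j.+1).
  by rewrite mulr_ge0// subr_ge0// exprn_ile1.
have := ler_wpM2l q0 IH.
rewrite (exprS q j.+1) -[in X in _ -> X](natr1 j.+1) => h1.
rewrite mulrDl mul1r mulrDl.
have -> : j.+1%:R * q ^+ j.+1 * (1 - q) = q * (j.+1%:R * q ^+ j * (1 - q)) by rewrite exprS; ring.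
by move: h h1; set z := q ^+ j.+1; set y := j.+1%:R * _ * _; lra.
Qed.

Lemma succ_mul_geometric_le (p : R) : 0 <= p < 1 ->
  exists2 q : R, 0 <= q < 1 & exists2 B : R, 0 <= B & forall j, j.+1%:R * p ^+ j <= B * q ^+ j.
Proof.
move=> /andP[p0 p1]; pose q := (1 + p) / 2.
have q0 : 0 <= q by rewrite /q; lra.
have q1 : q < 1 by rewrite /q; lra.
(* The mean q of p and 1 satisfies q^2 - p = (1 - p)^2 / 4. Of the two factors [q ^+ j] one absorbs
   [j.+1] and the other remains. *)
have pq : p <= q * q.
  have : 0 <= (1 - p) ^+ 2 by exact: sqr_ge0.
  rewrite /q; lra.
exists q; first by rewrite q0.
have q1' : 0 < 1 - q by rewrite subr_gt0.
exists (1 - q)^-1; first by rewrite invr_ge0 ltW.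
move=> j; apply: (@le_trans _ _ (j.+1%:R * (q * q) ^+ j)).
  by rewrite ler_wpM2l// lerXn2r// nnegrE// mulr_ge0.
rewrite exprMn mulrA ler_wpM2r ?exprn_ge0//.
rewrite -[leRHS]mul1r ler_pdivlMr//.
apply: (le_trans (succ_mul_expr_le _ _)); first by rewrite q0 ltW.
by rewrite lerBlDr lerDl exprn_ge0.
Qed.

(* Geometric domination at every point of the disc rather than mere
   convergence makes the class visibly closed under all operations. *)
Definition summable_on r c :=
  forall t, `|t| < r -> exists2 q : R, 0 <= q < 1 & exists2 B : R, 0 <= B &
    forall j, `|c j * t ^+ j| <= B * q ^+ j.

Definition psum c t := limn (pseries c t).

Lemma geometric_summable_on (M rho : R) c : 0 <= M -> 0 < rho ->
  (forall j, `|c j| <= M * rho ^+ j) -> summable_on rho^-1 c.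
Proof.
move=> M0 rho0 H t tr; exists (rho * `|t|).
  rewrite mulr_ge0 ?(ltW rho0)//=.
  by rewrite mulrC -ltr_pdivlMr// mul1r.
exists M => // j; rewrite normrM normrX exprMn mulrA.
by rewrite ler_wpM2r// exprn_ge0.
Qed.

Lemma summable_on_le r r' c : r' <= r -> summable_on r c -> summable_on r' c.
Proof. by move=> rr H t tr; apply: H; exact: lt_le_trans tr rr. Qed.

Lemma summable_on_add r c d : summable_on r c -> summable_on r d ->
  summable_on r (fun j => c j + d j).
Proof.
move=> H1 H2 t tr.
have [q1 /andP[q10 q11] [B1 B10 h1]] := H1 t tr.
have [q2 /andP[q20 q21] [B2 B20 h2]] := H2 t tr.
exists (Num.max q1 q2); first by rewrite le_max q10 gt_max q11.
exists (B1 + B2); first exact: addr_ge0.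
move=> j; rewrite mulrDl (le_trans (ler_normD _ _))// mulrDl lerD//.
  by apply: (le_trans (h1 j)); rewrite ler_wpM2l// lerXn2r ?nnegrE ?le_max ?q10 ?lexx.
by apply: (le_trans (h2 j)); rewrite ler_wpM2l// lerXn2r ?nnegrE ?le_max ?q20 ?lexx ?orbT.
Qed.

Lemma summable_on_scale r (a : R) c : summable_on r c -> summable_on r (fun j => a * c j).
Proof.
move=> H t tr; have [q qq [B B0 h]] := H t tr.
exists q => //; exists (`|a| * B); first exact: mulr_ge0.
by move=> j; rewrite -mulrA normrM -mulrA ler_wpM2l.
Qed.

Lemma summable_on_sum r (I : Type) (s : seq I) (a : I -> R) (c : I -> nat -> R) :
  (forall i, summable_on r (c i)) ->
  summable_on r (fun j => \sum_(i <- s) a i * c i j).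
Proof.
move=> H; elim: s => [|i s IH].
  move=> t _; exists 0; first by rewrite lexx ltr01.
  by exists 0 => // j; rewrite big_nil !mul0r normr0.
have -> : (fun j => \sum_(k <- i :: s) a k * c k j) =
          (fun j => a i * c i j + \sum_(k <- s) a k * c k j).
  by apply/funext => j; rewrite big_cons.
by apply: summable_on_add => //; exact: summable_on_scale.
Qed.

(** The bound is taken at a point u strictly between |t| and r; the ratio |t| / u < 1 then pays for
    the factor [j.+1]. *)
Lemma summable_on_diffs r c : summable_on r c -> summable_on r (pseries_diffs c).
Proof.
move=> H t tr; pose u := (`|t| + r) / 2.
have t0 := normr_ge0 t.
have tu : `|t| < u by rewrite /u; lra.
have ur : u < r by rewrite /u; lra.
have u0 : 0 < u by exact: le_lt_trans tu.
have [q /andP[q0 q1] [B B0 h]] := H u (ltac:(by rewrite gtr0_norm)).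
have [|q' qq' [B' B'0 h']] := @succ_mul_geometric_le (`|t| / u).
  by rewrite divr_ge0 ?(ltW u0)//= ltr_pdivrMr// mul1r.
exists q' => //; exists (B / u * B'); first by rewrite mulr_ge0// divr_ge0// ltW.
move=> j; apply: (@le_trans _ _ (B / u * (j.+1%:R * (`|t| / u) ^+ j))); last first.
  by rewrite -[leRHS]mulrA ler_wpM2l// divr_ge0// ltW.
rewrite /pseries_diffs !normrM normrX normr_nat.
have hc : `|c j.+1| <= B / u ^+ j.+1.
  have := h j.+1; rewrite normrM normrX (gtr0_norm u0) => hj.
  rewrite ler_pdivlMr ?exprn_gt0//; apply: le_trans hj _.
  by rewrite ler_piMr// exprn_ile1// ltW.
have -> : B / u * (j.+1%:R * (`|t| / u) ^+ j) = j.+1%:R * (B / u ^+ j.+1) * `|t| ^+ j.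
  rewrite expr_div_n exprS; field.
  by rewrite ?expf_neq0 ?gt_eqF ?exprn_gt0.
by rewrite ler_wpM2r ?exprn_ge0// ler_wpM2l.
Qed.

Lemma summable_on_shift r c : summable_on r c -> summable_on r (fun j => c j.+1).
Proof.
move=> /summable_on_diffs H t tr; have [q qq [B B0 h]] := H t tr.
exists q => //; exists B => // j; apply: le_trans (h j).
rewrite /pseries_diffs -mulrA [leRHS]normrM normr_nat.
by rewrite ler_peMl// ler1n.
Qed.

Lemma summable_on_primitive r (a : R) c : summable_on r c ->
  summable_on r (fun j => if j is k.+1 then c k / k.+1%:R else a).
Proof.
move=> H t tr; have [q /andP[q0 q1] [B B0 h]] := H t tr.
(* The rate [q] may be 0, whereas the shift of the index divides by the rate; hence a larger,
   positive one. *)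
pose q' := (1 + q) / 2.
have qq' : q <= q' by rewrite /q'; lra.
have q'0 : 0 < q' by rewrite /q'; lra.
have q'1 : q' < 1 by rewrite /q'; lra.
exists q'; first by rewrite (ltW q'0).
exists (`|a| + B * `|t| / q'); first by rewrite addr_ge0// divr_ge0 ?(ltW q'0)// mulr_ge0.
move=> [|j]; first by rewrite !expr0 !mulr1 lerDl divr_ge0 ?(ltW q'0)// mulr_ge0.
rewrite mulrDl -[leLHS]add0r lerD ?mulr_ge0 ?exprn_ge0 ?(ltW q'0)//.
have -> : B * `|t| / q' * q' ^+ j.+1 = B * q' ^+ j * `|t|.
  by rewrite exprS; field; rewrite gt_eqF.
have -> : c j / j.+1%:R * t ^+ j.+1 = c j * t ^+ j * (t / j.+1%:R) by rewrite exprSr; ring.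
rewrite normrM; apply: ler_pM => //.
  by apply: (le_trans (h j)); rewrite ler_wpM2l// lerXn2r// nnegrE// ltW.
rewrite normrM normfV normr_nat ler_piMr// invf_le1// ?ler1n// ltr0n.
Qed.

Lemma cvg_psum r c t : summable_on r c -> `|t| < r -> pseries c t @ \oo --> psum c t.
Proof.
move=> H tr; have [q /andP[q0 q1] [B B0 h]] := H t tr.
suff: cvgn (pseries c t) by [].
apply: normed_cvg; rewrite /normed_series_of.
apply: (@series_le_cvg _ _ (geometric B q)) => [n|n|n|].
- exact: normr_ge0.
- by rewrite /geometric/= mulr_ge0// exprn_ge0.
- exact: h.
- by apply: is_cvg_geometric_series; rewrite ger0_norm.
Qed.

Lemma psum_unique r c t l : summable_on r c -> `|t| < r ->
  pseries c t @ \oo --> l -> psum c t = l.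
Proof. by move=> H tr cl; apply: cvg_lim. Qed.

Lemma psum_add r c d t : summable_on r c -> summable_on r d -> `|t| < r ->
  psum (fun j => c j + d j) t = psum c t + psum d t.
Proof.
move=> H1 H2 tr; apply: (psum_unique (summable_on_add H1 H2) tr).
have -> : pseries (fun j => c j + d j) t = pseries c t + pseries d t.
  apply/funext => n.
  rewrite [RHS](_ : _ = pseries c t n + pseries d t n)// /pseries/series/= -big_split/=.
  by apply: eq_bigr => i _; rewrite mulrDl.
by apply: cvgD; apply: cvg_psum tr.
Qed.

Lemma psum_scale r (a : R) c t : summable_on r c -> `|t| < r ->
  psum (fun j => a * c j) t = a * psum c t.
Proof.
move=> H tr; apply: (psum_unique (summable_on_scale a H) tr).
have -> : pseries (fun j => a * c j) t = (fun n => a * pseries c t n).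
  apply/funext => n; rewrite /pseries /series/= mulr_sumr.
  by apply: eq_bigr => i _; rewrite mulrA.
by apply: cvgM; [exact: cvg_cst|apply: cvg_psum tr].
Qed.

Lemma psum_sum r (I : Type) (s : seq I) (a : I -> R) (c : I -> nat -> R) t :
  (forall i, summable_on r (c i)) -> `|t| < r ->
  psum (fun j => \sum_(i <- s) a i * c i j) t = \sum_(i <- s) a i * psum (c i) t.
Proof.
move=> H tr; elim: s => [|i s IH].
  rewrite big_nil /psum; apply: cvg_lim => //.
  have -> : pseries (fun j => \sum_(i <- [::]) a i * c i j) t = fun=> 0.
    by apply/funext => n; rewrite /pseries/series/= big1// => i _; rewrite big_nil mul0r.
  exact: cvg_cst.
have -> : (fun j => \sum_(k <- i :: s) a k * c k j) =
          (fun j => a i * c i j + \sum_(k <- s) a k * c k j).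
  by apply/funext => j; rewrite big_cons.
rewrite (psum_add (summable_on_scale _ (H i)) (summable_on_sum _ _ H) tr).
by rewrite (psum_scale _ (H i) tr) big_cons IH.
Qed.

Lemma psum_shift r c t : summable_on r c -> `|t| < r ->
  psum c t = c 0%N + t * psum (fun j => c j.+1) t.
Proof.
move=> H tr; apply: (psum_unique H tr).
rewrite -cvg_shiftS.
have -> : [sequence pseries c t n.+1]_n =
          (fun n => c 0%N + t * pseries (fun j => c j.+1) t n).
  apply/funext => n; rewrite /pseries/series/= big_nat_recl// expr0 mulr1 mulr_sumr.
  by congr (_ + _); apply: eq_bigr => i _; rewrite exprS; ring.
apply: cvgD; first exact: cvg_cst.
by apply: cvgM; [exact: cvg_cst|apply: cvg_psum tr; exact: summable_on_shift].
Qed.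

Lemma psum0 c : psum c 0 = c 0%N.
Proof.
apply: cvg_lim => //; rewrite -cvg_shiftS.
have -> : [sequence pseries c 0 n.+1]_n = (fun=> c 0%N).
  apply/funext => n; rewrite /pseries/series/= big_nat_recl// expr0 mulr1.
  by rewrite big1 ?addr0// => i _; rewrite expr0n mulr0.
exact: cvg_cst.
Qed.

Lemma is_derive_psum r c t : summable_on r c -> `|t| < r ->
  is_derive t 1 (psum c) (psum (pseries_diffs c) t).
Proof.
move=> H tr; pose u := (`|t| + r) / 2.
have t0 := normr_ge0 t.
have tu : `|t| < u by rewrite /u; lra.
have ur : u < r by rewrite /u; lra.
have u0 : 0 < u by exact: le_lt_trans tu.
have ur' : `|u| < r by rewrite gtr0_norm.
apply: (@pseries_snd_diffs _ c u t).
- by apply: cvgP; apply: cvg_psum ur'.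
- by apply: cvgP; apply: cvg_psum ur'; exact: summable_on_diffs.
- by apply: cvgP; apply: cvg_psum ur'; do 2 apply: summable_on_diffs.
- by rewrite (gtr0_norm u0).
Qed.

Lemma is_derive_psum_primitive r (a : R) c t : summable_on r c -> `|t| < r ->
  is_derive t 1 (psum (fun j => if j is k.+1 then c k / k.+1%:R else a)) (psum c t).
Proof.
move=> H tr; have := is_derive_psum (summable_on_primitive a H) tr.
congr is_derive; congr psum; apply/funext => j.
by rewrite /pseries_diffs mulrC divfK// pnatr_eq0.
Qed.

Definition cauchy_product c d j := \sum_(i < j.+1) c i * d (j - i)%N.

Lemma cauchy_product_le c d t (q B B' : R) j : 0 <= q ->
  (forall j, `|c j * t ^+ j| <= B * q ^+ j) -> (forall j, `|d j * t ^+ j| <= B' * q ^+ j) ->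
  `|cauchy_product c d j * t ^+ j| <= B * B' * (j.+1%:R * q ^+ j).
Proof.
move=> q0 hc hd; rewrite /cauchy_product mulr_suml (le_trans (ler_norm_sum _ _ _))//.
apply: (@le_trans _ _ (\sum_(i < j.+1) (B * B' * q ^+ j))); last first.
  by rewrite sumr_const card_ord -[leLHS]mulr_natl le_eqVlt; apply/orP; left; apply/eqP; ring.
apply: ler_sum => i _.
have ij : (i <= j)%N by rewrite -ltnS.
have -> : c i * d (j - i)%N * t ^+ j = (c i * t ^+ i) * (d (j - i)%N * t ^+ (j - i)).
  have -> : t ^+ j = t ^+ i * t ^+ (j - i) by rewrite -exprD subnKC.
  by ring.
have -> : B * B' * q ^+ j = (B * q ^+ i) * (B' * q ^+ (j - i)).
  have -> : q ^+ j = q ^+ i * q ^+ (j - i) by rewrite -exprD subnKC.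
  by ring.
by rewrite normrM ler_pM.
Qed.

Lemma summable_on_common r c d t : summable_on r c -> summable_on r d -> `|t| < r ->
  exists2 q, 0 <= q < 1 & exists2 B, 0 <= B &
    forall j, `|c j * t ^+ j| <= B * q ^+ j /\ `|d j * t ^+ j| <= B * q ^+ j.
Proof.
move=> H1 H2 tr.
have [q1 /andP[q10 q11] [B1 B10 h1]] := H1 t tr.
have [q2 /andP[q20 q21] [B2 B20 h2]] := H2 t tr.
exists (Num.max q1 q2); first by rewrite le_max q10 gt_max q11.
exists (Num.max B1 B2); first by rewrite le_max B10.
move=> j; split; [apply: le_trans (h1 j) _|apply: le_trans (h2 j) _];
  by rewrite ler_pM ?exprn_ge0 ?lerXn2r ?nnegrE ?le_max ?q10 ?q20 ?lexx ?orbT.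
Qed.

Lemma summable_on_cauchy_product r c d : summable_on r c -> summable_on r d ->
  summable_on r (cauchy_product c d).
Proof.
move=> H1 H2 t tr; have [q qq [B B0 h]] := summable_on_common H1 H2 tr.
have [q' qq' [B' B'0 h']] := succ_mul_geometric_le qq.
exists q' => //; exists (B * B * B'); first by rewrite !mulr_ge0.
have /andP[q0 _] := qq.
move=> j; apply: le_trans (cauchy_product_le (B := B) (B' := B) _ q0 _ _) _ => [k|k|].
- by have [] := h k.
- by have [] := h k.
- by rewrite -[leRHS]mulrA ler_wpM2l// mulr_ge0.
Qed.

(** Partial sums are values of polynomials P and Q. Their product differs from the partial sum of
    the Cauchy product only by the terms of [P * Q] of index n to 2n - 1, which are n terms of size
    O(n q^n). The rates p and p' arise by absorbing the factors n + 1 and n one after the other. *)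
Lemma psum_mul r c d t : summable_on r c -> summable_on r d -> `|t| < r ->
  psum (cauchy_product c d) t = psum c t * psum d t.
Proof.
move=> H1 H2 tr; apply: (psum_unique (summable_on_cauchy_product H1 H2) tr).
have [q qq [B B0 h]] := summable_on_common H1 H2 tr.
have /andP[q0 q1] := qq.
have [p pp [C C0 hC]] := succ_mul_geometric_le qq.
have [p' /andP[p'0 p'1] [C' C'0 hC']] := succ_mul_geometric_le pp.
suff: (fun n => pseries c t n * pseries d t n - pseries (cauchy_product c d) t n) @ \oo --> 0.
  move=> H0.
  have Hm : pseries c t \* pseries d t @ \oo --> psum c t * psum d t.
    by apply: cvgM; apply: cvg_psum tr.
  rewrite -[psum c t * _]subr0.
  have -> : pseries (cauchy_product c d) t = (pseries c t \* pseries d t) -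
    (fun n => pseries c t n * pseries d t n - pseries (cauchy_product c d) t n).
    by apply/funext => n; rewrite !fctE/=; ring.
  exact: cvgB.
pose K := B * B * 2 * C * C'.
suff hn n : `|pseries c t n * pseries d t n - pseries (cauchy_product c d) t n| <= geometric K p' n.
  have gK : geometric K p' @ \oo --> 0 by apply: cvg_geometric; rewrite ger0_norm.
  apply/cvgr0Pnorm_lt => e e0.
  move/cvgr0Pnorm_lt/(_ e e0) : gK; apply: filterS => n.
  apply: le_lt_trans; apply: le_trans (hn n) _; exact: ler_norm.
have -> : geometric K p' n = K * p' ^+ n by [].
pose P := \poly_(i < n) c i; pose Q := \poly_(i < n) d i.
have EP : pseries c t n = P.[t] by rewrite horner_poly /pseries/series/= big_mkord.
have EQ : pseries d t n = Q.[t] by rewrite horner_poly /pseries/series/= big_mkord.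
have sPQ : (size (P * Q)%R <= n + n)%N.
  apply: leq_trans (size_polyMleq _ _) _.
  by apply: leq_trans (leq_pred _) _; rewrite leq_add// size_poly.
rewrite EP EQ -hornerM (horner_coef_wide _ sPQ).
rewrite -(big_mkord xpredT (fun i => (P * Q)`_i * t ^+ i)).
rewrite (big_cat_nat (leq0n n) (leq_addr n n))/=.
have -> : \sum_(0 <= i < n) (P * Q)`_i * t ^+ i = pseries (cauchy_product c d) t n.
  rewrite /pseries/series/=; apply: eq_big_nat => i /andP[_ ilt].
  rewrite coefM; congr (_ * _); apply: eq_bigr => k _.
  rewrite !coef_poly.
  have ki : (k <= i)%N by rewrite -ltnS.
  by rewrite (leq_ltn_trans ki ilt) (leq_ltn_trans (leq_subr _ _) ilt).
rewrite addrAC subrr add0r (le_trans (ler_norm_sum _ _ _))//.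
apply: (@le_trans _ _ (\sum_(n <= i < n + n) (B * B * (2 * (n.+1%:R * q ^+ n))))).
  rewrite big_nat_cond [leRHS]big_nat_cond; apply: ler_sum => i /andP[/andP[ni inn] _].
  have -> : (P * Q)`_i * t ^+ i = cauchy_product (fun k => P`_k) (fun k => Q`_k) i * t ^+ i.
    by rewrite coefM.
  have hP (e : nat -> R) : (forall k, `|e k * t ^+ k| <= B * q ^+ k) ->
      forall k, `|(\poly_(i < n) e i)`_k * t ^+ k| <= B * q ^+ k.
    move=> he k; rewrite coef_poly; case: ifP => _ //.
    by rewrite mul0r normr0 mulr_ge0// exprn_ge0.
  apply: le_trans (cauchy_product_le (B := B) (B' := B) _ q0 _ _) _.
  - by apply: hP => k; have [] := h k.
  - by apply: hP => k; have [] := h k.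
  - rewrite ler_wpM2l ?mulr_ge0// mulrA ler_pM ?exprn_ge0//.
      by rewrite -natrM ler_nat mulnS addSn ltnS mul2n -addnn leqW// ltnW.
    by rewrite ler_wiXn2l// ltW.
rewrite sumr_const_nat addKn -[leLHS]mulr_natl.
have h1 := hC n; have h2 := hC' n.
have h3 : n%:R * p ^+ n <= n.+1%:R * p ^+ n.
  by rewrite ler_wpM2r ?exprn_ge0 ?ler_nat//; have /andP[] := pp.
apply: (@le_trans _ _ (B * B * 2 * (n%:R * (C * p ^+ n)))).
  have -> : n%:R * (B * B * (2 * (n.+1%:R * q ^+ n))) = B * B * 2 * (n%:R * (n.+1%:R * q ^+ n)) by ring.
  by rewrite ler_wpM2l ?mulr_ge0// ler_wpM2l.
rewrite /K; apply: (@le_trans _ _ (B * B * 2 * C * (n.+1%:R * p ^+ n))).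
  have -> : B * B * 2 * (n%:R * (C * p ^+ n)) = B * B * 2 * C * (n%:R * p ^+ n) by ring.
  by rewrite ler_wpM2l ?mulr_ge0.
by rewrite -[leRHS]mulrA ler_wpM2l ?mulr_ge0.
Qed.

End PowerSeries.

(** * Quadratic systems *)

Section QuadraticSystem.
Context {R : realType} (I : finType).
Variables (A : I -> I -> I -> R) (Lam : I -> I -> R).

(** Coefficient j of the quadratic term A(y, y). The systems in view are y' = Lam (y - y(0)) / t +
    A(y, y): the shifted series [fun j => c j.+1] represents (y - y(0)) / t, so that [Lam] accounts
    for a singular linear part. *)
Definition quadratic_conv (c : nat -> I -> R) (j : nat) (i : I) : R :=
  \sum_a \sum_b A i a b * cauchy_product (c^~ a) (c^~ b) j.

Section Recursion.
Variables (S : nat -> (I -> R) -> I -> R) (y0 : I -> R).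

(** Coefficient j + 1 depends on all earlier ones through the convolution, so the structural
    recursion carries the whole table of coefficients up to index j. *)
Fixpoint coef_table (j : nat) : nat -> I -> R :=
  if j is j'.+1 then
    fun k => if (k <= j')%N then coef_table j' k else S j' (quadratic_conv (coef_table j') j')
  else fun _ => y0.

Definition coefs k := coef_table k k.

Lemma coef_tableE j k : (k <= j)%N -> coef_table j k = coefs k.
Proof.
elim: j => [|j IH]; first by rewrite leqn0 => /eqP->.
rewrite leq_eqVlt => /orP[/eqP->//|kj].
by rewrite /= -ltnS kj IH.
Qed.

Lemma coefs0 : coefs 0 = y0. Proof. by []. Qed.

Lemma coefsS j : coefs j.+1 = S j (quadratic_conv coefs j).
Proof.
rewrite {1}/coefs/= ltnn; congr (S j _); apply/funext => i.
apply: eq_bigr => a _; apply: eq_bigr => b _; congr (_ * _).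
apply: eq_bigr => k _; have kj : (k <= j)%N by rewrite -ltnS.
by rewrite !coef_tableE// leq_subr.
Qed.
End Recursion.

Definition quadratic_norm : R := \sum_i \sum_a \sum_b `|A i a b|.

Lemma quadratic_norm_ge0 : 0 <= quadratic_norm.
Proof. by do 3 (apply: sumr_ge0 => ? _). Qed.

Lemma quadratic_conv_le (c : nat -> I -> R) (M rho : R) j i : 0 <= M -> 0 <= rho ->
  (forall k i, (k <= j)%N -> `|c k i| <= M * rho ^+ k) ->
  `|quadratic_conv c j i| <= quadratic_norm * (j.+1%:R * (M ^+ 2 * rho ^+ j)).
Proof.
move=> M0 rho0 H.
have cc a b : `|cauchy_product (c^~ a) (c^~ b) j| <= j.+1%:R * (M ^+ 2 * rho ^+ j).
  rewrite /cauchy_product (le_trans (ler_norm_sum _ _ _))//.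
  apply: (@le_trans _ _ (\sum_(k < j.+1) (M ^+ 2 * rho ^+ j))); last first.
    by rewrite sumr_const card_ord -[leLHS]mulr_natl.
  apply: ler_sum => k _; have kj : (k <= j)%N by rewrite -ltnS.
  have -> : M ^+ 2 * rho ^+ j = (M * rho ^+ k) * (M * rho ^+ (j - k)).
    have -> : rho ^+ j = rho ^+ k * rho ^+ (j - k) by rewrite -exprD subnKC.
    by ring.
  by rewrite normrM ler_pM// H// leq_subr.
have B0 : 0 <= j.+1%:R * (M ^+ 2 * rho ^+ j).
  by rewrite !mulr_ge0// ?exprn_ge0.
rewrite /quadratic_conv (le_trans (ler_norm_sum _ _ _))//.
apply: (@le_trans _ _ ((\sum_a \sum_b `|A i a b|) * (j.+1%:R * (M ^+ 2 * rho ^+ j)))).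
  rewrite mulr_suml; apply: ler_sum => a _; rewrite (le_trans (ler_norm_sum _ _ _))//.
  rewrite mulr_suml; apply: ler_sum => b _; rewrite normrM.
  exact: ler_wpM2l.
apply: ler_wpM2r => //; rewrite /quadratic_norm [leRHS](bigD1 i)//= lerDl.
by do 3 (apply: sumr_ge0 => ? _).
Qed.

(** [S j] is a right inverse of (j + 1) - Lam, the matrix that multiplies coefficient j + 1 in the
    recursion, and its norm decays like 1/(j + 1). *)
Definition solution_operator (S : nat -> (I -> R) -> I -> R) (C : R) :=
  (forall j v i, j.+1%:R * S j v i = \sum_b Lam i b * S j v b + v i) /\
  (forall j v (B : R), (forall i, `|v i| <= B) -> forall i, `|S j v i| <= C * B / j.+1%:R).

(** The convolution has k + 1 terms, which the factor 1/(k + 1) in the bound of [S] cancels exactly;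
    so a geometric majorant closes the induction. The summand 1 keeps the ratio positive. *)
Lemma coefs_le S (C : R) y0 (M : R) : 0 <= C -> 0 <= M -> solution_operator S C ->
  (forall i, `|y0 i| <= M) ->
  forall k i, `|coefs S y0 k i| <= M * (C * quadratic_norm * M + 1) ^+ k.
Proof.
move=> C0 M0 [_ hS] hy; set rho := _ + 1.
have a0 := quadratic_norm_ge0.
have rho1 : 1 <= rho by rewrite /rho lerDr !mulr_ge0.
have rho0 : 0 <= rho by apply: le_trans rho1.
elim/ltn_ind => -[|k] IH i; first by rewrite coefs0 expr0 mulr1.
rewrite coefsS.
apply: le_trans (hS k _ _ (fun i => quadratic_conv_le i M0 rho0 _) i) _ => [i' m i0 mk|].
  exact: IH.
have -> : C * (quadratic_norm * (k.+1%:R * (M ^+ 2 * rho ^+ k))) / k.+1%:R =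
   M * (C * quadratic_norm * M) * rho ^+ k.
  by rewrite expr2; field; rewrite nat1r pnatr_eq0.
by rewrite exprS [leRHS]mulrA ler_wpM2r ?exprn_ge0// ler_wpM2l// /rho lerDl.
Qed.

(* The radius depends on the size of the initial value only, which is what
   makes it possible to continue solutions by steps of a fixed length. *)
Lemma quadratic_series S (C M : R) : 0 <= C -> 0 <= M -> solution_operator S C ->
  exists2 r : R, 0 < r & forall y0, (forall i, `|y0 i| <= M) ->
    exists c : nat -> I -> R, [/\ c 0%N = y0, forall i, summable_on r (c^~ i) &
      forall t i, `|t| < r ->
        psum (pseries_diffs (c^~ i)) t =
        \sum_b Lam i b * psum (fun j => c j.+1 b) t +
        \sum_a \sum_b A i a b * (psum (c^~ a) t * psum (c^~ b) t)].
Proof.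
move=> C0 M0 hS; pose rho := C * quadratic_norm * M + 1.
have rho0 : 0 < rho.
  by rewrite /rho ltr_wpDl// !mulr_ge0// quadratic_norm_ge0.
exists rho^-1; first by rewrite invr_gt0.
move=> y0 hy; exists (coefs S y0).
have hs i : summable_on rho^-1 (fun j => coefs S y0 j i).
  apply: (geometric_summable_on M0 rho0) => j.
  exact: coefs_le.
split=> // t i tr; set c := coefs S y0.
have -> : pseries_diffs (c^~ i) = (fun j => \sum_b Lam i b * c j.+1 b + quadratic_conv c j i).
  apply/funext => j; rewrite /pseries_diffs /c coefsS.
  by case: hS => [hS _]; rewrite hS.
have hcp a b : summable_on rho^-1 (cauchy_product (c^~ a) (c^~ b)).
  exact: summable_on_cauchy_product.
have h1 : summable_on rho^-1 (fun j => \sum_b Lam i b * c j.+1 b).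
  apply: (@summable_on_sum _ _ _ _ (Lam i) (fun b j => c j.+1 b)) => b.
  exact: (@summable_on_shift _ _ (c^~ b)).
have h2 a : summable_on rho^-1 (fun j => \sum_b A i a b * cauchy_product (c^~ a) (c^~ b) j).
  by apply: summable_on_sum.
have E : quadratic_conv c ^~ i = (fun j => \sum_a 1 * \sum_b A i a b * cauchy_product (c^~ a) (c^~ b) j).
  by apply/funext => j; apply: eq_bigr => a _; rewrite mul1r.
have h3 : summable_on rho^-1 (quadratic_conv c ^~ i).
  by rewrite E; apply: (@summable_on_sum _ _ _ _ (fun=> 1)
    (fun a j => \sum_b A i a b * cauchy_product (c^~ a) (c^~ b) j)).
rewrite (psum_add h1 h3 tr); congr (_ + _).
  rewrite (@psum_sum _ _ _ _ (Lam i) (fun b j => c j.+1 b) _ _ tr)// => b.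
  exact: (@summable_on_shift _ _ (c^~ b)).
rewrite E (@psum_sum _ _ _ _ (fun=> 1)
    (fun a j => \sum_b A i a b * cauchy_product (c^~ a) (c^~ b) j) _ _ tr)//.
apply: eq_bigr => a _; rewrite mul1r (psum_sum _ _ _ tr)//.
by apply: eq_bigr => b _; rewrite (psum_mul (hs a) (hs b) tr).
Qed.

End QuadraticSystem.

(** * The reduced system *)

Lemma sum_ord4 (R : nmodType) (F : 'I_4 -> R) : \sum_i F i =
  F (Ordinal (isT : (0 < 4)%N)) + (F (Ordinal (isT : (1 < 4)%N)) +
  (F (Ordinal (isT : (2 < 4)%N)) + F (Ordinal (isT : (3 < 4)%N)))).
Proof.
rewrite !big_ord_recl big_ord0 addr0; congr (F _ + (F _ + (F _ + F _))); exact: val_inj.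
Qed.

Lemma sum_ord5 (R : nmodType) (F : 'I_5 -> R) : \sum_i F i =
  F (Ordinal (isT : (0 < 5)%N)) + (F (Ordinal (isT : (1 < 5)%N)) +
  (F (Ordinal (isT : (2 < 5)%N)) + (F (Ordinal (isT : (3 < 5)%N)) +
   F (Ordinal (isT : (4 < 5)%N))))).
Proof.
by rewrite !big_ord_recl big_ord0 addr0; congr (F _ + (F _ + (F _ + (F _ + F _)))); exact: val_inj.
Qed.

Section ReducedFlow.
Context {R : realType}.
Variables (nu kappa : R).
Implicit Types (l w k f : R -> R) (s : R).

(** The term m mu exp(2 phi / m) for kappa = 1/m and mu = 1/(m - 1), since m/(m - 1) = 1/(1 -
    kappa); for kappa = 0 it is the constant mu' = 1. *)
Definition potential_weight (y : R) : R := expR (2 * kappa * y) / (1 - kappa).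

(* With s = r^2/2, psi = r (1 + 2 s k)^(-1/2), psi'/psi = 1/r + r l and
   phi' = r w, this is the quasi-Einstein system, except for its constraint. *)
Definition reduced_flow l w k f s : Prop := exists dl dw dk : R,
  [/\ [/\ is_derive s 1 l dl, is_derive s 1 w dw, is_derive s 1 k dk &
          is_derive s 1 f (w s)],
      2 * s * dl = (nu - 2) * k s - (2 * nu - 1) * l s + w s
        + 2 * s * (w s * l s - (nu - 1) * l s ^+ 2),
      2 * s * dw = - nu * w s - potential_weight (f s)
        + 2 * s * (w s ^+ 2 - (nu - 1) * l s * w s)
    & 2 * s * dk = - 2 * k s - 2 * l s - 4 * s * k s * l s].

Lemma is_derive_potential_weight f s (df : R) : is_derive s 1 f df ->
  is_derive s 1 (fun t => potential_weight (f t)) (2 * kappa * df * potential_weight (f s)).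
Proof.
move=> hf; rewrite /potential_weight.
have h1 : is_derive s 1 (fun t => 2 * kappa * f t) (2 * kappa * df).
  by derive_eq; ring.
have h2 := is_derive_expRf h1.
by derive_eq; rewrite /=; ring.
Qed.

(** [e] multiplied by exp(- 2 kappa f) is constant. Thus the exponential weight can be an additional
    unknown with a quadratic equation and be identified afterwards. *)
Lemma potential_weight_unique (e w f : R -> R) (a b s0 : R) : a < s0 < b ->
  (forall s, a < s < b -> is_derive s 1 e (2 * kappa * w s * e s)) ->
  (forall s, a < s < b -> is_derive s 1 f (w s)) ->
  e s0 = potential_weight (f s0) ->
  forall s, a < s < b -> e s = potential_weight (f s).
Proof.
move=> /andP[as0 s0b] he hf E s /andP[as_ sb].
pose g t := e t * expR (- (2 * kappa * f t)).
have hg t : a < t < b -> is_derive t 1 g 0.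
  move=> tab; have het := he t tab; have hft := hf t tab.
  have h1 : is_derive t 1 (fun t => - (2 * kappa * f t)) (- (2 * kappa * w t)).
    by derive_eq; ring.
  have h2 := is_derive_expRf h1.
  by derive_eq; rewrite /=; ring.
have gE t : e t = g t * expR (2 * kappa * f t).
  by rewrite /g -mulrA -expRD addNr expR0 mulr1.
rewrite gE /potential_weight.
have -> : g s = g s0.
  case: (leP s s0) => [ss|/ltW ss]; [|symmetry]; apply: derive_eq0_cst => // z /andP[z1 z2].
    by apply: hg; rewrite (lt_le_trans as_ z1) (le_lt_trans z2 s0b).
  by apply: hg; rewrite (lt_le_trans as0 z1) (le_lt_trans z2 sb).
rewrite /g E /potential_weight mulrC; congr (_ * _).
by rewrite mulrAC -expRD subrr expR0 mul1r.
Qed.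

Lemma linear_ode_eq0 (G P p : R -> R) (a b s0 : R) : a < s0 < b ->
  (forall s, a < s < b -> is_derive s 1 P (p s)) ->
  (forall s, a < s < b -> is_derive s 1 G (- p s * G s)) ->
  G s0 = 0 -> forall s, a < s < b -> G s = 0.
Proof.
move=> /andP[as0 s0b] hP hG G0 s /andP[as_ sb].
pose E t := G t * expR (P t).
have dE t : a < t < b -> is_derive t 1 E 0.
  by move=> tab; have h1 := hP t tab; have h2 := hG t tab; derive_eq; ring.
have : E s = E s0.
  case: (leP s s0) => [ss|/ltW ss].
    apply: (@derive_eq0_cst _ E) => // z /andP[z1 z2]; apply: dE.
    by rewrite (lt_le_trans as_ z1) (le_lt_trans z2 s0b).
  symmetry; apply: (@derive_eq0_cst _ E) => // z /andP[z1 z2]; apply: dE.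
  by rewrite (lt_le_trans as0 z1) (le_lt_trans z2 sb).
rewrite /E G0 mul0r => /eqP; rewrite mulf_eq0 (gt_eqF (expR_gt0 _)) orbF.
by move/eqP.
Qed.

(** [s * sig s - 1] solves a linear homogeneous equation. Thus 1/s, which carries the explicit time
    dependence of the system, can be an unknown with the equation sig' = - sig^2. *)
Lemma reciprocal_unique (sig P : R -> R) (a b s0 : R) : a < s0 < b ->
  (forall s, a < s < b -> is_derive s 1 P (sig s)) ->
  (forall s, a < s < b -> is_derive s 1 sig (- sig s ^+ 2)) ->
  s0 * sig s0 = 1 -> forall s, a < s < b -> s != 0 -> sig s = s^-1.
Proof.
move=> sab hP hs E s sab' s0'.
have h : s * sig s - 1 = 0.
  apply: (@linear_ode_eq0 (fun s => s * sig s - 1) P sig a b s0) => // [t tab|].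
    by have h := hs t tab; derive_eq; ring.
  by rewrite E subrr.
apply: (mulfI s0'); rewrite divff//; apply/eqP; rewrite -subr_eq0; exact/eqP.
Qed.

Lemma normr_div_ge1 (x d : R) : 1 <= d -> `|x / d| <= `|x|.
Proof.
move=> d1; have d0 : 0 < d by apply: lt_le_trans d1.
by rewrite normrM normfV (gtr0_norm d0) ler_piMr// invf_le1.
Qed.

Lemma normr_div_shift (x J c : R) : 0 < J -> 0 <= c -> `|x / (J + c)| <= `|x| / J.
Proof.
move=> J0 c0; rewrite normrM normfV (gtr0_norm (_ : 0 < J + c)) ?ltr_wpDr//.
by rewrite ler_wpM2l// lef_pV2 ?posrE ?ltr_wpDr// lerDl.
Qed.

Hypotheses (nu_ge3 : 3 <= nu) (kappa_ge0 : 0 <= kappa) (kappa_lt1 : kappa < 1).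

Section SingularStart.

(** The indices 0, 1, 2, 3 stand for l, w, k and the weight e. Division of the equations by 2 s
    leaves the quadratic terms here; the linear terms, still divided by s, go to [Lam]. *)
Let A (i a b : 'I_4) : R :=
  (match nat_of_ord i, nat_of_ord a, nat_of_ord b with
  | 0, 0, 0 => (- (nu - 1))%R | 0, 1, 0 => (1)%R
  | 1, 1, 1 => (1)%R | 1, 0, 1 => (- (nu - 1))%R
  | 2, 2, 0 => (- 2)%R
  | 3, 1, 3 => (2 * kappa)%R
  | _, _, _ => (0)%R
  end)%N.

Let Lam (i b : 'I_4) : R :=
  (match nat_of_ord i, nat_of_ord b with
  | 0, 2 => ((nu - 2) / 2)%R | 0, 0 => (- (nu - 2^-1))%R | 0, 1 => (2^-1)%R
  | 1, 1 => (- (nu / 2))%R | 1, 3 => (- 2^-1)%R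
  | 2, 2 => (- 1)%R | 2, 0 => (- 1)%R
  | _, _ => (0)%R
  end)%N.

(* The linear part is triangular in e, w, l - (nu - 2) k and 2 l - k. *)
Let S (j : nat) (v : 'I_4 -> R) : 'I_4 -> R :=
  let J := j.+1%:R in
  let v0 := v (Ordinal (isT : (0 < 4)%N)) in let v1 := v (Ordinal (isT : (1 < 4)%N)) in
  let v2 := v (Ordinal (isT : (2 < 4)%N)) in let v3 := v (Ordinal (isT : (3 < 4)%N)) in
  let e := v3 / J in let w := (v1 - e / 2) / (J + nu / 2) in
  let p := (v0 - (nu - 2) * v2 + w / 2) / (J + 3 / 2) in
  let q := (2 * v0 - v2 + w) / (J + (nu - 1)) in
  fun i => nth 0 [:: ((nu - 2) * q - p) / (2 * nu - 5); w; (q - 2 * p) / (2 * nu - 5); e] i.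

(** The eigenvalues of [Lam] are 0, - nu/2, - 3/2 and - (nu - 1), as the denominators in [S] show,
    and j + 1 > 0 keeps the shifted matrix invertible. The constant comes from |e| <= b, |w| <= 2 b,
    |p| <= (nu + 1) b and |q| <= 5 b with b = B/(j + 1). *)
Lemma singular_solution_operator : solution_operator Lam S (6 * nu).
Proof.
have nu3 := nu_ge3.
split=> [j v i|j v B hv i].
  have J0 : 0 < j.+1%:R :> R by rewrite ltr0n.
  rewrite sum_ord4 /Lam/= {-1}/S/=; set J := j.+1%:R in J0 *.
  set v0 := v (Ordinal (isT : (0 < 4)%N)); set v1 := v (Ordinal (isT : (1 < 4)%N)).
  set v2 := v (Ordinal (isT : (2 < 4)%N)); set v3 := v (Ordinal (isT : (3 < 4)%N)).
  have ivE m (lt : (m < 4)%N) : nat_of_ord i = m -> v i = v (Ordinal lt).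
    by move=> im; congr v; apply: val_inj.
  move: J0; rewrite /S/= -/J -/v0 -/v1 -/v2 -/v3 => J0.
  have n1 : J != 0 by rewrite gt_eqF.
  have n2 : J + nu / 2 != 0 by rewrite gt_eqF//; lra.
  have n3 : J + 3 / 2 != 0 by rewrite gt_eqF//; lra.
  have n4 : J + (nu - 1) != 0 by rewrite gt_eqF//; lra.
  have n5 : 2 * nu - 5 != 0 by rewrite gt_eqF//; lra.
  set e := v3 / J; set w := (v1 - e / 2) / _; set p := (v0 - _ + _) / _.
  set q := (_ - _ + w) / _.
  have he : J * e = v3 by rewrite /e mulrC divfK.
  have hw : J * w = v1 - e / 2 - nu / 2 * w.
    have : (J + nu / 2) * w = v1 - e / 2 by rewrite /w mulrC divfK.
    lra.
  have hp : J * p = v0 - (nu - 2) * v2 + w / 2 - 3 / 2 * p.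
    have : (J + 3 / 2) * p = v0 - (nu - 2) * v2 + w / 2 by rewrite /p mulrC divfK.
    lra.
  have hq : J * q = 2 * v0 - v2 + w - (nu - 1) * q.
    have : (J + (nu - 1)) * q = 2 * v0 - v2 + w by rewrite /q mulrC divfK.
    lra.
  clearbody e w p q.
  case: i ivE => -[|[|[|[|//]]]] i4 ivE /=.
  - rewrite (ivE 0%N isT erefl) -/v0.
    transitivity (((nu - 2) * (J * q) - J * p) / (2 * nu - 5)); first by ring.
    by rewrite hp hq; field.
  - rewrite (ivE 1%N isT erefl) -/v1 hw; ring.
  - rewrite (ivE 2%N isT erefl) -/v2.
    transitivity ((J * q - 2 * (J * p)) / (2 * nu - 5)); first by ring.
    by rewrite hp hq; field.
  - by rewrite (ivE 3%N isT erefl) -/v3 he; ring.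
have J1 : 1 <= j.+1%:R :> R by rewrite ler1n.
rewrite /S/=; set J := j.+1%:R in J1 *.
set v0 := v (Ordinal (isT : (0 < 4)%N)); set v1 := v (Ordinal (isT : (1 < 4)%N)).
set v2 := v (Ordinal (isT : (2 < 4)%N)); set v3 := v (Ordinal (isT : (3 < 4)%N)).
have J0 : 0 < J by apply: lt_le_trans J1.
have h0 : `|v0| <= B by exact: hv.
have h1 : `|v1| <= B by exact: hv.
have h2 : `|v2| <= B by exact: hv.
have h3 : `|v3| <= B by exact: hv.
have B0 : 0 <= B by apply: le_trans (normr_ge0 v0) h0.
set e := v3 / J; set w := (v1 - e / 2) / _; set p := (v0 - _ + _) / _.
set q := (_ - _ + w) / _.
pose b := B / J.
have b0 : 0 <= b by rewrite /b divr_ge0// ltW.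
have bB : b <= B by rewrite /b ler_pdivrMr// ler_peMr.
have dJ (x c : R) : `|x| <= c * B -> `|x| / J <= c * b.
  by move=> xc; rewrite /b mulrA ler_wpM2r// invr_ge0 ltW.
have he : `|e| <= b.
  by rewrite /e normrM normfV (gtr0_norm J0) /b ler_wpM2r// invr_ge0 ltW.
have hw : `|w| <= 2 * b.
  apply: le_trans (normr_div_shift _ J0 _) _; first lra.
  apply: dJ; move: h1 he; rewrite !ler_norml => /andP[? ?] /andP[? ?].
  by apply/andP; split; lra.
have hp : `|p| <= (nu + 1) * b.
  apply: le_trans (normr_div_shift _ J0 _) _; first lra.
  apply: dJ; move: h0 h2 hw; rewrite !ler_norml => /andP[? ?] /andP[a1 a2] /andP[? ?].
  have a3 : (nu - 2) * v2 <= (nu - 2) * B by rewrite ler_wpM2l//; lra.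
  have a4 : (nu - 2) * (- B) <= (nu - 2) * v2 by rewrite ler_wpM2l//; lra.
  by apply/andP; split; lra.
have hq : `|q| <= 5 * b.
  apply: le_trans (normr_div_shift _ J0 _) _; first lra.
  apply: dJ; move: h0 h2 hw; rewrite !ler_norml => /andP[? ?] /andP[a1 a2] /andP[? ?].
  by apply/andP; split; lra.
have nb : 3 * b <= nu * b by rewrite ler_wpM2r.
have -> : 6 * nu * B / J = 6 * nu * b by rewrite /b; ring.
clearbody e w p q b.
case: i => -[|[|[|[|//]]]] i4 /=.
- apply: le_trans (normr_div_ge1 _ _) _; first lra.
  apply: le_trans (ler_normB _ _) _; rewrite normrM (ger0_norm (_ : 0 <= nu - 2)); last lra.
  have : (nu - 2) * `|q| <= (nu - 2) * (5 * b) by rewrite ler_wpM2l//; lra.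
  lra.
- lra.
- apply: le_trans (normr_div_ge1 _ _) _; first lra.
  apply: le_trans (ler_normB _ _) _; rewrite normrM (ger0_norm (_ : 0 <= 2))//.
  lra.
- lra.
Qed.

Lemma reduced_flow_start : exists2 d : R, 0 < d &
  exists cl cw ck cf : nat -> R,
   [/\ [/\ summable_on d cl, summable_on d cw, summable_on d ck & summable_on d cf],
       psum cf 0 = 1 &
       forall s, `|s| < d -> reduced_flow (psum cl) (psum cw) (psum ck) (psum cf) s].
Proof.
have nu3 := nu_ge3.
(* At s = 0 the linear parts must vanish: nu w0 = - e0, k0 = - l0 and (nu - 2) k0 - (2 nu - 1) l0 +
   w0 = 0, whence 3 (nu - 1) l0 = w0. So f(0) = 1 fixes all initial values. *)
pose e0 := potential_weight 1; pose w0 := - e0 / nu; pose l0 := w0 / (3 * (nu - 1)).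
pose y0 (i : 'I_4) := nth 0 [:: l0; w0; - l0; e0] i.
pose M := \sum_i `|y0 i|.
have hM i : `|y0 i| <= M by rewrite /M (bigD1 i)//= lerDl sumr_ge0.
have M0 : 0 <= M by apply: sumr_ge0.
have nu0 : 0 <= 6 * nu by lra.
have [d d0 H] := quadratic_series A nu0 M0 singular_solution_operator.
have [c [c0 hc hE]] := H y0 hM.
exists d => //.
pose o0 := Ordinal (isT : (0 < 4)%N); pose o1 := Ordinal (isT : (1 < 4)%N).
pose o2 := Ordinal (isT : (2 < 4)%N); pose o3 := Ordinal (isT : (3 < 4)%N).
pose cf (j : nat) := if j is k.+1 then c k o1 / k.+1%:R else 1.
have hcf : summable_on d cf by exact: (@summable_on_primitive _ _ 1 (c^~ o1)).
exists (c^~ o0), (c^~ o1), (c^~ o2), cf; split; [by split|by rewrite psum0|].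
have df s : `|s| < d -> is_derive s 1 (psum cf) (psum (c^~ o1) s).
  by move=> sd; exact: (@is_derive_psum_primitive _ _ 1 (c^~ o1)).
have de s : `|s| < d -> is_derive s 1 (psum (c^~ o3))
    (2 * kappa * psum (c^~ o1) s * psum (c^~ o3) s).
  move=> sd; apply: (is_derive_eq (is_derive_psum (hc o3) sd)).
  rewrite (hE s o3 sd) !sum_ord4 /A /Lam/= -/o0 -/o1 -/o2 -/o3; ring.
have eE s : `|s| < d -> psum (c^~ o3) s = potential_weight (psum cf s).
  rewrite ltr_norml => sd.
  have d1 : - d < 0 < d by rewrite oppr_lt0 d0.
  have h1 (t : R) : - d < t < d -> is_derive t 1 (psum (c^~ o3))
    (2 * kappa * psum (c^~ o1) t * psum (c^~ o3) t) by rewrite -ltr_norml; exact: de.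
  have h2 (t : R) : - d < t < d -> is_derive t 1 (psum cf) (psum (c^~ o1) t) by rewrite -ltr_norml; exact: df.
  apply: (potential_weight_unique d1 h1 h2 _ sd).
  by rewrite !psum0 c0.
move=> s sd.
have hs i := psum_shift (hc i) sd.
exists (psum (pseries_diffs (c^~ o0)) s), (psum (pseries_diffs (c^~ o1)) s),
  (psum (pseries_diffs (c^~ o2)) s); split.
- by split; [exact: is_derive_psum sd|exact: is_derive_psum sd|exact: is_derive_psum sd|exact: df].
- rewrite (hE s o0 sd) !sum_ord4 /A /Lam/= -/o0 -/o1 -/o2 -/o3.
  have n1 : nu - 1 != 0 by rewrite gt_eqF//; lra.
  move: (hs o0) (hs o1) (hs o2); rewrite c0 /y0/= => h0 h1 h2.
  set z0 := psum (fun j => c j.+1 o0) s in h0 *.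
  set z1 := psum (fun j => c j.+1 o1) s in h1 *.
  set z2 := psum (fun j => c j.+1 o2) s in h2 *.
  have -> : (nu - 2) * psum (c^~ o2) s - (2 * nu - 1) * psum (c^~ o0) s + psum (c^~ o1) s
    = s * ((nu - 2) * z2 - (2 * nu - 1) * z0 + z1).
    by rewrite h0 h1 h2 /l0; field.
  by field.
- rewrite -(eE s sd) (hE s o1 sd) !sum_ord4 /A /Lam/= -/o0 -/o1 -/o2 -/o3.
  have n1 : nu != 0 by rewrite gt_eqF//; lra.
  move: (hs o3) (hs o1); rewrite c0 /y0/= => h3 h1.
  set z3 := psum (fun j => c j.+1 o3) s in h3 *.
  set z1 := psum (fun j => c j.+1 o1) s in h1 *.
  have -> : - nu * psum (c^~ o1) s - psum (c^~ o3) s = s * (- nu * z1 - z3).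
    by rewrite h1 h3 /w0; field.
  by field.
- rewrite (hE s o2 sd) !sum_ord4 /A /Lam/= -/o0 -/o1 -/o2 -/o3.
  move: (hs o0) (hs o2); rewrite c0 /y0/= => h0 h2.
  set z0 := psum (fun j => c j.+1 o0) s in h0 *.
  set z2 := psum (fun j => c j.+1 o2) s in h2 *.
  have -> : - 2 * psum (c^~ o2) s - 2 * psum (c^~ o0) s = s * (- 2 * z2 - 2 * z0).
    by rewrite h0 h2; ring.
  by ring.
Qed.

End SingularStart.

Section RegularStep.

(** Away from s = 0 a fifth unknown, of index 4, represents 1/s. It multiplies the former linear
    part, which makes the system autonomous and purely quadratic. *)
Let A (i a b : 'I_5) : R :=
  (match nat_of_ord i, nat_of_ord a, nat_of_ord b with
  | 0, 0, 0 => (- (nu - 1))%R | 0, 1, 0 => (1)%R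
  | 0, 4, 2 => ((nu - 2) / 2)%R | 0, 4, 0 => (- (nu - 2^-1))%R | 0, 4, 1 => (2^-1)%R
  | 1, 1, 1 => (1)%R | 1, 0, 1 => (- (nu - 1))%R
  | 1, 4, 1 => (- (nu / 2))%R | 1, 4, 3 => (- 2^-1)%R
  | 2, 2, 0 => (- 2)%R
  | 2, 4, 2 => (- 1)%R | 2, 4, 0 => (- 1)%R
  | 3, 1, 3 => (2 * kappa)%R
  | 4, 4, 4 => (- 1)%R
  | _, _, _ => (0)%R
  end)%N.

Lemma regular_solution_operator : solution_operator (fun _ _ : 'I_5 => 0 : R)
  (fun j v i => v i / j.+1%:R) 1.
Proof.
split=> [j v i|j v B hv i].
  rewrite big1 ?add0r; first by rewrite mulrC divfK// pnatr_eq0.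
  by move=> b _; rewrite mul0r.
by rewrite normrM normfV normr_nat mul1r ler_wpM2r.
Qed.

Lemma reduced_flow_step (s1 M : R) : 0 < s1 -> 0 <= M ->
  exists2 h : R, 0 < h & forall s0 l0 w0 k0 f0 : R, s1 <= s0 ->
    `|l0| <= M -> `|w0| <= M -> `|k0| <= M -> potential_weight f0 <= M ->
    exists l w k f, [/\ l s0 = l0, w s0 = w0, k s0 = k0, f s0 = f0 &
      forall s, `|s - s0| < h -> 0 < s -> reduced_flow l w k f s].
Proof.
move=> s10 M0.
(* The reciprocal of the base point is among the initial data and is at most 1/s1; hence one step
   length for all base points beyond s1. *)
have M10 : 0 <= M + s1^-1 by rewrite addr_ge0// invr_ge0 ltW.
have [h h0 H] := quadratic_series A ler01 M10 regular_solution_operator.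
exists h => // s0 l0 w0 k0 f0 s10' hl hw hk he.
have s00 : 0 < s0 by exact: lt_le_trans s10'.
pose e0 := potential_weight f0.
have e00 : 0 <= e0 by rewrite /e0 /potential_weight divr_ge0 ?expR_ge0// subr_ge0 ltW.
pose y0 (i : 'I_5) := nth 0 [:: l0; w0; k0; e0; s0^-1] i.
have hy i : `|y0 i| <= M + s1^-1.
  have i1 : 0 <= s1^-1 by rewrite invr_ge0 ltW.
  have i2 : s0^-1 <= s1^-1 by rewrite lef_pV2.
  case: i => -[|[|[|[|[|//]]]]] i5; rewrite /y0/=; try lra.
    by rewrite ger0_norm// ler_wpDr.
  by rewrite ger0_norm ?invr_ge0 ?(ltW s00)//; lra.
have [c [c0 hc hE]] := H y0 hy.
pose o0 := Ordinal (isT : (0 < 5)%N); pose o1 := Ordinal (isT : (1 < 5)%N).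
pose o2 := Ordinal (isT : (2 < 5)%N); pose o3 := Ordinal (isT : (3 < 5)%N).
pose o4 := Ordinal (isT : (4 < 5)%N).
pose cf (j : nat) := if j is k.+1 then c k o1 / k.+1%:R else f0.
have dsh s : is_derive s 1 (fun t : R => t - s0) 1.
  by derive_eq; ring.
have dcomp (g : R -> R) s (dg : R) : is_derive (s - s0) 1 g dg -> is_derive s 1 (fun t => g (t - s0)) dg.
  by move=> hg; have := @is_derive_comp1 _ _ (fun t : R => t - s0) g s 1 _ _ hg (dsh s); rewrite mulr1.
have df s : `|s - s0| < h ->
    is_derive s 1 (fun t => psum cf (t - s0)) (psum (c^~ o1) (s - s0)).
  by move=> sd; apply: dcomp; exact: (@is_derive_psum_primitive _ _ f0 (c^~ o1)).
have dc i s : `|s - s0| < h -> is_derive s 1 (fun t => psum (c^~ i) (t - s0))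
    (\sum_a \sum_b A i a b * (psum (c^~ a) (s - s0) * psum (c^~ b) (s - s0))).
  move=> sd; apply: dcomp; apply: (is_derive_eq (is_derive_psum (hc i) sd)).
  by rewrite (hE _ i sd) big1 ?add0r// => b _; rewrite mul0r.
have cE i : psum (c^~ i) (s0 - s0) = y0 i by rewrite subrr psum0 c0.
have dom s : (`|s - s0| < h) = (s0 - h < s < s0 + h).
  by rewrite ltr_norml ltrBlDr ltrBrDr [- h + _]addrC [h + _]addrC.
have s0dom : s0 - h < s0 < s0 + h by rewrite ltrBlDr !ltrDl h0.
have eE s : `|s - s0| < h -> psum (c^~ o3) (s - s0) = potential_weight (psum cf (s - s0)).
  rewrite dom => sd.
  have h1 (t : R) : s0 - h < t < s0 + h -> is_derive t 1 (fun t => psum (c^~ o3) (t - s0))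
      (2 * kappa * psum (c^~ o1) (t - s0) * psum (c^~ o3) (t - s0)).
    rewrite -dom => td; apply: (is_derive_eqf (dc o3 t td)).
    rewrite !sum_ord5 /A/= -/o0 -/o1 -/o2 -/o3 -/o4; ring.
  have h2 (t : R) : s0 - h < t < s0 + h ->
      is_derive t 1 (fun t => psum cf (t - s0)) (psum (c^~ o1) (t - s0)) by rewrite -dom; exact: df.
  apply: (potential_weight_unique s0dom h1 h2 _ sd).
  by rewrite cE subrr psum0.
have sE s : `|s - s0| < h -> 0 < s -> psum (c^~ o4) (s - s0) = s^-1.
  move=> sd sp.
  pose ca (j : nat) : R := if j is k.+1 then c k o4 / k.+1%:R else 0.
  have hca t : `|t - s0| < h ->
      is_derive t 1 (fun t => psum (ca : nat -> R) (t - s0)) (psum (c^~ o4) (t - s0)).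
    move=> td; exact: (dcomp (psum ca) t _ (is_derive_psum_primitive 0 (hc o4) td)).
  have h1 (t : R) : s0 - h < t < s0 + h ->
      is_derive t 1 (fun t => psum ca (t - s0)) (psum (c^~ o4) (t - s0)).
    by rewrite -dom; exact: hca.
  have h2 (t : R) : s0 - h < t < s0 + h ->
      is_derive t 1 (fun t => psum (c^~ o4) (t - s0)) (- psum (c^~ o4) (t - s0) ^+ 2).
    rewrite -dom => td; apply: (is_derive_eqf (dc o4 t td)).
    rewrite !sum_ord5 /A/= -/o0 -/o1 -/o2 -/o3 -/o4; ring.
  move: sd; rewrite dom => sd; apply: (reciprocal_unique s0dom h1 h2 _ sd _).
  - by rewrite cE /y0/= divff// gt_eqF.
  - by rewrite gt_eqF.
exists (fun t => psum (c^~ o0) (t - s0)), (fun t => psum (c^~ o1) (t - s0)),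
  (fun t => psum (c^~ o2) (t - s0)), (fun t => psum cf (t - s0)).
split; rewrite ?cE ?subrr ?psum0// => s sd sp.
have n1 : s != 0 by rewrite gt_eqF.
do 3 eexists; split.
- by split; [exact: (dc o0 s sd)|exact: (dc o1 s sd)|exact: (dc o2 s sd)|exact: df].
- by rewrite !sum_ord5 /A/= -/o0 -/o1 -/o2 -/o3 -/o4 (sE s sd sp); field.
- by rewrite -(eE s sd) !sum_ord5 /A/= -/o0 -/o1 -/o2 -/o3 -/o4 (sE s sd sp); field.
- by rewrite !sum_ord5 /A/= -/o0 -/o1 -/o2 -/o3 -/o4 (sE s sd sp); field.
Qed.

End RegularStep.
End ReducedFlow.

(** * Uniqueness for the singular system *)

Section Uniqueness.
Context {R : realType}.
Variables (nu kappa : R).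
Implicit Types (l w k f : R -> R) (r : R).

(** The system of [reduced_flow] in the variable r, by r d/dr = 2 s d/ds. Uniqueness is proved in
    this form because a given quasi-Einstein metric provides l, w and k on r > 0 only. *)
Definition radial_flow l w k f r : Prop := exists dl dw dk : R,
  [/\ [/\ is_derive r 1 l dl, is_derive r 1 w dw, is_derive r 1 k dk &
          is_derive r 1 f (r * w r)],
      r * dl = (nu - 2) * k r - (2 * nu - 1) * l r + w r
        + r ^+ 2 * (w r * l r - (nu - 1) * l r ^+ 2),
      r * dw = - nu * w r - potential_weight kappa (f r)
        + r ^+ 2 * (w r ^+ 2 - (nu - 1) * l r * w r)
    & r * dk = - 2 * k r - 2 * l r - 2 * r ^+ 2 * k r * l r].

Lemma radial_flow_reduced l w k f r : reduced_flow nu kappa l w k f (r ^+ 2 / 2) ->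
  radial_flow (fun r => l (r ^+ 2 / 2)) (fun r => w (r ^+ 2 / 2))
    (fun r => k (r ^+ 2 / 2)) (fun r => f (r ^+ 2 / 2)) r.
Proof.
move=> [dl [dw [dk [[hl hw hk hf] El Ew Ek]]]].
have hr : is_derive r 1 (fun t : R => t ^+ 2 / 2) r by derive_eq; rewrite /=; field.
have hc (g : R -> R) (dg : R) : is_derive (r ^+ 2 / 2) 1 g dg ->
    is_derive r 1 (fun t => g (t ^+ 2 / 2)) (dg * r).
  by move=> hg; exact: (is_derive_comp1 (f := fun t : R => t ^+ 2 / 2) hg hr).
exists (dl * r), (dw * r), (dk * r); split.
- split; [exact: hc|exact: hc|exact: hc|].
  by rewrite mulrC; exact: hc.
- transitivity (2 * (r ^+ 2 / 2) * dl); first by field.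
  by rewrite El; field.
- transitivity (2 * (r ^+ 2 / 2) * dw); first by field.
  by rewrite Ew; field.
- transitivity (2 * (r ^+ 2 / 2) * dk); first by field.
  by rewrite Ek; field.
Qed.

(** r^2 Q exp(- C r^2 / 2) is nonincreasing, and since Q is bounded it tends to 0 at the origin; so
    it is nonpositive. The factor r^2 is what the coefficient - 2 pays for. *)
Lemma singular_gronwall (Q dQ : R -> R) (C B T : R) :
  (forall r, 0 < r < T -> is_derive r 1 Q (dQ r)) ->
  (forall r, 0 < r < T -> r * dQ r <= (C * r ^+ 2 - 2) * Q r) ->
  (forall r, 0 < r < T -> `|Q r| <= B) ->
  forall r, 0 < r < T -> Q r <= 0.
Proof.
move=> hQ hd hB r /andP[r0 rT].
pose E t := t ^+ 2 * Q t * expR (- (C / 2 * t ^+ 2)).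
pose dE t := t * (t * dQ t + 2 * Q t - C * t ^+ 2 * Q t) * expR (- (C / 2 * t ^+ 2)).
have hE t : 0 < t < T -> is_derive t 1 E (dE t).
  by move=> tT; have h := hQ t tT; derive_eq; rewrite /dE /=; field.
have E0 t : 0 < t < T -> dE t <= 0.
  move=> /[dup] tT /andP[t0 _]; rewrite /dE; have := hd t tT => h.
  rewrite pmulr_lle0 ?expR_gt0// pmulr_rle0//.
  by move: h; rewrite mulrBl; lra.
have EE t : 0 < t -> t <= r -> E r <= E t.
  move=> t0 tr; apply: (derive_le0_le tr) => z /andP[z1 z2].
    by apply: hE; rewrite (lt_le_trans t0 z1) (le_lt_trans z2 rT).
  by apply: E0; rewrite (lt_le_trans t0 z1) (le_lt_trans z2 rT).
rewrite leNgt; apply/negP => Q0.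
have Er0 : 0 < E r by rewrite /E !mulr_gt0 ?expR_gt0 ?exprn_gt0.
have B0 : 0 < B.
  by apply: lt_le_trans Q0 _; apply: le_trans (ler_norm _) _; apply: hB; rewrite r0.
pose K := B * expR (`|C| / 2 * r ^+ 2).
have K0 : 0 < K by rewrite /K mulr_gt0 ?expR_gt0.
have EK t : 0 < t -> t <= r -> E r <= t ^+ 2 * K.
  move=> t0 tr; apply: le_trans (EE t t0 tr) _; rewrite /E -mulrA ler_wpM2l ?exprn_ge0 ?(ltW t0)//.
  rewrite /K; apply: (@le_trans _ _ (B * expR (- (C / 2 * t ^+ 2)))).
    rewrite ler_wpM2r ?expR_ge0//; apply: le_trans (ler_norm _) _.
    by apply: hB; rewrite t0 (le_lt_trans tr rT).
  rewrite ler_wpM2l ?(ltW B0)// ler_expR.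
  have h1 : t ^+ 2 <= r ^+ 2 by rewrite lerXn2r ?nnegrE ?(ltW t0) ?(ltW r0).
  have h2 : - C * t ^+ 2 <= `|C| * t ^+ 2.
    by rewrite ler_wpM2r ?exprn_ge0 ?(ltW t0)// -normrN ler_norm.
  have h3 : `|C| * t ^+ 2 <= `|C| * r ^+ 2 by rewrite ler_wpM2l.
  lra.
pose t := Num.min r (Num.min 1 (E r / K / 2)).
have q0 : 0 < E r / K / 2 by rewrite !divr_gt0.
have t0 : 0 < t by rewrite !lt_min r0 ltr01.
have tr : t <= r by rewrite ge_min lexx.
have t1 : t <= 1 by rewrite !ge_min lexx orbT.
have tq : t <= E r / K / 2 by rewrite !ge_min lexx !orbT.
have := EK t t0 tr; rewrite leNgt => /negP; apply.
have : t ^+ 2 <= t by rewrite expr2 ler_piMl// ltW.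
move=> /le_trans/(_ tq); rewrite -(ler_pM2r K0) => /le_lt_trans; apply.
have -> : E r / K / 2 * K = E r / 2 by field; rewrite gt_eqF.
by lra.
Qed.

Lemma expR_lipschitz (a b F : R) : a <= F -> b <= F -> `|expR a - expR b| <= expR F * `|a - b|.
Proof.
wlog ba : a b / b <= a.
  move=> H aF bF; case: (leP b a) => [h|/ltW h]; first exact: H.
  by rewrite distrC [`|a - b|]distrC; apply: H.
move=> aF bF; have h0 : 0 <= expR a - expR b by rewrite subr_ge0 ler_expR.
rewrite (ger0_norm h0) ger0_norm ?subr_ge0//.
have h1 : expR b = expR a * expR (b - a) by rewrite -expRD addrC subrK.
apply: (@le_trans _ _ (expR a * (a - b))); last first.
  by rewrite ler_wpM2r ?subr_ge0// ler_expR.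
rewrite h1 -{1}[expR a]mulr1 -mulrBr ler_wpM2l ?expR_ge0//.
by have := expR_ge1Dx (b - a); lra.
Qed.

Hypotheses (kappa_ge0 : 0 <= kappa) (kappa_lt1 : kappa < 1).

Lemma normrM_le (a b A M : R) : `|a| <= A -> `|b| <= M -> `|a * b| <= A * M.
Proof. by move=> ? ?; rewrite normrM ler_pM. Qed.

Lemma potential_weight_lipschitz (a b F : R) : a <= F -> b <= F ->
  `|potential_weight kappa a - potential_weight kappa b| <=
  2 * potential_weight kappa F * `|a - b|.
Proof.
have k0 := kappa_ge0; have k1 := kappa_lt1.
move=> aF bF; rewrite /potential_weight -mulrBl normrM normfV (gtr0_norm (_ : 0 < 1 - kappa)); last lra.
have -> : 2 * (expR (2 * kappa * F) / (1 - kappa)) * `|a - b| =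
  expR (2 * kappa * F) * (2 * `|a - b|) / (1 - kappa) by ring.
rewrite ler_wpM2r ?invr_ge0//; first lra.
apply: le_trans (expR_lipschitz (F := 2 * kappa * F) _ _) _.
- by rewrite ler_wpM2l//; lra.
- by rewrite ler_wpM2l//; lra.
rewrite ler_wpM2l ?expR_ge0// -mulrBr normrM ler_wpM2r// ger0_norm; lra.
Qed.

End Uniqueness.

(** A weighted sum of squares of the differences satisfies the inequality of [singular_gronwall]: in
    suitable coordinates the singular linear part is damping, and the nonlinear terms carry a factor
    r^2. *)
Lemma radial_flow_unique_bounded (R : realType) (nu kappa : R)
  (l1 w1 k1 f1 l2 w2 k2 f2 : R -> R) (B T : R) :
  3 <= nu -> 0 <= kappa -> kappa < 1 ->
  (forall r : R, 0 < r < T -> radial_flow nu kappa l1 w1 k1 f1 r) ->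
  (forall r : R, 0 < r < T -> radial_flow nu kappa l2 w2 k2 f2 r) ->
  (forall r : R, 0 < r < T ->
    [/\ `|l1 r| <= B, `|w1 r| <= B, `|k1 r| <= B, `|f1 r| <= B & `|f1 r - 1| <= B * r ^+ 2]) ->
  (forall r : R, 0 < r < T ->
    [/\ `|l2 r| <= B, `|w2 r| <= B, `|k2 r| <= B, `|f2 r| <= B & `|f2 r - 1| <= B * r ^+ 2]) ->
  forall r : R, 0 < r < T -> [/\ l1 r = l2 r, w1 r = w2 r, k1 r = k2 r & f1 r = f2 r].
Proof.
move=> n3 kappa_ge0 kappa_lt1 flow1 flow2 bound1 bound2 r rT0.
(* These combinations diagonalize the singular linear part. *)
pose p r := l1 r - l2 r - (nu - 2) * (k1 r - k2 r).
pose q r := 2 * (l1 r - l2 r) - (k1 r - k2 r).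
pose z r := w1 r - w2 r.
(* Divided by r^2, the difference of the potentials obeys r eps' = 2 z - 2 eps, stays bounded by the
   hypotheses on f - 1, and makes the difference of the weights O(r^2 eps). *)
pose eps r := 2 * (f1 r - f2 r) / r ^+ 2.
(* With the weight 2, the term - 4 nu z^2 in r Q' helps absorb the cross terms p z, q z and eps z,
   so that the linear part contributes at most - 2 Q. *)
pose Q r := p r ^+ 2 + q r ^+ 2 + 2 * z r ^+ 2 + eps r ^+ 2.
have Q_ge0 t : 0 <= Q t.
  rewrite /Q.
  by have := sqr_ge0 (p t); have := sqr_ge0 (q t); have := sqr_ge0 (z t); have := sqr_ge0 (eps t); lra.
have component_le t : let N := Num.sqrt (Q t) in
  [/\ `|p t| <= N, `|q t| <= N, `|z t| <= N & `|eps t| <= N].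
  have sq (x y : R) : x ^+ 2 <= y -> `|x| <= Num.sqrt y.
    by move=> h; rewrite -sqrtr_sqr ler_wsqrtr.
  have := sqr_ge0 (p t); have := sqr_ge0 (q t); have := sqr_ge0 (z t); have := sqr_ge0 (eps t).
  by move=> h1 h2 h3 h4 N; clear -sq h1 h2 h3 h4; split; apply: sq; rewrite /Q; lra.
have B0 : 0 <= B by have [h _ _ _ _] := bound1 _ rT0; apply: le_trans (normr_ge0 _) h.
have n5 : 0 < 2 * nu - 5 by lra.
pose L := potential_weight kappa B.
have L0 : 0 <= L by rewrite /L /potential_weight divr_ge0 ?expR_ge0// subr_ge0 ltW.
pose C := 2 * (2 * B * nu + 2 * B * nu * nu + 2 * nu * (2 * B * nu)) +
  2 * (2 * (2 * B * nu + 2 * B * nu * nu) + 2 * (2 * B * nu)) +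
  4 * (2 * B + nu * (2 * B * nu)) + 4 * L.
have main : exists dQ : R -> R, forall r, 0 < r < T ->
    is_derive r 1 Q (dQ r) /\ r * dQ r <= (C * r ^+ 2 - 2) * Q r.
  suff : forall r, exists d : R, 0 < r < T ->
    is_derive r 1 Q d /\ r * d <= (C * r ^+ 2 - 2) * Q r by move=> /choice[dQ h]; exists dQ.
  move=> t; have [tT|ntT] := boolP (0 < t < T); last by exists 0.
  have [dl1 [dw1 [dk1 [[hl1 hw1 hk1 hf1] El1 Ew1 Ek1]]]] := flow1 _ tT.
  have [dl2 [dw2 [dk2 [[hl2 hw2 hk2 hf2] El2 Ew2 Ek2]]]] := flow2 _ tT.
  have [bl1 bw1 bk1 bf1 _] := bound1 _ tT.
  have [bl2 bw2 bk2 bf2 _] := bound2 _ tT.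
  have /andP[t0 _] := tT.
  have tn0 : t != 0 by rewrite gt_eqF.
  have t2n0 : t ^+ 2 != 0 by rewrite expf_neq0.
  pose dp := dl1 - dl2 - (nu - 2) * (dk1 - dk2).
  pose dq := 2 * (dl1 - dl2) - (dk1 - dk2).
  pose dz := dw1 - dw2.
  pose de := (2 * (t * w1 t - t * w2 t) - 2 * t * eps t) / t ^+ 2.
  have hp : is_derive t 1 p dp by rewrite /p /dp; derive_eq; ring.
  have hq : is_derive t 1 q dq by rewrite /q /dq; derive_eq; ring.
  have hz : is_derive t 1 z dz by rewrite /z /dz; derive_eq; ring.
  have he : is_derive t 1 eps de.
    rewrite /eps /de; derive_eq => //.
    by rewrite /eps /=; field.
  exists (2 * p t * dp + 2 * q t * dq + 4 * z t * dz + 2 * eps t * de) => _; split.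
    by rewrite /Q; derive_eq; rewrite /=; ring.
  have [bp bq bz be] := component_le t.
  set N := Num.sqrt (Q t) in bp bq bz be.
  have N0 : 0 <= N by exact: sqrtr_ge0.
  have NQ : N * N = Q t by rewrite -expr2 sqr_sqrtr ?Q_ge0.
  pose dl := l1 t - l2 t; pose dk := k1 t - k2 t.
  have bdl : `|dl| <= nu * N.
    have E : dl = ((nu - 2) * q t - p t) / (2 * nu - 5).
      by rewrite /dl /q /p; field; rewrite gt_eqF.
    rewrite E; apply: le_trans (normr_div_ge1 _ _) _; first by clear -n3; lra.
    apply: le_trans (ler_normB _ _) _; rewrite normrM ger0_norm; last by clear -n3; lra.
    have h : (nu - 2) * `|q t| <= (nu - 2) * N by rewrite ler_wpM2l//; clear -n3; lra.
    clear -h bp N0; lra.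
  have bdk : `|dk| <= nu * N.
    have E : dk = (q t - 2 * p t) / (2 * nu - 5).
      by rewrite /dk /q /p; field; rewrite gt_eqF.
    rewrite E; apply: le_trans (normr_div_ge1 _ _) _; first by clear -n3; lra.
    apply: le_trans (ler_normB _ _) _; rewrite normrM ger0_norm//.
    have h : 3 * N <= nu * N by rewrite ler_wpM2r.
    clear -h bp bq; lra.
  pose xwl := w1 t * l1 t - w2 t * l2 t.
  pose xll := l1 t ^+ 2 - l2 t ^+ 2.
  pose xkl := k1 t * l1 t - k2 t * l2 t.
  pose xww := w1 t ^+ 2 - w2 t ^+ 2.
  have NuN : N <= nu * N by rewrite ler_peMl//; clear -n3; lra.
  have BnN : B * N <= B * (nu * N) by rewrite ler_wpM2l.
  have bxwl : `|xwl| <= 2 * B * nu * N.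
    have -> : xwl = w1 t * dl + l2 t * z t by rewrite /xwl /dl /z; ring.
    apply: le_trans (ler_normD _ _) _.
    have h1 := normrM_le bw1 bdl; have h2 := normrM_le bl2 bz; clear -h1 h2 BnN; lra.
  have bxll : `|xll| <= 2 * B * nu * N.
    have -> : xll = l1 t * dl + l2 t * dl by rewrite /xll /dl; ring.
    apply: le_trans (ler_normD _ _) _.
    have h1 := normrM_le bl1 bdl; have h2 := normrM_le bl2 bdl; clear -h1 h2; lra.
  have bxkl : `|xkl| <= 2 * B * nu * N.
    have -> : xkl = k1 t * dl + l2 t * dk by rewrite /xkl /dl /dk; ring.
    apply: le_trans (ler_normD _ _) _.
    have h1 := normrM_le bk1 bdl; have h2 := normrM_le bl2 bdk; clear -h1 h2; lra.
  have bxww : `|xww| <= 2 * B * N.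
    have -> : xww = w1 t * z t + w2 t * z t by rewrite /xww /z; ring.
    apply: le_trans (ler_normD _ _) _.
    have h1 := normrM_le bw1 bz; have h2 := normrM_le bw2 bz; clear -h1 h2; lra.
  pose dpot := potential_weight kappa (f1 t) - potential_weight kappa (f2 t).
  have bpot : `|dpot| <= t ^+ 2 * (L * N).
    have E : f1 t - f2 t = t ^+ 2 / 2 * eps t by rewrite /eps; field.
    apply: le_trans (potential_weight_lipschitz kappa_ge0 kappa_lt1 (F := B) _ _) _.
    - exact: le_trans (ler_norm _) bf1.
    - exact: le_trans (ler_norm _) bf2.
    rewrite E normrM ger0_norm ?divr_ge0 ?sqr_ge0//.
    have -> : 2 * potential_weight kappa B * (t ^+ 2 / 2 * `|eps t|) =
      t ^+ 2 * (L * `|eps t|) by rewrite /L; field.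
    by rewrite ler_wpM2l ?sqr_ge0// ler_wpM2l.
  pose Xp := xwl - (nu - 1) * xll + 2 * (nu - 2) * xkl.
  pose Xq := 2 * (xwl - (nu - 1) * xll) + 2 * xkl.
  pose Xz := xww - (nu - 1) * xwl.
  have Ep : t * dp = - 3 * p t + z t + t ^+ 2 * Xp.
    rewrite /dp; transitivity (t * dl1 - t * dl2 - (nu - 2) * (t * dk1 - t * dk2)); first by ring.
    by rewrite El1 El2 Ek1 Ek2 /Xp /xwl /xll /xkl /p /z; ring.
  have Eq : t * dq = - 2 * (nu - 1) * q t + 2 * z t + t ^+ 2 * Xq.
    rewrite /dq; transitivity (2 * (t * dl1 - t * dl2) - (t * dk1 - t * dk2)); first by ring.
    by rewrite El1 El2 Ek1 Ek2 /Xq /xwl /xll /xkl /q /z; ring.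
  have Ez : t * dz = - nu * z t - dpot + t ^+ 2 * Xz.
    rewrite /dz mulrBr Ew1 Ew2 /dpot /Xz /xww /xwl /z; ring.
  have Ee : t * de = 2 * z t - 2 * eps t by rewrite /de /z; field.
  have bnx (x : R) : `|x| <= 2 * B * nu * N -> `|(nu - 1) * x| <= nu * (2 * B * nu * N).
    move=> h; apply: normrM_le h; rewrite ger0_norm; clear -n3; lra.
  have bXp : `|Xp| <= (2 * B * nu + 2 * B * nu * nu + 2 * nu * (2 * B * nu)) * N.
    apply: le_trans (ler_normD _ _) _; have := ler_normB xwl ((nu - 1) * xll).
    have h1 := bnx _ bxll.
    have h2 : `|2 * (nu - 2) * xkl| <= 2 * nu * (2 * B * nu * N).
      by apply: normrM_le bxkl; rewrite ger0_norm; clear -n3; lra.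
    move=> h3; clear -h1 h2 h3 bxwl; lra.
  have bXq : `|Xq| <= (2 * (2 * B * nu + 2 * B * nu * nu) + 2 * (2 * B * nu)) * N.
    apply: le_trans (ler_normD _ _) _; have := ler_normB xwl ((nu - 1) * xll).
    have h1 := bnx _ bxll; rewrite [`|2 * (_ - _)|]normrM [`|2 * xkl|]normrM (ger0_norm (_ : 0 <= 2))// => h2; clear -h1 h2 bxwl bxkl; lra.
  have bXz : `|Xz| <= (2 * B + nu * (2 * B * nu)) * N.
    apply: le_trans (ler_normB _ _) _; have h := bnx _ bxwl; clear -h bxww; lra.
  have Y1 := normrM_le bp bXp; have Y2 := normrM_le bq bXq.
  have Y3 := normrM_le bz bXz; have Y4 := normrM_le bz bpot.
  have YC : 2 * (p t * Xp) + 2 * (q t * Xq) + 4 * (z t * Xz) <= (C - 4 * L) * Q t.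
    rewrite -NQ; move: Y1 Y2 Y3; rewrite /C !ler_norml.
    move=> /andP[_ Z1] /andP[_ Z2] /andP[_ Z3]; clear -Z1 Z2 Z3; lra.
  have YL : - 4 * (z t * dpot) <= 4 * L * (t ^+ 2 * Q t).
    rewrite -NQ; move: Y4; rewrite ler_norml => /andP[Z _]; clear -Z; lra.
  have t20 := sqr_ge0 t.
  have YC2 := ler_wpM2l t20 YC.
  have -> : t * (2 * p t * dp + 2 * q t * dq + 4 * z t * dz + 2 * eps t * de) =
    2 * p t * (t * dp) + 2 * q t * (t * dq) + 4 * z t * (t * dz) + 2 * eps t * (t * de) by ring.
  rewrite Ep Eq Ez Ee.
  have s1 := sqr_ge0 (p t - z t); have s2 := sqr_ge0 (q t - z t).
  have s3 := sqr_ge0 (eps t - z t); have s4 := sqr_ge0 (p t).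
  have s5 := sqr_ge0 (q t); have s6 := sqr_ge0 (z t).
  have s7 : 2 * q t ^+ 2 <= (nu - 1) * q t ^+ 2 by rewrite ler_wpM2r//; clear -n3; lra.
  have s8 : 3 * z t ^+ 2 <= nu * z t ^+ 2 by rewrite ler_wpM2r.
  have QE : Q t = p t ^+ 2 + q t ^+ 2 + 2 * z t ^+ 2 + eps t ^+ 2 by [].
  have G1 : (C * t ^+ 2 - 2) * Q t = t ^+ 2 * ((C - 4 * L) * Q t) + 4 * L * (t ^+ 2 * Q t) - 2 * Q t by ring.
  rewrite G1; apply: (@le_trans _ _ (t ^+ 2 * (2 * (p t * Xp) + 2 * (q t * Xq) + 4 * (z t * Xz))
     - 4 * (z t * dpot) - 2 * Q t)); last by clear -YC2 YL; lra.
  rewrite QE; clear -s1 s2 s3 s4 s5 s6 s7 s8; lra.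
have [dQ hQ] := main.
pose BQ := (2 * B + nu * (2 * B)) ^+ 2 + (6 * B) ^+ 2 + 2 * (2 * B) ^+ 2 + (4 * B) ^+ 2.
have QB t : 0 < t < T -> `|Q t| <= BQ.
  move=> tT; rewrite ger0_norm//.
  have [bl1 bw1 bk1 _ bf1] := bound1 _ tT; have [bl2 bw2 bk2 _ bf2] := bound2 _ tT.
  have /andP[t0 _] := tT.
  have sq (x y : R) : `|x| <= y -> x ^+ 2 <= y ^+ 2.
    by move=> h; rewrite -real_normK ?num_real// lerXn2r ?nnegrE// (le_trans _ h).
  have hk : `|k1 t - k2 t| <= 2 * B by apply: le_trans (ler_normB _ _) _; clear -bk1 bk2; lra.
  have hl : `|l1 t - l2 t| <= 2 * B by apply: le_trans (ler_normB _ _) _; clear -bl1 bl2; lra.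
  have h1 : `|p t| <= 2 * B + nu * (2 * B).
    apply: le_trans (ler_normB _ _) _; apply: lerD => //; apply: normrM_le => //.
    rewrite ger0_norm; clear -n3; lra.
  have h2 : `|q t| <= 6 * B.
    apply: le_trans (ler_normB _ _) _; rewrite normrM ger0_norm//; clear -hk hl; lra.
  have h3 : `|z t| <= 2 * B by apply: le_trans (ler_normB _ _) _; clear -bw1 bw2; lra.
  have h4 : `|eps t| <= 4 * B.
    rewrite /eps normrM normfV (gtr0_norm (exprn_gt0 _ t0)) ler_pdivrMr ?exprn_gt0//.
    rewrite normrM (ger0_norm (_ : 0 <= 2))//.
    have -> : f1 t - f2 t = (f1 t - 1) - (f2 t - 1) by ring.
    have := ler_normB (f1 t - 1) (f2 t - 1); clear -bf1 bf2; lra.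
  have := sq _ _ h1; have := sq _ _ h2; have := sq _ _ h3; have := sq _ _ h4.
  rewrite /Q /BQ; clear; lra.
have Qr : Q r <= 0.
  apply: (singular_gronwall (dQ := dQ) (C := C) (B := BQ) (T := T)) => // t tT.
  - by have [] := hQ t tT.
  - by have [] := hQ t tT.
have [bp bq bz be] := component_le r.
have N0 : Num.sqrt (Q r) = 0 by apply/eqP; rewrite sqrtr_eq0.
rewrite N0 !normr_le0 in bp bq bz be.
move: bp bq bz be => /eqP bp /eqP bq /eqP bz /eqP be.
have /andP[r0 _] := rT0.
have kk : k1 r - k2 r = 0.
  have : (2 * nu - 5) * (k1 r - k2 r) = q r - 2 * p r by rewrite /p /q; ring.
  by rewrite bp bq mulr0 subr0 => /eqP; rewrite mulf_eq0 (gt_eqF n5) => /eqP.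
have ll : l1 r - l2 r = 0 by move: bp; rewrite /p kk mulr0 subr0.
split; apply/eqP; rewrite -subr_eq0 ?ll ?kk ?eqxx//.
- by apply/eqP; exact: bz.
- move: be => /eqP; rewrite /eps !mulf_eq0 invr_eq0 (gt_eqF (exprn_gt0 2 r0)) orbF.
  by rewrite pnatr_eq0.
Qed.

(** * Regularity at the origin *)

Section TameFlows.
Context {R : realType}.
Implicit Types (l w k f : R -> R) (r : R).

(** The part of smoothness on R^n that the uniqueness proof uses; it singles out one solution of the
    singular system. The last bound encodes f(0) = 1 without referring to values at r = 0. *)
Definition tame_at_origin l w k f := exists B d : R, 0 < d /\ forall r, 0 < r < d ->
  [/\ `|l r| <= B, `|w r| <= B, `|k r| <= B & `|f r - 1| <= B * r ^+ 2].

Lemma bounded_on_segment (g : R -> R) (a b : R) : a <= b ->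
  (forall r, a <= r <= b -> derivable g r 1) ->
  exists B, forall r, a <= r <= b -> `|g r| <= B.
Proof.
move=> ab hg.
have hc : {within `[a, b], continuous g}.
  by apply: derivable_within_continuous => r; rewrite in_itv; exact: hg.
have [x _ hx] := EVT_max ab hc; have [y _ hy] := EVT_min ab hc.
exists (`|g x| + `|g y|) => r rab.
have rI : r \in `[a, b] by rewrite in_itv.
have := hx r rI; have := hy r rI; have := ler_norm (g x); have := ler_norm (- g y).
rewrite normrN => h1 h2 h3 h4.
by rewrite ler_norml; have := normr_ge0 (g x); have := normr_ge0 (g y); move=> ? ?; apply/andP; split; lra.
Qed.

End TameFlows.

Lemma tame_bounded (R : realType) (nu kappa : R) l w k f (T T' : R) : T' < T -> tame_at_origin l w k f ->
  (forall r : R, 0 < r < T -> radial_flow nu kappa l w k f r) ->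
  exists B, forall r : R, 0 < r < T' ->
   [/\ `|l r| <= B, `|w r| <= B, `|k r| <= B, `|f r| <= B & `|f r - 1| <= B * r ^+ 2].
Proof.
move=> TT [B [d [d0 hB]]] flow.
pose d' := Num.min d 1 / 2.
have m0 : 0 < Num.min d 1 by rewrite lt_min d0 ltr01.
have md : Num.min d 1 <= d by rewrite ge_min lexx.
have m1 : Num.min d 1 <= 1 by rewrite ge_min lexx orbT.
have d'0 : 0 < d' by rewrite /d'; lra.
have d'd : d' < d by rewrite /d'; lra.
have d'1 : d' < 1 by rewrite /d'; lra.
have B0 : 0 <= B.
  have [h _ _ _] := hB d' (ltac:(by rewrite d'0)); exact: le_trans (normr_ge0 _) h.
have near0 r : 0 < r < d' ->
   [/\ `|l r| <= B, `|w r| <= B, `|k r| <= B & `|f r - 1| <= B * r ^+ 2].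
  by move=> /andP[r0 rd]; apply: hB; rewrite r0 (lt_trans rd d'd).
have near1 r : 0 < r < d' -> `|f r| <= B + 1.
  move=> /[dup] rd /near0[_ _ _ h]; have /andP[r0 rd'] := rd.
  have -> : f r = (f r - 1) + 1 by ring.
  apply: le_trans (ler_normD _ _) _; rewrite normr1 lerD2r; apply: le_trans h _.
  by rewrite ler_piMr// exprn_ile1// ltW// (lt_trans rd' d'1).
have [T'd|dT'] := ltP T' d'.
  exists (B + 1) => r /andP[r0 rT].
  have rd : 0 < r < d' by rewrite r0 (lt_trans rT T'd).
  have [h1 h2 h3 h4] := near0 r rd; have h5 := near1 r rd.
  by have h6 := sqr_ge0 r; clear -h1 h2 h3 h4 h5 h6 B0; split; try lra.
have dom r : d' <= r <= T' -> 0 < r < T.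
  by move=> /andP[h1 h2]; rewrite (lt_le_trans d'0 h1) (le_lt_trans h2 TT).
have [Bl hl] : exists B, forall r, d' <= r <= T' -> `|l r| <= B.
  by apply: bounded_on_segment => // r /dom/flow [? [? [? [[[? _] _ _ _] _ _ _]]]].
have [Bw hw] : exists B, forall r, d' <= r <= T' -> `|w r| <= B.
  by apply: bounded_on_segment => // r /dom/flow [? [? [? [[_ [? _] _ _] _ _ _]]]].
have [Bk hk] : exists B, forall r, d' <= r <= T' -> `|k r| <= B.
  by apply: bounded_on_segment => // r /dom/flow [? [? [? [[_ _ [? _] _] _ _ _]]]].
have [Bf hf] : exists B, forall r, d' <= r <= T' -> `|f r| <= B.
  by apply: bounded_on_segment => // r /dom/flow [? [? [? [[_ _ _ [? _]] _ _ _]]]].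
have dd : d' <= d' <= T' by rewrite lexx.
have Bl0 : 0 <= Bl by apply: le_trans (hl _ dd).
have Bw0 : 0 <= Bw by apply: le_trans (hw _ dd).
have Bk0 : 0 <= Bk by apply: le_trans (hk _ dd).
have Bf0 : 0 <= Bf by apply: le_trans (hf _ dd).
(* On [d', T'] the bound Bf + 1 of |f - 1| becomes a multiple of r^2 because r >= d'. *)
pose S := (Bf + 1) / d' ^+ 2.
have S0 : 0 <= S by rewrite /S divr_ge0 ?sqr_ge0//; lra.
exists (B + 1 + Bl + Bw + Bk + Bf + S) => r /andP[r0 rT].
have [rd|dr] := ltP r d'.
  have rd' : 0 < r < d' by rewrite r0.
  have [h1 h2 h3 h4] := near0 r rd'; have h5 := near1 r rd'.
  clear -h1 h2 h3 h4 h5 Bl0 Bw0 Bk0 Bf0 S0 B0; split; try lra; apply: le_trans h4 _; rewrite ler_wpM2r ?sqr_ge0//; clear h1 h2 h3; lra.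
have rr : d' <= r <= T' by rewrite dr ltW.
have := hl r rr; have := hw r rr; have := hk r rr; have h := hf r rr.
move=> h1 h2 h3; clear -h h1 h2 h3 rr dr d'0 r0 Bl0 Bw0 Bk0 Bf0 S0 B0; split; try (clear rr dr d'0 r0; lra).
apply: le_trans (ler_normB _ _) _; rewrite normr1.
apply: (@le_trans _ _ (S * r ^+ 2)); last by rewrite ler_wpM2r ?sqr_ge0//; clear -Bl0 Bw0 Bk0 Bf0 B0; lra.
apply: (@le_trans _ _ (S * d' ^+ 2)).
  by rewrite /S divfK ?lerD2r// expf_neq0// gt_eqF.
by rewrite ler_wpM2l// lerXn2r ?nnegrE ?(ltW r0) ?(ltW d'0).
Qed.

Section TameUniqueness.
Context {R : realType}.
Variables (nu kappa : R).
Implicit Types (l w k f : R -> R) (r : R).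
Hypotheses (nu_ge3 : 3 <= nu) (kappa_ge0 : 0 <= kappa) (kappa_lt1 : kappa < 1).

Lemma radial_flow_unique l1 w1 k1 f1 l2 w2 k2 f2 (T : R) :
  tame_at_origin l1 w1 k1 f1 -> tame_at_origin l2 w2 k2 f2 ->
  (forall r, 0 < r < T -> radial_flow nu kappa l1 w1 k1 f1 r) ->
  (forall r, 0 < r < T -> radial_flow nu kappa l2 w2 k2 f2 r) ->
  forall r, 0 < r < T -> [/\ l1 r = l2 r, w1 r = w2 r, k1 r = k2 r & f1 r = f2 r].
Proof.
move=> t1 t2 h1 h2 r /andP[r0 rT]; pose T' := (r + T) / 2.
have rT' : r < T' by rewrite /T'; lra.
have TT : T' < T by rewrite /T'; lra.
have [B1 b1] := tame_bounded TT t1 h1; have [B2 b2] := tame_bounded TT t2 h2.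
have dom t : 0 < t < T' -> 0 < t < T by move=> /andP[-> tt]; exact: lt_trans tt TT.
have B10 : 0 <= B1.
  by have [h _ _ _ _] := b1 r (ltac:(by rewrite r0)); apply: le_trans (normr_ge0 _) h.
have B20 : 0 <= B2.
  by have [h _ _ _ _] := b2 r (ltac:(by rewrite r0)); apply: le_trans (normr_ge0 _) h.
apply: (@radial_flow_unique_bounded R nu kappa l1 w1 k1 f1 l2 w2 k2 f2 (B1 + B2) T') => //.
- by move=> t /dom; exact: h1.
- by move=> t /dom; exact: h2.
- move=> t /b1[h1' h2' h3' h4' h]; have ht := sqr_ge0 t; split; try (clear -h1' h2' h3' h4' B20; lra).
  by apply: le_trans h _; rewrite ler_wpM2r//; lra.
- move=> t /b2[h1' h2' h3' h4' h]; have ht := sqr_ge0 t; split; try (clear -h1' h2' h3' h4' B10; lra).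
  by apply: le_trans h _; rewrite ler_wpM2r//; lra.
- by rewrite r0.
Qed.

End TameUniqueness.

(** * A priori bounds and global existence *)

Lemma eq_divr_mull (F : fieldType) (t x y : F) : t != 0 -> t * x = y -> x = y / t.
Proof. by move=> t0 <-; rewrite mulrC mulKf. Qed.

Section Positivity.
Context {R : realType}.
Implicit Types (p dp : R -> R).

Lemma first_nonpos p (a t : R) : a <= t -> (forall x, a <= x <= t -> {for x, continuous p}) ->
  0 < p a -> p t <= 0 ->
  exists z, [/\ a < z, z <= t, p z <= 0 & forall x, a <= x < z -> 0 < p x].
Proof.
move=> at_ cp pa pt.
pose S := [set x | a <= x <= t /\ forall y, a <= y <= x -> 0 < p y].
have Sa : S a.
  by split; [rewrite lexx|move=> y /andP[h1 h2]; have -> : y = a by apply: le_anti; rewrite h1 h2].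
have Sub : ubound S t by move=> x [/andP[]].
have hS : has_sup S by split; [exists a|exists t].
pose z := sup S.
have az : a <= z by apply: ub_le_sup => //; exists t.
have zt : z <= t by apply: ge_sup => //; exists a.
have pos x : a <= x < z -> 0 < p x.
  move=> /andP[ax xz].
  have [y Sy xy] : exists2 y, S y & x < y.
    by apply: sup_gt => //; exists a.
  by case: Sy => _; apply; rewrite ax ltW.
have pz : p z <= 0.
  rewrite leNgt; apply/negP => pz.
  have zdom : a <= z <= t by rewrite az zt.
  have := cp z zdom => /cvgrPdist_lt /(_ _ pz) [e/= e0 he].
  have pe y : `|y - z| < e -> 0 < p y.
    move=> ye; have := he y; rewrite /ball_ /= distrC => /(_ ye).
    by rewrite ltr_norml => /andP[_ ?]; lra.
  have ztl : z < t.
    rewrite lt_neqAle zt andbT; apply/eqP => E.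
    by move: pz; rewrite E ltNge pt.
  pose y := Num.min t (z + e / 2).
  have zy : z < y by rewrite lt_min ztl ltrDl divr_gt0.
  have ye : y <= z + e / 2 by rewrite ge_min lexx orbT.
  have yt : y <= t by rewrite ge_min lexx.
  suff : S y by move=> Sy; have := ub_le_sup (ex_intro _ t Sub : has_ubound S) Sy; rewrite -/z leNgt zy.
  split; first by rewrite yt (le_trans az (ltW zy)).
  move=> x /andP[ax xy]; have [xz|zx] := ltP x z; first by apply: pos; rewrite ax.
  apply: pe; rewrite ger0_norm; lra.
exists z; split=> //; rewrite lt_neqAle az andbT; apply/eqP => E.
by move: pz; rewrite -E leNgt pa.
Qed.

(** Up to the first point where p fails to be positive, p exp(B x) is nondecreasing, so p is
    positive at that point as well, a contradiction. The inequality is asked only where p > 0, which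
    allows equations that are not linear in p. *)
Lemma derive_ge_linear_gt0 p dp (B a t : R) : a <= t ->
  (forall x, a <= x <= t -> is_derive x 1 p (dp x)) ->
  (forall x, a <= x <= t -> 0 < p x -> - B * p x <= dp x) ->
  0 < p a -> 0 < p t.
Proof.
move=> at_ hp hd pa; rewrite ltNge; apply/negP => pt.
have cp x : a <= x <= t -> {for x, continuous p}.
  by move=> /hp/is_derive_continuous.
have [z [az zt pz pos]] := first_nonpos at_ cp pa pt.
pose E x := p x * expR (B * x).
have hE x : a <= x <= z -> is_derive x 1 E ((dp x + B * p x) * expR (B * x)).
  move=> /andP[ax xz]; have h := hp x (ltac:(by rewrite ax (le_trans xz zt))).
  by derive_eq; ring.
have [c /andP[ac cz] Ec] := mean_value az hE.
have : 0 < E z.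
  have -> : E z = E a + (E z - E a) by ring.
  rewrite Ec ltr_wpDr// ?mulr_gt0 ?expR_gt0// mulr_ge0//; last by rewrite subr_ge0 ltW.
  rewrite mulr_ge0 ?expR_ge0//.
  have pc : 0 < p c by apply: pos; rewrite cz ltW.
  have := hd c (ltac:(by rewrite !ltW ?(lt_le_trans cz zt))) pc; lra.
by rewrite /E pmulr_lgt0 ?expR_gt0// ltNge pz.
Qed.
End Positivity.

Section Hamiltonian.
Context {R : realType}.
Variables (nu kappa : R) (l w k f : R -> R).

(** With L = 1/r + r l, V = - r w and K = 1/r^2 + k this is (1 - kappa) V^2 + 2 (nu - 1) V L + (nu -
    1)(nu - 2)(L^2 - K) - e, the radial Einstein equation after the flow has been used to eliminate
    the derivatives. *)
Definition hamiltonian (r : R) : R := (1 - kappa) * r ^+ 2 * w r ^+ 2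
  - 2 * (nu - 1) * w r * (1 + r ^+ 2 * l r)
  + (nu - 1) * (nu - 2) * (2 * l r + r ^+ 2 * l r ^+ 2 - k r) - potential_weight kappa (f r).

Definition admissible_flow (T : R) : Prop :=
  [/\ 3 <= nu, 0 <= kappa < 1, forall r : R, 0 < r < T -> radial_flow nu kappa l w k f r,
      tame_at_origin l w k f & exists2 d : R, 0 < d & forall r : R, 0 < r < d -> w r < 0].

Lemma admissible_bounded (T T' : R) : admissible_flow T -> T' < T ->
  exists2 B : R, 0 <= B & forall r : R, 0 < r < T' ->
   [/\ `|l r| <= B, `|w r| <= B, `|k r| <= B, `|f r| <= B & `|f r - 1| <= B * r ^+ 2].
Proof.
move=> [_ _ flow tame _] TT; have [B hB] := tame_bounded TT tame flow.
exists `|B| => // r rT; have BB := ler_norm B.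
have [h1 h2 h3 h4 h5] := hB r rT; split; try exact: le_trans BB.
by apply: le_trans h5 _; rewrite ler_wpM2r// sqr_ge0.
Qed.

End Hamiltonian.

(** Along the flow r F' = c F with c = - 2 (nu - 1) + O(r^2), so a nonzero F would blow up like a
    negative power of r, while tameness keeps it bounded. [singular_gronwall] is applied to F^2. *)
Lemma hamiltonian_eq0 (R : realType) (nu kappa : R) (l w k f : R -> R) (T : R) :
  admissible_flow nu kappa l w k f T ->
  forall r : R, 0 < r < T -> hamiltonian nu kappa l w k f r = 0.
Proof.
move=> adm r /andP[r0 rT]; have [n3 /andP[k0 k1] flow _ _] := adm.
pose F := hamiltonian nu kappa l w k f; rewrite -/(F r).
pose T' := (r + T) / 2.
have rT' : r < T' by rewrite /T'; lra.
have TT : T' < T by rewrite /T'; lra.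
have [B B0 hB] := admissible_bounded adm TT.
pose c t := - 2 * ((nu - 1) * (1 + t ^+ 2 * l t) - t ^+ 2 * w t).
have hF t : 0 < t < T' -> is_derive t 1 F (c t * F t / t).
  move=> /andP[t0 tT]; have tT2 : 0 < t < T by rewrite t0 (lt_trans tT TT).
  have [dl [dw [dk [[hl hw hk hf] El Ew Ek]]]] := flow _ tT2.
  have tn0 : t != 0 by rewrite gt_eqF.
  have hpot := is_derive_potential_weight kappa hf.
  rewrite /F /hamiltonian; derive_eq; rewrite /=.
  have -> : dl = ((nu - 2) * k t - (2 * nu - 1) * l t + w t
        + t ^+ 2 * (w t * l t - (nu - 1) * l t ^+ 2)) / t by apply: (eq_divr_mull _ El).
  have -> : dw = (- nu * w t - potential_weight kappa (f t)
        + t ^+ 2 * (w t ^+ 2 - (nu - 1) * l t * w t)) / t by apply: (eq_divr_mull _ Ew).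
  have -> : dk = (- 2 * k t - 2 * l t - 2 * t ^+ 2 * k t * l t) / t by apply: (eq_divr_mull _ Ek).
  by rewrite /c /F /hamiltonian; field.
pose Q t := F t ^+ 2.
suff : Q r <= 0.
  by rewrite /Q => h; apply/eqP; rewrite -sqrf_eq0 eq_le h sqr_ge0.
pose P := potential_weight kappa B.
have P0 : 0 <= P by rewrite /P /potential_weight divr_ge0 ?expR_ge0// subr_ge0 ltW.
pose S := T' ^+ 2.
have S0 : 0 <= S by exact: sqr_ge0.
pose D := S * B ^+ 2 + 2 * nu * B * (1 + S * B) + nu * nu * (2 * B + S * B ^+ 2 + B) + P.
have rdom : 0 < r < T' by rewrite r0.
apply: (singular_gronwall (Q := Q) (dQ := fun t => 2 * c t / t * Q t)
   (C := 4 * nu * B + 4 * B) (B := D ^+ 2) (T := T')) rdom.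
- move=> t tT; have h := hF t tT; rewrite /Q; derive_eq; rewrite /=; ring.
- move=> t tT; have [hl hw _ _ _] := hB t tT; have /andP[t0 _] := tT.
  have -> : t * (2 * c t / t * Q t) = 2 * c t * Q t by field; rewrite gt_eqF.
  rewrite ler_wpM2r ?sqr_ge0// /c.
  have t20 : 0 <= t ^+ 2 by exact: sqr_ge0.
  have h1 : - l t <= B by apply: le_trans (ler_norm _) _; rewrite normrN.
  have h2 : w t <= B by apply: le_trans (ler_norm _) _.
  have h3 : t ^+ 2 * w t <= t ^+ 2 * B by rewrite ler_wpM2l.
  have h4 : t ^+ 2 * ((nu - 1) * - l t) <= t ^+ 2 * (nu * B).
    rewrite ler_wpM2l//; apply: (@le_trans _ _ ((nu - 1) * B)); first by rewrite ler_wpM2l//; lra.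
    rewrite ler_wpM2r//; lra.
  clear -h3 h4 n3; lra.
- move=> t tT; have [hl hw hk hf _] := hB t tT; have /andP[t0 tT'] := tT.
  have t2S : `|t ^+ 2| <= S by rewrite ger0_norm ?sqr_ge0// lerXn2r ?nnegrE ?(ltW t0) ?(ltW tT')// ltW// (lt_trans t0).
  have D0 : `|F t| <= D.
    have hl2 : `|l t ^+ 2| <= B ^+ 2 by apply: normrM_le.
    have hw2 : `|w t ^+ 2| <= B ^+ 2 by apply: normrM_le.
    have a1 : `|(1 - kappa) * t ^+ 2 * w t ^+ 2| <= S * B ^+ 2.
      apply: normrM_le => //; rewrite -[S]mul1r; apply: normrM_le => //.
      by rewrite ger0_norm; clear -k0 k1; lra.
    have a2 : `|2 * (nu - 1) * w t * (1 + t ^+ 2 * l t)| <= 2 * nu * B * (1 + S * B).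
      apply: normrM_le; first by apply: normrM_le => //; rewrite ger0_norm; clear -n3; lra.
      by apply: le_trans (ler_normD _ _) _; rewrite normr1 lerD2l; apply: normrM_le.
    have a3 : `|(nu - 1) * (nu - 2) * (2 * l t + t ^+ 2 * l t ^+ 2 - k t)| <=
        nu * nu * (2 * B + S * B ^+ 2 + B).
      apply: normrM_le; first by apply: normrM_le; rewrite ger0_norm; clear -n3; lra.
      apply: le_trans (ler_normB _ _) _; apply: lerD => //.
      apply: le_trans (ler_normD _ _) _; apply: lerD; apply: normrM_le => //.
      by rewrite ger0_norm.
    have a4 : `|potential_weight kappa (f t)| <= P.
      rewrite ger0_norm; last by rewrite /potential_weight divr_ge0 ?expR_ge0// subr_ge0 ltW.
      rewrite /P /potential_weight ler_wpM2r ?invr_ge0 ?subr_ge0 ?(ltW k1)// ler_expR.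
      by rewrite ler_wpM2l ?mulr_ge0// (le_trans (ler_norm _) hf).
    rewrite /F /hamiltonian /D; apply: le_trans (ler_normB _ _) _; apply: lerD => //.
    apply: le_trans (ler_normD _ _) _; apply: lerD => //.
    by apply: le_trans (ler_normB _ _) _; apply: lerD.
  rewrite ger0_norm ?sqr_ge0// /Q -real_normK ?num_real// lerXn2r ?nnegrE//.
  exact: le_trans (normr_ge0 _) D0.
Qed.

Lemma signs_near_origin (R : realType) (nu kappa : R) (l w k f : R -> R) (T : R) :
  admissible_flow nu kappa l w k f T ->
  exists2 d : R, 0 < d & forall r : R, 0 < r <= d ->
  [/\ 0 < 1 + r ^+ 2 * k r, 0 < 1 + r ^+ 2 * l r & w r < 0].
Proof.
move=> [_ _ _ [B [d [d0 hB]]] [e e0 he]].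
pose m := Num.min (Num.min d e) (Num.min 1 (1 + `|B|)^-1) / 2.
have B1 : 0 < 1 + `|B| by rewrite ltr_pwDl.
have m0 : 0 < m by rewrite /m divr_gt0// !lt_min d0 e0 ltr01 invr_gt0 B1.
have mm : Num.min (Num.min d e) (Num.min 1 (1 + `|B|)^-1) = 2 * m by rewrite /m; field.
have md : 2 * m <= d by rewrite -mm !ge_min lexx.
have me : 2 * m <= e by rewrite -mm !ge_min lexx orbT.
have m1 : 2 * m <= 1 by rewrite -mm !ge_min lexx !orbT.
have mB : 2 * m <= (1 + `|B|)^-1 by rewrite -mm !ge_min lexx !orbT.
exists m => // r /andP[r0 rm].
have [hl _ hk _] := hB r (ltac:(by rewrite r0; lra)).
have rr : r ^+ 2 <= r by rewrite expr2 ler_piMl ?(ltW r0)//; lra.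
have sm (x : R) : `|x| <= B -> 0 < 1 + r ^+ 2 * x.
  move=> xB; have h1 : - x <= `|B| by apply: le_trans (ler_norm _) _; rewrite normrN; apply: le_trans xB (ler_norm _).
  have h2 : r ^+ 2 * - x <= r ^+ 2 * `|B| by rewrite ler_wpM2l// sqr_ge0.
  have h3 : r ^+ 2 * `|B| <= m * (1 + `|B|).
    apply: ler_pM; rewrite ?sqr_ge0//; [exact: le_trans rr rm|by rewrite lerDr].
  have h4 : 2 * m * (1 + `|B|) <= 1 by rewrite -ler_pdivlMr// mul1r.
  lra.
split; [exact: sm|exact: sm|apply: he; rewrite r0/=; lra].
Qed.

(** Three uses of [derive_ge_linear_gt0], in an order that matters. For - w the source is the
    positive weight; 1 + r^2 k solves a linear homogeneous equation; the equation of 1 + r^2 l has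
    the source (nu - 2)(1 + r^2 k), whose sign must be known first. *)
Lemma a_priori_signs (R : realType) (nu kappa : R) (l w k f : R -> R) (T : R) :
  admissible_flow nu kappa l w k f T -> forall r : R, 0 < r < T ->
  [/\ 0 < 1 + r ^+ 2 * k r, 0 < 1 + r ^+ 2 * l r & w r < 0].
Proof.
move=> adm r /andP[r0 rT]; have [n3 /andP[k0 k1] flow _ _] := adm.
have [d d0 hd] := signs_near_origin adm.
have [rd|dr] := leP r d; first by apply: hd; rewrite r0.
pose T' := (r + T) / 2.
have rT' : r < T' by rewrite /T'; lra.
have TT : T' < T by rewrite /T'; lra.
have [B B0 hB] := admissible_bounded adm TT.
have dd : 0 < d <= d by rewrite d0 lexx.
have [pd Ld wd] := hd d dd.
have dom t : d <= t <= r -> [/\ 0 < t, 0 < t < T' & 0 < t < T].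
  move=> /andP[h1 h2]; have t0 := lt_le_trans d0 h1; have tT := le_lt_trans h2 rT'.
  by rewrite t0 tT (lt_trans tT TT).
have wneg t : d <= t <= r -> w t < 0.
  move=> /andP[dt tr].
  pose u t := - w t.
  pose du t := (- nu * u t + potential_weight kappa (f t) + t ^+ 2 * u t * (w t - (nu - 1) * l t)) / t.
  have hu x : d <= x <= t -> is_derive x 1 u (du x).
    move=> /andP[dx xt]; have [x0 _ xT] := dom x (ltac:(by rewrite dx (le_trans xt tr))).
    have [dl [dw [dk [[hl hw hk hf] El Ew Ek]]]] := flow _ xT.
    rewrite /u; derive_eq; rewrite /du /u.
    have -> : dw = (- nu * w x - potential_weight kappa (f x)
        + x ^+ 2 * (w x ^+ 2 - (nu - 1) * l x * w x)) / x by apply: (eq_divr_mull _ Ew); rewrite gt_eqF.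
    by field; rewrite gt_eqF.
  have ud : 0 < u d by rewrite /u oppr_gt0.
  suff : 0 < u t by rewrite /u oppr_gt0.
  apply: (derive_ge_linear_gt0 (B := nu / d + r * (B + nu * B)) dt hu _ ud) => x /andP[dx xt] ux.
  have [x0 xT' _] := dom x (ltac:(by rewrite dx (le_trans xt tr))).
  have [hl hw _ _ _] := hB x xT'.
  have E : du x = - (nu / x) * u x + potential_weight kappa (f x) / x + u x * (x * (w x - (nu - 1) * l x)).
    by rewrite /du; field; rewrite gt_eqF.
  rewrite E.
  have h1 : 0 <= potential_weight kappa (f x) / x.
    by rewrite /potential_weight !divr_ge0 ?expR_ge0 ?(ltW x0)// subr_ge0 ltW.
  have h2 : nu / x * u x <= nu / d * u x.
    rewrite ler_wpM2r ?(ltW ux)// ler_wpM2l ?lef_pV2//; lra.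
  have h3 : `|x * (w x - (nu - 1) * l x)| <= r * (B + nu * B).
    apply: normrM_le; first by rewrite ger0_norm ?(ltW x0)// (le_trans xt tr).
    apply: le_trans (ler_normB _ _) _; apply: lerD => //; apply: normrM_le => //.
    by rewrite ger0_norm; clear -n3; lra.
  have h4 : u x * (- (x * (w x - (nu - 1) * l x))) <= u x * (r * (B + nu * B)).
    by rewrite ler_wpM2l ?(ltW ux)// (le_trans (ler_norm _))// normrN.
  clear -h1 h2 h4; lra.
have ppos t : d <= t <= r -> 0 < 1 + t ^+ 2 * k t.
  move=> /andP[dt tr].
  pose p t := 1 + t ^+ 2 * k t; pose dp t := - 2 * t * l t * p t.
  have hp x : d <= x <= t -> is_derive x 1 p (dp x).
    move=> /andP[dx xt]; have [x0 _ xT] := dom x (ltac:(by rewrite dx (le_trans xt tr))).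
    have [dl [dw [dk [[hl hw hk hf] El Ew Ek]]]] := flow _ xT.
    rewrite /p; derive_eq; rewrite /dp /p /=.
    have -> : dk = (- 2 * k x - 2 * l x - 2 * x ^+ 2 * k x * l x) / x by apply: (eq_divr_mull _ Ek); rewrite gt_eqF.
    by field; rewrite gt_eqF.
  apply: (derive_ge_linear_gt0 (B := 2 * (r * B)) dt hp _ pd) => x /andP[dx xt] px.
  have [x0 xT' _] := dom x (ltac:(by rewrite dx (le_trans xt tr))).
  have [hl _ _ _ _] := hB x xT'.
  have h3 : `|x * l x| <= r * B.
    by apply: normrM_le => //; rewrite ger0_norm ?(ltW x0)// (le_trans xt tr).
  have h4 : p x * (x * l x) <= p x * (r * B).
    by rewrite ler_wpM2l ?(ltW px)// (le_trans (ler_norm _)).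
  rewrite /dp; clear -h4; lra.
split; [by apply: ppos; rewrite (ltW dr) lexx| |by apply: wneg; rewrite (ltW dr) lexx].
pose La t := 1 + t ^+ 2 * l t.
pose dLa t := ((nu - 2) * (1 + t ^+ 2 * k t) + La t * (t ^+ 2 * w t - (nu - 1) * La t + 1)) / t.
have hLa x : d <= x <= r -> is_derive x 1 La (dLa x).
  move=> xr; have [x0 _ xT] := dom x xr.
  have [dl [dw [dk [[hl hw hk hf] El Ew Ek]]]] := flow _ xT.
  rewrite /La; derive_eq; rewrite /dLa /La /=.
  have -> : dl = ((nu - 2) * k x - (2 * nu - 1) * l x + w x
        + x ^+ 2 * (w x * l x - (nu - 1) * l x ^+ 2)) / x by apply: (eq_divr_mull _ El); rewrite gt_eqF.
  by field; rewrite gt_eqF.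
apply: (derive_ge_linear_gt0 (B := r * B + nu * (1 + r ^+ 2 * B) / d) (ltW dr) hLa _ Ld) => x xr Lx.
have [x0 xT' _] := dom x xr; have /andP[dx xr'] := xr.
have [hl hw _ _ _] := hB x xT'; have px := ppos x xr.
have E : dLa x = (nu - 2) * (1 + x ^+ 2 * k x) / x + La x / x + La x * (x * w x)
   - La x * ((nu - 1) * La x / x).
  by rewrite /dLa; field; rewrite gt_eqF.
have h1 : 0 <= (nu - 2) * (1 + x ^+ 2 * k x) / x.
  by rewrite divr_ge0 ?(ltW x0)// mulr_ge0 ?(ltW px)//; lra.
have h2 : 0 <= La x / x by rewrite divr_ge0 ?(ltW x0)// ltW.
have h3 : La x * (- (x * w x)) <= La x * (r * B).
  rewrite ler_wpM2l ?(ltW Lx)// (le_trans (ler_norm _))// normrN; apply: normrM_le => //.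
  by rewrite ger0_norm// ltW.
have x2 : x ^+ 2 <= r ^+ 2 by rewrite lerXn2r ?nnegrE ?(ltW x0) ?(ltW r0).
have h5 : La x <= 1 + r ^+ 2 * B.
  rewrite /La lerD2l (le_trans (ler_norm _))//; apply: normrM_le => //.
  by rewrite ger0_norm ?sqr_ge0.
have h6 : (nu - 1) * La x / x <= nu * (1 + r ^+ 2 * B) / d.
  apply: ler_pM; rewrite ?invr_ge0 ?(ltW x0)//.
  - by rewrite mulr_ge0 ?(ltW Lx)//; clear -n3; lra.
  - by apply: ler_pM => //; rewrite ?(ltW Lx)//; clear -n3; lra.
  - by rewrite lef_pV2.
have h4 : La x * ((nu - 1) * La x / x) <= La x * (nu * (1 + r ^+ 2 * B) / d).
  by rewrite ler_wpM2l ?(ltW Lx).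
rewrite E; clear -h1 h2 h3 h4; lra.
Qed.

(** The signs make K and f nonincreasing, hence also the weight, so the right side of [EH] stays
    below its value at r1. The left side is a sum of three nonnegative terms, the cross term because
    - w and 1 + r^2 l are positive. Only the data at r1 enter the bound. *)
Lemma a_priori_bound (R : realType) (nu kappa : R) (l w k f : R -> R) (T : R) (r1 A : R) :
  admissible_flow nu kappa l w k f T -> 0 < r1 < T ->
  (nu - 1) * (nu - 2) * ((1 + r1 ^+ 2 * k r1) / r1 ^+ 2) + potential_weight kappa (f r1) <= A ->
  forall r : R, r1 <= r < T ->
  [/\ r ^+ 2 * w r ^+ 2 <= A / (1 - kappa), (r^-1 + r * l r) ^+ 2 <= A,
      0 < (1 + r ^+ 2 * k r) / r ^+ 2 <= A & potential_weight kappa (f r) <= A].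
Proof.
move=> adm /andP[r10 r1T] hA r /andP[r1r rT]; have [n3 /andP[k0 k1] flow _ _] := adm.
have r0 := lt_le_trans r10 r1r.
pose K t := (1 + t ^+ 2 * k t) / t ^+ 2.
have dom t : r1 <= t <= r -> 0 < t /\ 0 < t < T.
  by move=> /andP[h1 h2]; rewrite (lt_le_trans r10 h1) (le_lt_trans h2 rT).
have KK : K r <= K r1.
  apply: (@derive_le0_le _ K (fun t => - 2 * K t * (1 + t ^+ 2 * l t) / t)) => // t /dom[t0 tT].
    have [dl [dw [dk [[hl hw hk hf] El Ew Ek]]]] := flow _ tT.
    have t2 : t ^+ 2 != 0 by rewrite expf_neq0 ?gt_eqF.
    rewrite /K; derive_eq; rewrite //=.
    have -> : dk = (- 2 * k t - 2 * l t - 2 * t ^+ 2 * k t * l t) / t by apply: (eq_divr_mull _ Ek); rewrite gt_eqF.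
    by field; rewrite gt_eqF.
  have [h1 h2 _] := a_priori_signs adm tT.
  rewrite !mulNr oppr_le0 divr_ge0 ?(ltW t0)// mulr_ge0 ?(ltW h2)// mulr_ge0// /K.
  by rewrite divr_ge0 ?(ltW h1)// sqr_ge0.
have ff : f r <= f r1.
  apply: (@derive_le0_le _ f (fun t => t * w t)) => // t /dom[t0 tT].
    by have [dl [dw [dk [[hl hw hk hf] El Ew Ek]]]] := flow _ tT.
  by have [_ _ h] := a_priori_signs adm tT; rewrite mulr_ge0_le0 ?(ltW t0)// ltW.
have ee : potential_weight kappa (f r) <= potential_weight kappa (f r1).
  rewrite /potential_weight ler_wpM2r ?invr_ge0 ?subr_ge0 ?(ltW k1)// ler_expR.
  by rewrite ler_wpM2l// mulr_ge0.
have rdom : 0 < r < T by rewrite r0.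
have [p0 L0 w0] := a_priori_signs adm rdom.
have H0 := hamiltonian_eq0 adm rdom.
have K0 : 0 < K r by rewrite /K divr_gt0// exprn_gt0.
have e0 : 0 <= potential_weight kappa (f r).
  by rewrite /potential_weight divr_ge0 ?expR_ge0// subr_ge0 ltW.
have n2 : 2 <= (nu - 1) * (nu - 2).
  have : 2 * 1 <= (nu - 1) * (nu - 2) by apply: ler_pM; clear -n3; lra.
  lra.
have nK : (nu - 1) * (nu - 2) * K r <= (nu - 1) * (nu - 2) * K r1 by rewrite ler_wpM2l//; lra.
have AA : (nu - 1) * (nu - 2) * K r + potential_weight kappa (f r) <= A.
  by apply: le_trans hA; rewrite lerD.
have rn0 : r != 0 by rewrite gt_eqF.
pose L := r^-1 + r * l r.
have EH : (1 - kappa) * (r ^+ 2 * w r ^+ 2) + 2 * (nu - 1) * (- w r * (1 + r ^+ 2 * l r))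
   + (nu - 1) * (nu - 2) * L ^+ 2 = (nu - 1) * (nu - 2) * K r + potential_weight kappa (f r).
  apply/eqP; rewrite -subr_eq0; apply/eqP; rewrite -[RHS]H0 /hamiltonian /K /L.
  by field.
have g1 : 0 <= (1 - kappa) * (r ^+ 2 * w r ^+ 2).
  by rewrite mulr_ge0 ?subr_ge0 ?(ltW k1)// mulr_ge0// sqr_ge0.
have g2 : 0 <= 2 * (nu - 1) * (- w r * (1 + r ^+ 2 * l r)).
  by rewrite !mulr_ge0 ?oppr_ge0 ?(ltW w0) ?(ltW L0)//; lra.
have g3 : 0 <= (nu - 1) * (nu - 2) * L ^+ 2 by rewrite mulr_ge0 ?sqr_ge0//; lra.
have g4 : 2 * L ^+ 2 <= (nu - 1) * (nu - 2) * L ^+ 2 by rewrite ler_wpM2r// sqr_ge0.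
have g5 : 2 * K r <= (nu - 1) * (nu - 2) * K r by rewrite ler_wpM2r// ltW.
have g6 := sqr_ge0 L.
have K0' := ltW K0.
split.
- rewrite ler_pdivlMr ?subr_gt0// mulrC; clear -EH AA g1 g2 g3; lra.
- rewrite -/L; clear -EH AA g1 g2 g3 g4 g6; lra.
- rewrite -/(K r) K0/=; clear -AA g5 e0 K0'; lra.
- clear -AA g5 e0 K0'; lra.
Qed.


(** * Gluing and continuation of solutions to all s *)

Section Gluing.
Context {R : realType}.

Definition glue (c : R) (f g : R -> R) (x : R) : R := if x < c then f x else g x.

Lemma near_glue_lt (c : R) (f g : R -> R) (s : R) : s < c -> \near s, f s = glue c f g s.
Proof. by move=> sc; near=> x; rewrite /glue; have -> : x < c by near: x; exact: lt_nbhsl. Unshelve. all: by end_near. Qed.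

Lemma near_glue_gt (c : R) (f g : R -> R) (s : R) : c < s -> \near s, g s = glue c f g s.
Proof.
move=> sc; near=> x; rewrite /glue ltNge.
by have -> : c <= x by apply: ltW; near: x; exact: lt_nbhsr.
Unshelve. all: by end_near. Qed.

(** The Caratheodory slope functions of the two sides glue to a slope function continuous at c,
    which avoids one-sided derivatives. *)
Lemma is_derive_glue (c d : R) (f g : R -> R) :
  is_derive c 1 f d -> is_derive c 1 g d -> f c = g c -> is_derive c 1 (glue c f g) d.
Proof.
move=> /is_derive1_caratheodory[pf [hf cf pfd]] /is_derive1_caratheodory[pg [hg cg pgd]] E.
apply/is_derive1_caratheodory; exists (glue c pf pg); split.
- by move=> z; rewrite /glue ltxx; case: ifP => _; [rewrite -hf E|rewrite -hg].
- apply/cvgrPdist_lt => e e0.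
  move/cvgrPdist_lt/(_ e e0) : cf => h1; move/cvgrPdist_lt/(_ e e0) : cg => h2.
  near=> z; rewrite {1}/glue ltxx /glue; case: ifP => _.
    by rewrite pgd -pfd; near: z.
  by near: z.
- by rewrite /glue ltxx.
Unshelve. all: by end_near. Qed.

Lemma reduced_flow_near (nu kappa : R) (l w k f l' w' k' f' : R -> R) (s : R) :
  (\near s, l s = l' s) -> (\near s, w s = w' s) -> (\near s, k s = k' s) ->
  (\near s, f s = f' s) -> reduced_flow nu kappa l w k f s ->
  reduced_flow nu kappa l' w' k' f' s.
Proof.
move=> hl hw hk hf [dl [dw [dk [[dl1 dw1 dk1 df1] El Ew Ek]]]].
exists dl, dw, dk.
rewrite -(nbhs_singleton hl) -(nbhs_singleton hw) -(nbhs_singleton hk) -(nbhs_singleton hf).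
split=> //; split; [exact: near_eq_is_derive dl1|exact: near_eq_is_derive dw1|
  exact: near_eq_is_derive dk1|exact: near_eq_is_derive df1].
Qed.

(** For s > 0 the equations determine the derivatives from the values, so matching values at the
    seam force matching derivatives. *)
Lemma reduced_flow_glue (nu kappa : R) (l w k f l' w' k' f' : R -> R) (s : R) : 0 < s ->
  l s = l' s -> w s = w' s -> k s = k' s -> f s = f' s ->
  reduced_flow nu kappa l w k f s -> reduced_flow nu kappa l' w' k' f' s ->
  reduced_flow nu kappa (glue s l l') (glue s w w') (glue s k k') (glue s f f') s.
Proof.
move=> s0 hl hw hk hf [dl [dw [dk [[dl1 dw1 dk1 df1] El Ew Ek]]]].
move=> [dl' [dw' [dk' [[dl2 dw2 dk2 df2] El' Ew' Ek']]]].
have s2 : 2 * s != 0 by rewrite gt_eqF// mulr_gt0.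
have Dl : dl = dl' by apply: (mulfI s2); rewrite El El' hl hw hk.
have Dw : dw = dw' by apply: (mulfI s2); rewrite Ew Ew' hl hw hf.
have Dk : dk = dk' by apply: (mulfI s2); rewrite Ek Ek' hl hk.
subst dl' dw' dk'.
exists dl, dw, dk; rewrite /glue ltxx; split=> //; split.
- exact: is_derive_glue.
- exact: is_derive_glue.
- exact: is_derive_glue.
- by apply: is_derive_glue => //; rewrite -hw.
Qed.

End Gluing.

Lemma tame_reduced_flow (R : realType) (nu kappa : R) (l w k f : R -> R) (e : R) :
  3 <= nu -> 0 <= kappa < 1 -> 0 < e ->
  (forall s : R, - e < s < e -> reduced_flow nu kappa l w k f s) -> f 0 = 1 ->
  tame_at_origin (fun r => l (r ^+ 2 / 2)) (fun r => w (r ^+ 2 / 2))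
    (fun r => k (r ^+ 2 / 2)) (fun r => f (r ^+ 2 / 2)) /\
  exists2 d : R, 0 < d & forall r : R, 0 < r < d -> w (r ^+ 2 / 2) < 0.
Proof.
move=> n3 /andP[k0 k1] e0 flow f0.
have e2 : 0 <= e / 2 by lra.
have dom s : 0 <= s <= e / 2 -> - e < s < e by move=> /andP[h1 h2]; apply/andP; split; lra.
have [Bl hl] : exists B, forall s, 0 <= s <= e / 2 -> `|l s| <= B.
  by apply: bounded_on_segment => // s /dom/flow [? [? [? [[[? _] _ _ _] _ _ _]]]].
have [Bw hw] : exists B, forall s, 0 <= s <= e / 2 -> `|w s| <= B.
  by apply: bounded_on_segment => // s /dom/flow [? [? [? [[_ [? _] _ _] _ _ _]]]].
have [Bk hk] : exists B, forall s, 0 <= s <= e / 2 -> `|k s| <= B.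
  by apply: bounded_on_segment => // s /dom/flow [? [? [? [[_ _ [? _] _] _ _ _]]]].
have dom0 : 0 <= (0 : R) <= e / 2 by rewrite lexx.
have Bl0 : 0 <= Bl by apply: le_trans (hl 0 dom0).
have Bw0 : 0 <= Bw by apply: le_trans (hw 0 dom0).
have Bk0 : 0 <= Bk by apply: le_trans (hk 0 dom0).
pose d := Num.min 1 e.
have d0 : 0 < d by rewrite lt_min ltr01 e0.
have d1 : d <= 1 by rewrite ge_min lexx.
have de : d <= e by rewrite ge_min lexx orbT.
have small r : 0 < r < d -> [/\ 0 < r ^+ 2 / 2, r ^+ 2 / 2 <= r / 2 & 0 <= r ^+ 2 / 2 <= e / 2].
  move=> /andP[r0 rd]; have r2 : r ^+ 2 <= r by rewrite expr2 ler_piMl ?(ltW r0)//; lra.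
  have r20 : 0 < r ^+ 2 by rewrite exprn_gt0.
  by clear -r2 r20 rd de e0 r0; split; try lra; apply/andP; split; lra.
split.
  exists (Bl + Bw + Bk), d; split=> // r rd; have [s0 sr sdom] := small r rd.
  have := hl _ sdom; have := hw _ sdom; have := hk _ sdom => h1 h2 h3.
  split; try (clear -h1 h2 h3 Bl0 Bw0 Bk0; lra).
  have hf s : 0 <= s <= r ^+ 2 / 2 -> is_derive s 1 f (w s).
    move=> /andP[s1 s2]; have /andP[_ s3] := sdom.
    have sd : 0 <= s <= e / 2 by rewrite s1 (le_trans s2 s3).
    by have [? [? [? [[_ _ _ ?] _ _ _]]]] := flow s (dom s sd).
  have [c /andP[c0 cs] E] := mean_value s0 hf.
  have -> : f (r ^+ 2 / 2) - 1 = w c * (r ^+ 2 / 2) by move: E; rewrite f0 subr0.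
  have /andP[_ s3] := sdom.
  have cd : 0 <= c <= e / 2 by rewrite (ltW c0)/= (le_trans (ltW cs) s3).
  have r20 : 0 <= r ^+ 2 by exact: sqr_ge0.
  rewrite normrM (gtr0_norm s0); apply: (@le_trans _ _ (Bw * (r ^+ 2 / 2))).
    by rewrite ler_wpM2r ?hw// ltW.
  have h4 : 0 <= Bl * r ^+ 2 by rewrite mulr_ge0.
  have h5 : 0 <= Bw * r ^+ 2 by rewrite mulr_ge0.
  have h6 : 0 <= Bk * r ^+ 2 by rewrite mulr_ge0.
  clear -h4 h5 h6; lra.
have [dl [dw [dk [[_ hw0 _ _] _ Ew _]]]] := flow 0 (dom 0 dom0).
(* At s = 0 the second equation degenerates to nu w(0) = - e with e the positive weight of f(0). *)
have w0 : w 0 < 0.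
  move: Ew; rewrite !mulr0 !mul0r addr0 => Ew.
  have p0 : 0 < potential_weight kappa (f 0) by rewrite divr_gt0 ?expR_gt0// subr_gt0.
  have : nu * - w 0 = potential_weight kappa (f 0) by lra.
  move=> E; rewrite -oppr_gt0 -(pmulr_rgt0 (- w 0) (_ : 0 < nu)) ?E//; lra.
have /cvgrPdist_lt/(_ (- w 0)) := is_derive_continuous hw0.
rewrite oppr_gt0 => /(_ w0)[a/= a0 ha].
exists (Num.min d a); first by rewrite lt_min d0 a0.
move=> r /andP[r0]; rewrite lt_min => /andP[rd ra].
have [s0 sr _] := small r (ltac:(by rewrite r0)).
have := ha (r ^+ 2 / 2); rewrite /ball_/= sub0r normrN (gtr0_norm s0).
have ra2 : r ^+ 2 / 2 < a by clear -sr ra r0; lra.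
by move=> /(_ ra2); rewrite ltr_norml => /andP[h _]; clear -h; lra.
Qed.

Section Continuation.
Context {R : realType}.
Variables (nu kappa : R).

(** The germ at 0 is prescribed by fixed power series: it gives all extensions the same initial data
    and later provides smoothness at s = 0. It is required on half of the disc only, because the
    seams of later gluings lie beyond D / 2. *)
Definition extends (D : R) (cl cw ck cf : nat -> R) (T : R) (l w k f : R -> R) : Prop :=
  (forall s : R, - D < s < T -> reduced_flow nu kappa l w k f s) /\ (forall s : R, `|s| < D / 2 ->
    [/\ l s = psum cl s, w s = psum cw s, k s = psum ck s & f s = psum cf s]).

End Continuation.

Lemma extends_admissible (R : realType) (nu kappa D : R) cl cw ck cf (T : R) l w k f :
  3 <= nu -> 0 <= kappa < 1 -> 0 < D -> D <= T -> psum cf 0 = 1 ->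
  extends nu kappa D cl cw ck cf T l w k f ->
  admissible_flow nu kappa (fun r => l (r ^+ 2 / 2)) (fun r => w (r ^+ 2 / 2))
    (fun r => k (r ^+ 2 / 2)) (fun r => f (r ^+ 2 / 2)) (Num.sqrt (2 * T)).
Proof.
move=> n3 k01 D0 DT f0 [flow germ].
have f01 : f 0 = 1.
  have h : `|0 : R| < D / 2 by rewrite normr0; lra.
  by have [_ _ _ ->] := germ 0 h.
have flowD s : - D < s < D -> reduced_flow nu kappa l w k f s.
  by move=> /andP[h1 h2]; apply: flow; rewrite h1 (lt_le_trans h2 DT).
have [tm neg] := tame_reduced_flow n3 k01 D0 flowD f01.
split=> // r /andP[r0 rT]; apply: radial_flow_reduced; apply: flow.
have T0 : 0 <= 2 * T by lra.
have : r ^+ 2 < 2 * T.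
  by rewrite -(sqr_sqrtr T0) ltrXn2r// ?nnegrE ?(ltW r0)// sqrtr_ge0.
have r20 : 0 <= r ^+ 2 by exact: sqr_ge0.
by move=> h; apply/andP; split; lra.
Qed.

(** For s <= 0 both solutions equal the common germ; for s > 0 uniqueness of the radial flow applies
    with r = sqrt(2 s). Negative s are included because derivatives at s = 0 are two-sided. *)
Lemma extends_unique (R : realType) (nu kappa D : R) cl cw ck cf (T T' : R) l w k f l' w' k' f' :
  3 <= nu -> 0 <= kappa < 1 -> 0 < D -> D <= T -> D <= T' -> psum cf 0 = 1 ->
  extends nu kappa D cl cw ck cf T l w k f -> extends nu kappa D cl cw ck cf T' l' w' k' f' ->
  forall s, - (D / 2) < s -> s < T -> s < T' ->
  [/\ l s = l' s, w s = w' s, k s = k' s & f s = f' s].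
Proof.
move=> n3 /[dup] k01 /andP[k0 k1] D0 DT DT' f0 ext ext' s sD sT sT'.
have [s0|s0] := leP s 0.
  have sD2 : `|s| < D / 2 by rewrite ltr_norml sD; lra.
  have [_ /(_ s sD2)[-> -> -> ->]] := ext.
  by have [_ /(_ s sD2)[-> -> -> ->]] := ext'.
have [_ _ fl tm _] := extends_admissible n3 k01 D0 DT f0 ext.
have [_ _ fl' tm' _] := extends_admissible n3 k01 D0 DT' f0 ext'.
pose r := Num.sqrt (2 * s).
have r2 : r ^+ 2 / 2 = s by rewrite sqr_sqrtr ?mulr_ge0 ?(ltW s0)//; field.
have r0 : 0 < r by rewrite sqrtr_gt0 mulr_gt0.
pose U := Num.min (Num.sqrt (2 * T)) (Num.sqrt (2 * T')).
have rU : 0 < r < U.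
  by rewrite r0 lt_min !ltr_sqrt ?mulr_gt0 ?ltr_pM2l//; lra.
have h1 t : 0 < t < U -> _ := fun h => fl t (ltac:(by move: h; rewrite lt_min => /andP[-> /andP[-> _]])).
have h2 t : 0 < t < U -> _ := fun h => fl' t (ltac:(by move: h; rewrite lt_min => /andP[-> /andP[_ ->]])).
have := radial_flow_unique n3 k0 k1 tm tm' h1 h2 rU.
by rewrite /= r2.
Qed.

Lemma extends_step (R : realType) (nu kappa D : R) cl cw ck cf :
  3 <= nu -> 0 <= kappa < 1 -> 0 < D -> psum cf 0 = 1 ->
  exists2 h : R, 0 < h & forall (T : R) l w k f, D <= T ->
    extends nu kappa D cl cw ck cf T l w k f ->
    exists l' w' k' f', extends nu kappa D cl cw ck cf (T + h) l' w' k' f'.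
Proof.
move=> n3 /[dup] k01 /andP[k0 k1] D0 f0.
pose d := D / 2; have d0 : 0 < d by rewrite /d; lra.
(* The reference point is s = d / 2, that is r1^2 = d. It lies in the domain of the germ, so [A] and
   the bounds derived from it, and with them the step length, are the same for every extension. *)
pose e1 := potential_weight kappa (psum cf (d / 2)).
pose A := (nu - 1) * (nu - 2) * `|(1 + d * psum ck (d / 2)) / d| + e1.
have e10 : 0 <= e1 by rewrite /e1 /potential_weight divr_ge0 ?expR_ge0// subr_ge0 ltW.
have A0 : 0 <= A by rewrite /A addr_ge0// !mulr_ge0//; lra.
pose r1 := Num.sqrt d.
have r10 : 0 < r1 by rewrite sqrtr_gt0.
have r1d : r1 ^+ 2 = d by rewrite sqr_sqrtr// ltW.
pose Ml := (1 + A + r1^-1) / r1; pose Mw := 1 + A / (1 - kappa) / d; pose Mk := A + d^-1.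
have Ml0 : 0 <= Ml.
  by rewrite /Ml divr_ge0 ?(ltW r10)// addr_ge0 ?invr_ge0 ?(ltW r10)// addr_ge0.
have Mw0 : 0 <= Mw by rewrite /Mw addr_ge0// divr_ge0 ?(ltW d0)// divr_ge0// subr_ge0 ltW.
have Mk0 : 0 <= Mk by rewrite /Mk addr_ge0// invr_ge0 ltW.
have M0 : 0 <= Ml + Mw + Mk + A by lra.
have d20 : 0 < d / 2 by lra.
have [h h0 step] := reduced_flow_step nu k1 d20 M0.
exists (h / 2); first by lra.
move=> T l w k f DT ext.
(* h' <= D / 4 puts the restart point T - h' beyond D / 2, and h' <= h / 4 lets the new piece, of
   radius h, reach past T + h / 2. *)
pose h' := Num.min h D / 4.
have m0 : 0 < Num.min h D by rewrite lt_min h0.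
have mh : Num.min h D <= h by rewrite ge_min lexx.
have mD : Num.min h D <= D by rewrite ge_min lexx orbT.
have h'0 : 0 < h' by rewrite /h'; lra.
have h'h : h' <= h / 4 by rewrite /h'; lra.
have h'D : h' <= D / 4 by rewrite /h'; lra.
pose s0 := T - h'.
have s0d : d < s0 by rewrite /s0 /d; lra.
have s0T : s0 < T by rewrite /s0; lra.
have s00 : 0 < s0 by lra.
have adm := extends_admissible n3 k01 D0 DT f0 ext.
have [flow germ] := ext.
pose r := Num.sqrt (2 * s0).
have r2 : r ^+ 2 = 2 * s0 by rewrite sqr_sqrtr// mulr_ge0// ltW.
have r22 : r ^+ 2 / 2 = s0 by rewrite r2; field.
have r0 : 0 < r by rewrite sqrtr_gt0 mulr_gt0.
have r1r : r1 <= r by rewrite /r1 /r ler_wsqrtr//; lra.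
have rT : r < Num.sqrt (2 * T) by rewrite ltr_sqrt; clear -s0T s00; lra.
have r1T : 0 < r1 < Num.sqrt (2 * T) by rewrite r10 (le_lt_trans r1r rT).
have hA : (nu - 1) * (nu - 2) * ((1 + r1 ^+ 2 * k (r1 ^+ 2 / 2)) / r1 ^+ 2) +
    potential_weight kappa (f (r1 ^+ 2 / 2)) <= A.
  have dd : `|d / 2| < D / 2 by rewrite gtr0_norm//; rewrite /d; clear -D0; lra.
  have [_ _ Ek Ef] := germ _ dd.
  rewrite r1d Ek Ef /A /e1 lerD2r ler_wpM2l ?ler_norm// mulr_ge0//; clear -n3; lra.
have rr : r1 <= r < Num.sqrt (2 * T) by rewrite r1r.
have [bw bl bk be] := a_priori_bound adm r1T hA rr.
rewrite r22 in bw bl bk be.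
have dr : d <= r ^+ 2 by rewrite r2; clear -s0d s00; lra.
have ri : r^-1 <= r1^-1 by rewrite lef_pV2.
have sqb (x y : R) : x ^+ 2 <= y -> `|x| <= 1 + y.
  move=> h1; have := sqr_ge0 (`|x| - 1); rewrite -(real_normK (num_real x)) in h1.
  by have := normr_ge0 x => h2 h3; clear -h1 h2 h3; lra.
have Hl : `|l s0| <= Ml + Mw + Mk + A.
  suff : `|l s0| <= Ml by clear -Ml0 Mw0 Mk0 A0; lra.
  have h1 : `|r^-1 + r * l s0| <= 1 + A by apply: sqb.
  have h2 : `|r * l s0| <= 1 + A + r1^-1.
    have -> : r * l s0 = (r^-1 + r * l s0) - r^-1 by ring.
    apply: le_trans (ler_normB _ _) _; apply: lerD => //.
    by rewrite ger0_norm// invr_ge0 ltW.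
  rewrite /Ml ler_pdivlMr//; apply: le_trans h2.
  by rewrite normrM (gtr0_norm r0) mulrC ler_wpM2r.
have Hw : `|w s0| <= Ml + Mw + Mk + A.
  suff : `|w s0| <= Mw by clear -Ml0 Mw0 Mk0 A0; lra.
  apply: sqb; rewrite ler_pdivlMr//; apply: le_trans bw.
  by rewrite mulrC ler_wpM2r// sqr_ge0.
have Hk : `|k s0| <= Ml + Mw + Mk + A.
  suff : `|k s0| <= Mk by clear -Ml0 Mw0 Mk0 A0; lra.
  have -> : k s0 = (1 + r ^+ 2 * k s0) / r ^+ 2 - (r ^+ 2)^-1.
    by field; rewrite gt_eqF.
  move: bk => /andP[bk1 bk2].
  apply: le_trans (ler_normB _ _) _; apply: lerD; first by rewrite gtr0_norm.
  by rewrite ger0_norm ?invr_ge0 ?sqr_ge0// lef_pV2 ?posrE// exprn_gt0.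
have He : potential_weight kappa (f s0) <= Ml + Mw + Mk + A by clear -be Ml0 Mw0 Mk0; lra.
have s0d2 : d / 2 <= s0 by clear -s0d s00; lra.
have [l2 [w2 [k2 [f2 [El Ew Ek Ef flow2]]]]] := step s0 _ _ _ _ s0d2 Hl Hw Hk He.
exists (glue s0 l l2), (glue s0 w w2), (glue s0 k k2), (glue s0 f f2); split.
  move=> s /andP[sD sT].
  have [ss|ss|->] := ltgtP s s0.
  - apply: (@reduced_flow_near _ _ _ l w k f); try exact: near_glue_lt.
    by apply: flow; rewrite sD (lt_trans ss s0T).
  - apply: (@reduced_flow_near _ _ _ l2 w2 k2 f2); try exact: near_glue_gt.
    apply: flow2; last by apply: lt_trans ss.
    rewrite ger0_norm ?subr_ge0 ?(ltW ss)//.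
    by have Es : s0 = T - h' by []; clear -Es sT h'h h0; lra.
  - apply: reduced_flow_glue => //.
      by apply: flow; rewrite s0T andbT; clear -s00 D0; lra.
    by apply: flow2 => //; rewrite subrr normr0.
move=> s sD; have ss : s < s0.
  by move: sD; rewrite ltr_norml => /andP[_]; move: s0d; rewrite /d; clear; lra.
by rewrite /glue ss; exact: germ.
Qed.

Theorem global_reduced_flow (R : realType) (nu kappa : R) : 3 <= nu -> 0 <= kappa < 1 ->
  exists2 d : R, 0 < d & exists (cl cw ck cf : nat -> R) (l w k f : R -> R),
  [/\ [/\ summable_on d cl, summable_on d cw, summable_on d ck & summable_on d cf],
      forall s : R, `|s| < d ->
        [/\ l s = psum cl s, w s = psum cw s, k s = psum ck s & f s = psum cf s],
      f 0 = 1 & forall s : R, - d < s -> reduced_flow nu kappa l w k f s].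
Proof.
move=> n3 /[dup] k01 /andP[k0 k1].
have [D D0 [cl [cw [ck [cf [[sl sw sk sf] f0 fl]]]]]] := @reduced_flow_start R nu kappa n3.
have [h h0 step] := extends_step cl cw ck n3 k01 D0 f0.
have ext n : exists l w k f, extends nu kappa D cl cw ck cf (D + n%:R * h) l w k f.
  elim: n => [|n [l [w [k [f IH]]]]].
    exists (psum cl), (psum cw), (psum ck), (psum cf); split=> // s.
    by rewrite mul0r addr0 -ltr_norml; exact: fl.
  have DT : D <= D + n%:R * h by rewrite lerDl mulr_ge0// ltW.
  have [l' [w' [k' [f' IH']]]] := step _ _ _ _ _ DT IH.
  exists l', w', k', f'; have -> : D + n.+1%:R * h = D + n%:R * h + h by rewrite -natr1; ring.
  exact: IH'.
have extT T : exists q : (R -> R) * (R -> R) * ((R -> R) * (R -> R)),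
    extends nu kappa D cl cw ck cf T q.1.1 q.1.2 q.2.1 q.2.2.
  have [n hn] : exists n, T <= n%:R * h.
    exists (Num.truncn (T / h)).+1; rewrite -ler_pdivrMr//.
    by rewrite ltW// truncnS_gt.
  have [l [w [k [f [H1 H2]]]]] := ext n.
  exists ((l, w), (k, f)); split=> // s /andP[sD sT]; apply: H1; rewrite sD.
  apply: lt_le_trans sT _; apply: le_trans hn _; rewrite lerDr; exact: ltW.
have [F HF] := choice extT.
pose d := D / 2; have d0 : 0 < d by rewrite /d; lra.
have HF1 T : D <= Num.max T D by rewrite le_max lexx orbT.
(* The extensions are chosen independently of each other. The value at s is read from [G (s + 1)];
   by uniqueness, near s all these choices agree with the single solution [G (s + 2)]. *)
pose G T := F (Num.max T D).
exists d => //; exists cl, cw, ck, cf.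
exists (fun s => (G (s + 1)).1.1 s), (fun s => (G (s + 1)).1.2 s),
  (fun s => (G (s + 1)).2.1 s), (fun s => (G (s + 1)).2.2 s).
have germ s : `|s| < d -> [/\ (G (s + 1)).1.1 s = psum cl s, (G (s + 1)).1.2 s = psum cw s,
   (G (s + 1)).2.1 s = psum ck s & (G (s + 1)).2.2 s = psum cf s].
  by move=> sd; have [_ /(_ s sd)] := HF (Num.max (s + 1) D).
split=> //.
- by split; apply: (@summable_on_le _ D) => //; rewrite /d; lra.
- by have [|_ _ _ ->] := germ 0; rewrite ?normr0.
move=> s sd.
have key : \forall x \near s, [/\ (G (s + 2)).1.1 x = (G (x + 1)).1.1 x,
   (G (s + 2)).1.2 x = (G (x + 1)).1.2 x, (G (s + 2)).2.1 x = (G (x + 1)).2.1 x &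
   (G (s + 2)).2.2 x = (G (x + 1)).2.2 x].
  near=> x.
  apply: (extends_unique n3 k01 D0 (HF1 (s + 2)) (HF1 (x + 1)) f0 (HF _) (HF _)).
  - by near: x; exact: lt_nbhsr.
  - rewrite lt_max; apply/orP; left; near: x; apply: lt_nbhsl; lra.
  - by rewrite lt_max ltrDl ltr01.
apply: (@reduced_flow_near _ _ _ (G (s + 2)).1.1 (G (s + 2)).1.2 (G (s + 2)).2.1 (G (s + 2)).2.2).
- by apply: filterS key => x [].
- by apply: filterS key => x [].
- by apply: filterS key => x [].
- by apply: filterS key => x [].
have [fls _] := HF (Num.max (s + 2) D); apply: fls; apply/andP; split.
  by move: sd; rewrite /d; lra.
by rewrite lt_max; apply/orP; left; lra.
Unshelve. all: by end_near. Qed.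

(** * Smoothness *)

Section LineSmoothness.
Context {R : realType}.
Implicit Types (U V : set R) (f g : R -> R).

Fixpoint ck (n : nat) U f : Prop :=
  match n with
  | 0 => forall x, U x -> {for x, continuous f}
  | n'.+1 => exists f', (forall x, U x -> is_derive x 1 f (f' x)) /\ ck n' U f'
  end.

Lemma ck_pred n U f : ck n.+1 U f -> ck n U f.
Proof.
elim: n f => [|n IH] f; last by move=> [f' [hf /IH h]]; exists f'.
by move=> [f' [hf _]] x /hf/is_derive_continuous.
Qed.

Lemma ck_ext n U f g : open U -> (forall x, U x -> f x = g x) -> ck n U f -> ck n U g.
Proof.
move=> oU fg; have near_fg x : U x -> \near x, f x = g x.
  by move=> Ux; apply: filterS (open_nbhs_nbhs (conj oU Ux)) => y /fg.
case: n => [|n].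
  move=> hf x Ux; rewrite /prop_for /continuous_at -(fg x Ux).
  by apply: cvg_trans (hf x Ux); apply: near_eq_cvg; exact: near_fg.
move=> [f' [hf hf']]; exists f'; split=> // x Ux.
exact: near_eq_is_derive (near_fg x Ux) (hf x Ux).
Qed.

(** The derivative functions given on U and on V may be different functions; both are replaced by
    ['D_1 f], which equals each of them on its own set. *)
Lemma ck_union n U V f : open U -> open V -> ck n U f -> ck n V f -> ck n (U `|` V) f.
Proof.
move=> oU oV; elim: n f => [|n IH] f; first by move=> h1 h2 x [/h1|/h2].
move=> [f1 [h1 c1]] [f2 [h2 c2]]; exists (fun x => 'D_1 f x); split.
  by move=> x [/h1|/h2] [df _]; apply: DeriveDef.
apply: IH.
  by apply: ck_ext c1 => // x /h1 [_ <-].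
by apply: ck_ext c2 => // x /h2 [_ <-].
Qed.

Lemma ck_cst n U (a : R) : ck n U (fun _ => a).
Proof.
elim: n a => [|n IH] a; first by move=> x _; exact: cst_continuous.
by exists (fun _ => 0); split=> // x _; exact: is_derive_constf.
Qed.

Lemma ck_id n U : ck n U (fun x => x).
Proof.
case: n => [|n]; first by move=> x _; exact: cvg_id.
by exists (fun _ => 1); split=> [x _|]; [exact: is_derive_idf|exact: ck_cst].
Qed.

Lemma ck_add n U f g : ck n U f -> ck n U g -> ck n U (fun x => f x + g x).
Proof.
elim: n f g => [|n IH] f g; first by move=> hf hg x Ux; apply: cvgD; [exact: hf|exact: hg].
move=> [f' [hf cf]] [g' [hg cg]]; exists (fun x => f' x + g' x); split; last exact: IH.
by move=> x Ux; apply: is_derive_addf; [exact: hf|exact: hg].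
Qed.

Lemma ck_mul n U f g : ck n U f -> ck n U g -> ck n U (fun x => f x * g x).
Proof.
elim: n f g => [|n IH] f g; first by move=> hf hg x Ux; apply: cvgM; [exact: hf|exact: hg].
move=> /[dup] Hf [f' [hf cf]] /[dup] Hg [g' [hg cg]].
exists (fun x => f' x * g x + f x * g' x); split.
  by move=> x Ux; apply: is_derive_mulf; [exact: hf|exact: hg].
by apply: ck_add; apply: IH => //; exact: ck_pred.
Qed.

Lemma ck_scale n U (a : R) f : ck n U f -> ck n U (fun x => a * f x).
Proof. by move=> h; apply: ck_mul => //; exact: ck_cst. Qed.

Lemma ck_inv n U f : (forall x, U x -> f x != 0) -> ck n U f -> ck n U (fun x => (f x)^-1).
Proof.
move=> f0; elim: n => [|n IH]; first by move=> hf x Ux; apply: cvgV; [exact: f0|exact: hf].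
move=> /[dup] /ck_pred/IH ci [f' [hf cf]].
exists (fun x => - 1 * f' x * ((f x)^-1 * (f x)^-1)); split.
  move=> x Ux; apply: is_derive_eqf (is_derive_invf (f0 x Ux) (hf x Ux)) _.
  by have := f0 x Ux => fx; field.
by apply: ck_mul; [exact: ck_scale|exact: ck_mul].
Qed.

Lemma ck_exp n U f : ck n U f -> ck n U (fun x => expR (f x)).
Proof.
elim: n => [|n IH].
  by move=> hf x Ux; apply: (@continuous_comp _ _ _ f expR); [exact: hf|exact: continuous_expR].
move=> /[dup] /ck_pred/IH ci [f' [hf cf]].
exists (fun x => expR (f x) * f' x); split; last exact: ck_mul.
by move=> x Ux; apply: is_derive_expRf; exact: hf.
Qed.

Lemma ck_psum n (r : R) (c : nat -> R) : summable_on r c -> ck n [set x | `|x| < r] (psum c).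
Proof.
elim: n c => [|n IH] c hc.
  by move=> x xr; exact: is_derive_continuous (is_derive_psum hc xr).
exists (psum (pseries_diffs c)); split; first by move=> x; exact: is_derive_psum.
exact/IH/summable_on_diffs.
Qed.

Lemma open_ball_norm (r : R) : open [set x : R | `|x| < r].
Proof.
rewrite (_ : [set x | _] = [set x : R | x \in `]-r, r[]); first exact: itv_open.
by apply/seteqP; split=> x /=; rewrite in_itv/= ltr_norml.
Qed.

Lemma open_right_ray (a : R) : open [set x : R | a < x].
Proof. exact: open_gt. Qed.

End LineSmoothness.

(* Bootstrap: on ]0, oo[ the equations can be solved for the derivatives. *)
Lemma ck_reduced_flow (R : realType) (nu kappa d : R) (cl cw ck' cf : nat -> R)
  (l w k f : R -> R) n : 0 < d -> kappa < 1 ->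
  summable_on d cl -> summable_on d cw -> summable_on d ck' -> summable_on d cf ->
  (forall s : R, `|s| < d ->
    [/\ l s = psum cl s, w s = psum cw s, k s = psum ck' s & f s = psum cf s]) ->
  (forall s : R, - d < s -> reduced_flow nu kappa l w k f s) ->
  [/\ ck n [set s | - d < s] l, ck n [set s | - d < s] w, ck n [set s | - d < s] k &
      ck n [set s | - d < s] f].
Proof.
move=> d0 k1 hl hw hk hf germ flow.
pose U := [set s : R | 0 < s]; pose B := [set s : R | `|s| < d].
have oU : open U by exact: open_right_ray.
have oB : open B by exact: open_ball_norm.
have UB : [set s | - d < s] = B `|` U.
  apply/seteqP; split=> s; rewrite /B /U /= ltr_norml.
    by move=> h; have [s0|s0] := ltP 0 s; [right|left; rewrite h/=; exact: le_lt_trans d0].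
  by case=> [/andP[]//|s0]; apply: lt_trans s0; rewrite oppr_lt0.
rewrite UB.
have near0 (g : R -> R) c : summable_on d c -> (forall s, `|s| < d -> g s = psum c s) -> ck n B g.
  move=> hc hg; apply: (ck_ext (f := psum c)) => //; first by move=> s /hg.
  exact: ck_psum.
have pos s : U s -> reduced_flow nu kappa l w k f s.
  by move=> s0; apply: flow; apply: lt_trans s0; rewrite oppr_lt0.
suff [h1 h2 h3 h4] : [/\ ck n U l, ck n U w, ck n U k & ck n U f].
  split; apply: ck_union => //; [apply: near0 hl _|apply: near0 hw _|apply: near0 hk _|apply: near0 hf _];
    by move=> s /germ[].
elim: n {near0} => [|n [cl1 cw1 ck1 cf1]].
  split=> s /pos [dl [dw [dk [[h1 h2 h3 h4] _ _ _]]]];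
    [exact: is_derive_continuous h1|exact: is_derive_continuous h2|exact: is_derive_continuous h3|exact: is_derive_continuous h4].
have cinv : ck n U (fun s => (2 * s)^-1).
  apply: ck_inv; last by apply: ck_scale; exact: ck_id.
  by move=> s /= s0; rewrite gt_eqF// mulr_gt0.
have cpot : ck n U (fun s => potential_weight kappa (f s)).
  by apply: ck_mul (ck_cst _ _ _); apply: ck_exp; exact: ck_scale.
have c2s : ck n U (fun s => 2 * s) by apply: ck_scale; exact: ck_id.
have cww : ck n U (fun s => w s * w s) by exact: ck_mul.
have cll : ck n U (fun s => l s * l s) by exact: ck_mul.
have cwl : ck n U (fun s => w s * l s) by exact: ck_mul.
have ckl : ck n U (fun s => k s * l s) by exact: ck_mul.
split.
- exists (fun s => ((nu - 2) * k s + (- (2 * nu - 1) * l s + w s)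
        + 2 * s * (w s * l s + - (nu - 1) * (l s * l s))) * (2 * s)^-1); split.
    move=> s /[dup] s0 /pos [dl [dw [dk [[h _ _ _] E _ _]]]]; apply: is_derive_eqf h _.
    apply: (mulfI (_ : 2 * s != 0)); first by rewrite gt_eqF// mulr_gt0.
    by rewrite E; field; rewrite gt_eqF.
  apply: ck_mul => //; apply: ck_add; first by do 2 (apply: ck_add => //; try exact: ck_scale).
  by apply: ck_mul => //; apply: ck_add => //; exact: ck_scale.
- exists (fun s => (- nu * w s + - 1 * potential_weight kappa (f s)
        + 2 * s * (w s * w s + - (nu - 1) * (w s * l s))) * (2 * s)^-1); split.
    move=> s /[dup] s0 /pos [dl [dw [dk [[_ h _ _] _ E _]]]]; apply: is_derive_eqf h _.
    apply: (mulfI (_ : 2 * s != 0)); first by rewrite gt_eqF// mulr_gt0.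
    by rewrite E; field; rewrite gt_eqF.
  apply: ck_mul => //; apply: ck_add; first by apply: ck_add; exact: ck_scale.
  by apply: ck_mul => //; apply: ck_add => //; exact: ck_scale.
- exists (fun s => (- 2 * k s + - 2 * l s + - 2 * (2 * s * (k s * l s))) * (2 * s)^-1); split.
    move=> s /[dup] s0 /pos [dl [dw [dk [[_ _ h _] _ _ E]]]]; apply: is_derive_eqf h _.
    apply: (mulfI (_ : 2 * s != 0)); first by rewrite gt_eqF// mulr_gt0.
    by rewrite E; field; rewrite gt_eqF.
  apply: ck_mul => //; apply: ck_add; first by apply: ck_add; exact: ck_scale.
  by apply: ck_scale; exact: ck_mul.
- by exists w; split=> // s /pos [dl [dw [dk [[_ _ _ h] _ _ _]]]].
Qed.

(** * Smooth functions of |x|^2 / 2 on R^m *)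

Section SpaceSmoothness.
Context {R : realType} {m : nat}.
Implicit Types (F G : 'rV[R]_m -> R) (x : 'rV[R]_m).

(** Continuity is demanded at every level because the existence of partial derivatives does not
    imply it. *)
Fixpoint dk (n : nat) F : Prop :=
  match n with
  | 0 => continuous F
  | n'.+1 => continuous F /\ exists G : 'I_m -> 'rV[R]_m -> R,
      (forall i x, is_derive x (delta_mx 0 i) F (G i x)) /\ forall i, dk n' (G i)
  end.

Lemma dk_continuous n F : dk n F -> continuous F.
Proof. by case: n => [|n []]. Qed.

Lemma dk_pred n F : dk n.+1 F -> dk n F.
Proof.
elim: n F => [|n IH] F; first by move=> [].
by move=> [cF [G [hG dG]]]; split=> //; exists G; split=> // i; exact: IH.
Qed.

Lemma dk_cst n (a : R) : dk n (fun _ => a).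
Proof.
elim: n a => [|n IH] a /=; first by move=> x; exact: cst_continuous.
split; first by move=> x; exact: cst_continuous.
by exists (fun _ _ => 0); split=> // i x; exact: is_derive_constf.
Qed.

Lemma is_derive_coord x (i j : 'I_m) :
  is_derive x (delta_mx 0 i : 'rV[R]_m) (fun y : 'rV[R]_m => y 0 j) (i == j)%:R.
Proof.
apply/is_derive_lineE.
have -> : (fun t : R => (t *: delta_mx 0 i + x) 0 j) = (fun t : R => t * (i == j)%:R + x 0 j).
  by apply/funext => t; rewrite !mxE eqxx/= eq_sym.
by derive_eq; ring.
Qed.

Lemma dk_coord n (j : 'I_m) : dk n (fun x : 'rV[R]_m => x 0 j).
Proof.
case: n => [|n] /=; first exact: coord_continuous.
split; first exact: coord_continuous.
exists (fun i _ => (i == j)%:R); split=> [i x|i]; [exact: is_derive_coord|exact: dk_cst].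
Qed.

Lemma dk_add n F G : dk n F -> dk n G -> dk n (fun x => F x + G x).
Proof.
elim: n F G => [|n IH] F G; first by move=> /= hF hG x; apply: (@continuousD _ _ _ F G x); [exact: hF|exact: hG].
move=> [cF [F' [hF dF]]] [cG [G' [hG dG]]]; split.
  by move=> x; apply: (@continuousD _ _ _ F G x); [exact: cF|exact: cG].
exists (fun i x => F' i x + G' i x); split=> [i x|i]; last by apply: IH; [exact: dF|exact: dG].
exact: is_derive_addf.
Qed.

Lemma dk_mul n F G : dk n F -> dk n G -> dk n (fun x => F x * G x).
Proof.
elim: n F G => [|n IH] F G; first by move=> /= hF hG x; apply: (@continuousM _ _ F G x); [exact: hF|exact: hG].
move=> /[dup] HF [cF [F' [hF dF]]] /[dup] HG [cG [G' [hG dG]]]; split.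
  by move=> x; apply: (@continuousM _ _ F G x); [exact: cF|exact: cG].
exists (fun i x => F' i x * G x + F x * G' i x); split=> [i x|i]; first exact: is_derive_mulf.
apply: dk_add; apply: IH; [exact: dF|exact: dk_pred|exact: dk_pred|exact: dG].
Qed.

Lemma dk_smooth F : (forall n, dk n F) -> smooth F.
Proof.
move=> hF s.
have H n : dk n (foldr partial F s).
  elim: s n => [|i s IH] n //=.
  have [_ [G [hG dG]]] := IH n.+1.
  have -> : partial i (foldr partial F s) = G i.
    by apply/funext => x; have [_ <-] := hG i x.
  exact: dG.
split; first exact: (dk_continuous (H 0%N)).
by move=> i x; have [_ [G [hG _]]] := H 1%N; have [] := hG i x.
Qed.

Definition half_sqnorm x : R := (\sum_(i < m) x 0 i ^+ 2) / 2.

Lemma half_sqnorm_ge0 x : 0 <= half_sqnorm x.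
Proof. by rewrite divr_ge0// sumr_ge0// => i _; exact: sqr_ge0. Qed.

Lemma is_derive_half_sqnorm x (i : 'I_m) :
  is_derive x (delta_mx 0 i : 'rV[R]_m) half_sqnorm (x 0 i).
Proof.
have h : is_derive x (delta_mx 0 i : 'rV[R]_m) (fun y : 'rV[R]_m => \sum_(j < m) y 0 j ^+ 2)
    (\sum_(j < m) 2 * x 0 j * (i == j)%:R).
  apply: is_derive_sumf => j; have hj := is_derive_coord x i j.
  by derive_eq; rewrite /= ; ring.
rewrite /half_sqnorm; derive_eq.
have -> : \sum_(j < m) 2 * x 0 j * (i == j)%:R = 2 * x 0 i.
  rewrite (bigD1 i)//= eqxx big1 ?addr0 ?mulr1// => j ji.
  by rewrite eq_sym (negbTE ji) mulr0.
by field.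
Qed.

Lemma dk_half_sqnorm n : dk n half_sqnorm.
Proof.
have h j : dk n (fun x : 'rV[R]_m => x 0 j * x 0 j) by apply: dk_mul; exact: dk_coord.
have : dk n (fun x : 'rV[R]_m => \sum_(j < m) x 0 j * x 0 j).
  elim: (index_enum _) => [|j r IH].
    have -> : (fun x : 'rV[R]_m => \sum_(j <- [::]) x 0 j * x 0 j) = (fun=> 0).
      by apply/funext => x; rewrite big_nil.
    exact: dk_cst.
  have -> : (fun x : 'rV[R]_m => \sum_(i <- j :: r) x 0 i * x 0 i) =
     (fun x => x 0 j * x 0 j + \sum_(i <- r) x 0 i * x 0 i).
    by apply/funext => x; rewrite big_cons.
  exact: dk_add.
by move=> /dk_mul/(_ (dk_cst n 2^-1)).
Qed.

(** The i-th partial derivative is [f' (half_sqnorm x) * x 0 i], of the same form times a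
    coordinate. Nothing is divided by |x|, so the origin is not exceptional; this is the reason for
    the variable s = |x|^2 / 2. *)
Lemma dk_comp_half_sqnorm n (U : set R) (f : R -> R) : (forall s, 0 <= s -> U s) ->
  ck n U f -> dk n (fun x => f (half_sqnorm x)).
Proof.
move=> U0; have Ux x : U (half_sqnorm x) by apply: U0; exact: half_sqnorm_ge0.
have cs : continuous half_sqnorm by exact: dk_half_sqnorm 0%N.
have cc (g : R -> R) : (forall s, U s -> {for s, continuous g}) -> continuous (fun x => g (half_sqnorm x)).
  by move=> hg x; apply: (@continuous_comp _ _ _ half_sqnorm g); [exact: cs|exact: hg].
elim: n f => [|n IH] f; first exact: cc.
move=> [f' [hf cf]]; split.
  by apply: cc => s /hf/is_derive_continuous.
exists (fun i x => f' (half_sqnorm x) * x 0 i); split.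
  by move=> i x; apply: is_derive_comp1; [exact: hf|exact: is_derive_half_sqnorm].
by move=> i; apply: dk_mul; [exact: IH|exact: dk_coord].
Qed.

End SpaceSmoothness.

(** * Curvature of rotationally symmetric metrics *)

Section RadialTensors.
Context {R : realType} {n : nat}.
Implicit Types (x : 'rV[R]_n) (i j k p : 'I_n).

Lemma sum_delta (F : 'I_n -> R) k : \sum_p (p == k)%:R * F p = F k.
Proof.
rewrite (bigD1 k)//= eqxx mul1r big1 ?addr0// => p pk.
by rewrite (negbTE pk) mul0r.
Qed.

Lemma sum_sqr_coord x : \sum_p x 0 p * x 0 p = 2 * half_sqnorm x.
Proof.
have -> : \sum_p x 0 p * x 0 p = \sum_(i < n) x 0 i ^+ 2 by [].
by rewrite /half_sqnorm; field.
Qed.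

(** The tensors in the computation are built from Kronecker deltas and coordinates. As functions of
    one contracted index they have this shape, and [sum_radial_form2] evaluates the contraction of
    two of them. *)
Definition radial_form x (al : R) k (be : R) i (ga : R) p : R :=
  al * (p == k)%:R + be * (p == i)%:R + ga * x 0 p.

Lemma sum_radial_form x al k be i ga (F : 'I_n -> R) :
  \sum_p radial_form x al k be i ga p * F p =
  al * F k + be * F i + ga * \sum_p x 0 p * F p.
Proof.
transitivity (\sum_p (al * ((p == k)%:R * F p) + be * ((p == i)%:R * F p)
    + ga * (x 0 p * F p))).
  by apply: eq_bigr => p _; rewrite /radial_form; ring.
by rewrite !big_split/= -!mulr_sumr !sum_delta.
Qed.

Lemma sum_coord_radial_form x al k be i ga :
  \sum_p x 0 p * radial_form x al k be i ga p = al * x 0 k + be * x 0 i + 2 * half_sqnorm x * ga.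
Proof.
under eq_bigr do rewrite mulrC.
by rewrite sum_radial_form sum_sqr_coord; ring.
Qed.

Lemma sum_radial_form2 x al k be i ga al' k' be' i' ga' :
  \sum_p radial_form x al k be i ga p * radial_form x al' k' be' i' ga' p =
  al * radial_form x al' k' be' i' ga' k + be * radial_form x al' k' be' i' ga' i
  + ga * (al' * x 0 k' + be' * x 0 i' + 2 * half_sqnorm x * ga').
Proof. by rewrite sum_radial_form sum_coord_radial_form. Qed.

Lemma partial_eq (F : 'rV[R]_n -> R) i x (d : R) :
  is_derive x (delta_mx 0 i) F d -> partial i F x = d.
Proof. by move=> [_ <-]. Qed.

Lemma partial_near_eq (D : set 'rV[R]_n) (F G : 'rV[R]_n -> R) i x (d : R) :
  open D -> D x -> (forall y, D y -> G y = F y) ->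
  is_derive x (delta_mx 0 i) G d -> partial i F x = d.
Proof.
move=> oD Dx FG hG; apply: partial_eq; apply: near_eq_is_derive hG.
by apply: filterS (open_nbhs_nbhs (conj oD Dx)) => y; exact: FG.
Qed.

(** [a1] acts as the derivative of [a] with respect to s = |x|^2 / 2. The set [D] will be all of R^n
    for existence and R^n without the origin for uniqueness. *)
Definition radial_gradient (D : set 'rV[R]_n) (a a1 : 'rV[R]_n -> R) :=
  forall x, D x -> forall i, is_derive x (delta_mx 0 i : 'rV[R]_n) a (a1 x * x 0 i).

End RadialTensors.

Section RadialCurvature.
Context {R : realType} {n : nat}.
Variables (D : set 'rV[R]_n) (g : 'rV[R]_n -> 'M[R]_n) (phi : 'rV[R]_n -> R).
Variables (l l1 k k1 k2 w w1 : 'rV[R]_n -> R).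
Let s := @half_sqnorm R n.
Let a x := (1 + 2 * s x * k x)^-1.

Hypotheses (openD : open D)
  (pos : forall x, D x -> 0 < 1 + 2 * s x * k x)
  (gE : forall x, D x -> forall i j, g x i j = a x * (i == j)%:R + k x * a x * (x 0 i * x 0 j))
  (dl : radial_gradient D l l1) (dk : radial_gradient D k k1) (dk1 : radial_gradient D k1 k2)
  (kin : forall x, D x -> s x * k1 x = - k x - l x - 2 * s x * k x * l x)
  (dphi : radial_gradient D phi w) (dw : radial_gradient D w w1).

(** [l], [B] and [C] are the coefficients of the Christoffel symbols in [radial_christoffel]; [B1]
    is the derivative of [B] with respect to s. *)
Let B x := a x * (k x - l x).
Let C x := a x * (k1 x / 2 - k x * l x).
Let B1 x := 2 * l x * a x * (k x - l x) + a x * (k1 x - l1 x).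

Lemma is_derive_radial_a : radial_gradient D a (fun x => 2 * l x * a x).
Proof.
move=> x Dx i; have h1 := is_derive_half_sqnorm x i; have h2 := dk Dx i.
have p0 := pos Dx; rewrite /a; derive_eq; first by rewrite gt_eqF.
have -> : 0 + ((0 * s x + 2 * x 0 i) * k x + 2 * s x * (k1 x * x 0 i))
  = 2 * (k x + s x * k1 x) * x 0 i by ring.
rewrite (kin Dx); field; by rewrite gt_eqF.
Qed.

(** The metric is a rank-one perturbation of a multiple of the identity, with eigenvalue a (1 + 2 s
    k) = 1 along x and a on the complement; its inverse has the same shape. *)
Lemma inverse_radial_metric x : D x -> forall i j,
  invmx (g x) i j = (1 + 2 * s x * k x) * (i == j)%:R - k x * (x 0 i * x 0 j).
Proof.
move=> Dx; have p0 := pos Dx.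
pose h : 'M[R]_n := \matrix_(i, j)
  ((1 + 2 * s x * k x) * (i == j)%:R - k x * (x 0 i * x 0 j)).
suff gh : g x *m h = 1%:M.
  have [ug _] := mulmx1_unit gh.
  have -> : invmx (g x) = h by rewrite -[RHS](mulKmx ug) gh mulmx1.
  by move=> i j; rewrite mxE.
apply/matrixP => i j; rewrite !mxE.
transitivity (\sum_p radial_form x (a x) i 0 i (k x * a x * x 0 i) p *
   radial_form x (1 + 2 * s x * k x) j 0 j (- k x * x 0 j) p).
  apply: eq_bigr => p _; rewrite (gE Dx) !mxE /radial_form (eq_sym i p); ring.
rewrite sum_radial_form2 /radial_form -/s /a.
by field; rewrite gt_eqF.
Qed.

Lemma partial_radial_metric x : D x -> forall i j p,
  partial p (fun y => g y i j) x =
  2 * l x * a x * x 0 p * (i == j)%:R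
  + (k1 x + 2 * l x * k x) * a x * x 0 p * (x 0 i * x 0 j)
  + k x * a x * ((p == i)%:R * x 0 j + x 0 i * (p == j)%:R).
Proof.
move=> Dx i j p.
apply: (partial_near_eq (D := D) (G := fun y => a y * (i == j)%:R + k y * a y * (y 0 i * y 0 j))) => //.
  by move=> y Dy; rewrite (gE Dy).
have h1 := is_derive_radial_a Dx p; have h2 := dk Dx p.
have h3 := is_derive_coord x p i; have h4 := is_derive_coord x p j.
derive_eq; ring.
Qed.

Lemma radial_christoffel x : D x -> forall q i j,
  christoffel g q i j x = l x * (x 0 i * (j == q)%:R + x 0 j * (i == q)%:R)
   + B x * (i == j)%:R * x 0 q + C x * (x 0 i * x 0 j * x 0 q).
Proof.
move=> Dx q i j; have p0 := pos Dx; rewrite /christoffel.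
transitivity (2^-1 * \sum_p radial_form x (1 + 2 * s x * k x) q 0 q (- k x * x 0 q) p *
  radial_form x (2 * l x * a x * x 0 i) j (2 * l x * a x * x 0 j) i
   ((2 * (k x * a x) - 2 * l x * a x) * (i == j)%:R + (k1 x + 2 * l x * k x) * a x * (x 0 i * x 0 j)) p).
  congr (_ * _); apply: eq_bigr => p _.
  rewrite (inverse_radial_metric Dx) !(partial_radial_metric Dx) /radial_form -/s.
  rewrite (eq_sym q p) (eq_sym j p) (eq_sym i p) (eq_sym j i).
  by rewrite ?(eq_sym j i); ring.
rewrite sum_radial_form2 /radial_form -/s /B /C /a (eq_sym q j) (eq_sym q i).
by field; rewrite gt_eqF.
Qed.

Lemma is_derive_radial_B : radial_gradient D B B1.
Proof.
move=> x Dx i; have h1 := is_derive_radial_a Dx i; have h2 := dk Dx i; have h3 := dl Dx i.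
by rewrite /B /B1; derive_eq; ring.
Qed.

Lemma is_derive_radial_C : radial_gradient D C (fun x =>
  2 * l x * a x * (k1 x / 2 - k x * l x) + a x * (k2 x / 2 - k1 x * l x - k x * l1 x)).
Proof.
move=> x Dx i; have h1 := is_derive_radial_a Dx i; have h2 := dk Dx i; have h3 := dl Dx i.
have h4 := dk1 Dx i.
by rewrite /C; derive_eq; field.
Qed.

Let C1 x := 2 * l x * a x * (k1 x / 2 - k x * l x) + a x * (k2 x / 2 - k1 x * l x - k x * l1 x).

Lemma partial_radial_christoffel x : D x -> forall p q i j,
  partial p (christoffel g q i j) x =
  l1 x * x 0 p * (x 0 i * (j == q)%:R + x 0 j * (i == q)%:R)
  + l x * ((p == i)%:R * (j == q)%:R + (p == j)%:R * (i == q)%:R)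
  + (i == j)%:R * (B1 x * x 0 p * x 0 q + B x * (p == q)%:R)
  + C1 x * x 0 p * (x 0 i * x 0 j * x 0 q)
  + C x * ((p == i)%:R * x 0 j * x 0 q + x 0 i * (p == j)%:R * x 0 q + x 0 i * x 0 j * (p == q)%:R).
Proof.
move=> Dx p q i j.
apply: (partial_near_eq (D := D) (G := fun x =>
  l x * (x 0 i * (j == q)%:R + x 0 j * (i == q)%:R)
   + B x * (i == j)%:R * x 0 q + C x * (x 0 i * x 0 j * x 0 q))) => //.
  by move=> y Dy; rewrite (radial_christoffel Dy).
have h1 := dl Dx p; have h2 := is_derive_radial_B Dx p; have h3 := is_derive_radial_C Dx p.
have h4 := is_derive_coord x p i; have h5 := is_derive_coord x p j.
have h6 := is_derive_coord x p q.
by derive_eq; rewrite /C1; ring.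
Qed.

(** The traced Christoffel symbols are T x_p, [T1] is the derivative of [T] in s, and [bet] is the
    coefficient of x_j x_k in the contraction of two Christoffel symbols with each other. *)
Let T x := (n%:R + 1) * l x + B x + 2 * s x * C x.
Let T1 x := (n%:R + 1) * l1 x + B1 x + 2 * C x + 2 * s x * C1 x.
Let bet x := (n%:R + 3) * l x ^+ 2 + 8 * s x * l x * C x + 2 * l x * B x + B x ^+ 2
  + 4 * s x * B x * C x + 4 * s x ^+ 2 * C x ^+ 2.

Lemma radial_ricci x : D x -> forall i j,
  ricci g x i j =
   (2 * l x + 2 * s x * B1 x + n%:R * B x - T x + 2 * s x * B x * T x - 4 * s x * l x * B x)
     * (i == j)%:R
   + (2 * l1 x + 2 * s x * C1 x + (n%:R + 2) * C x - T1 x + T x * (2 * l x + 2 * s x * C x) - bet x)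
     * (x 0 i * x 0 j).
Proof.
move=> Dx j k'; rewrite mxE /riemann_curvature.
rewrite big_split/= sumrB.
(* [S1] is the divergence of the Christoffel symbols, [S2] the derivative of their trace and [S3]
   the quadratic part. *)
set S1 := (X in X - _ + _); set S2 := (X in _ - X + _); set S3 := (X in _ - _ + X).
have E1 : S1 =
  2 * l1 x * (x 0 j * x 0 k') + 2 * l x * (j == k')%:R
  + (j == k')%:R * (2 * s x * B1 x + n%:R * B x)
  + (x 0 j * x 0 k') * (2 * s x * C1 x + (n%:R + 2) * C x).
  transitivity (\sum_i ((i == k')%:R * (l1 x * x 0 i * x 0 j + l x * (i == j)%:R + C x * x 0 j * x 0 i)
    + (i == j)%:R * (l1 x * x 0 i * x 0 k' + l x * (i == k')%:R + C x * x 0 k' * x 0 i)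
    + x 0 i * x 0 i * ((j == k')%:R * B1 x + C1 x * (x 0 j * x 0 k'))
    + 1 * ((j == k')%:R * B x + C x * (x 0 j * x 0 k')))).
    apply: eq_bigr => i _; rewrite (partial_radial_christoffel Dx).
    by rewrite (eq_sym k' i) (eq_sym j i) !eqxx !mulr1n; ring.
  rewrite !big_split/= !sum_delta -mulr_suml sum_sqr_coord sumr_const card_ord -/s.
  rewrite -[_ *+ n]mulr_natl (eq_sym k' j); ring.
have E2 : S2 = T1 x * (x 0 j * x 0 k') + T x * (j == k')%:R.
  transitivity (\sum_i ((i == k')%:R * (l1 x * x 0 j * x 0 i + l x * (j == i)%:R
       + B1 x * x 0 j * x 0 i + B x * (j == i)%:R)
    + (i == j)%:R * (2 * C x * x 0 k' * x 0 i)
    + x 0 i * x 0 i * (C1 x * x 0 j * x 0 k' + C x * (j == k')%:R)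
    + 1 * (l1 x * x 0 j * x 0 k' + l x * (j == k')%:R))).
    apply: eq_bigr => i _; rewrite (partial_radial_christoffel Dx).
    by rewrite (eq_sym k' i) (eq_sym j i) !eqxx !mulr1n; ring.
  rewrite !big_split/= !sum_delta -mulr_suml sum_sqr_coord sumr_const card_ord -/s.
  rewrite -[_ *+ n]mulr_natl /T /T1; ring.
have E3 p : \sum_i christoffel g i i p x = T x * x 0 p.
  transitivity (\sum_i ((i == p)%:R * (l x * x 0 i + B x * x 0 i)
    + x 0 i * x 0 i * (C x * x 0 p) + l x * x 0 p)).
    apply: eq_bigr => i _; rewrite (radial_christoffel Dx).
    by rewrite (eq_sym p i) !eqxx !mulr1n; ring.
  rewrite !big_split/= !sum_delta -mulr_suml sum_sqr_coord sumr_const card_ord -/s.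
  rewrite -[_ *+ n]mulr_natl /T; ring.
have E4 : \sum_i \sum_p (christoffel g p j k' x * christoffel g i i p x) =
   T x * (2 * l x * (x 0 j * x 0 k') + 2 * s x * B x * (j == k')%:R
     + 2 * s x * C x * (x 0 j * x 0 k')).
  rewrite exchange_big/=.
  transitivity (T x * \sum_p x 0 p * radial_form x (l x * x 0 k') j (l x * x 0 j) k'
      (B x * (j == k')%:R + C x * (x 0 j * x 0 k')) p).
    rewrite mulr_sumr; apply: eq_bigr => p _; rewrite -mulr_sumr E3 (radial_christoffel Dx).
    by rewrite /radial_form (eq_sym k' p) (eq_sym j p); ring.
  by rewrite sum_coord_radial_form -/s; ring.
have E5 : \sum_i \sum_p (christoffel g p i k' x * christoffel g i j p x) =
   4 * s x * l x * B x * (j == k')%:R + bet x * (x 0 j * x 0 k').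
  transitivity (\sum_i ((i == k')%:R * (l x ^+ 2 * x 0 i * x 0 j
       + B x * (B x * x 0 i * x 0 j + l x * x 0 j * x 0 i + 2 * s x * l x * (i == j)%:R
         + 2 * s x * C x * x 0 i * x 0 j))
     + (i == j)%:R * (l x ^+ 2 * x 0 k' * x 0 i + l x * x 0 k' * (B x * x 0 i + l x * x 0 i)
         + C x * x 0 i * x 0 k' * (2 * s x * l x))
     + x 0 i * x 0 i * (l x * B x * (j == k')%:R + 2 * l x * C x * x 0 j * x 0 k'
         + C x * x 0 k' * (B x * x 0 j + l x * x 0 j + 2 * s x * C x * x 0 j))
     + l x ^+ 2 * x 0 j * x 0 k')).
    apply: eq_bigr => i _.
    transitivity (\sum_p radial_form x (l x * x 0 i) k' (l x * x 0 k') i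
         (B x * (i == k')%:R + C x * (x 0 i * x 0 k')) p *
       radial_form x (B x * x 0 i) j (l x * x 0 j) i
         (l x * (i == j)%:R + C x * (x 0 j * x 0 i)) p).
      apply: eq_bigr => p _; rewrite !(radial_christoffel Dx) /radial_form.
      by rewrite (eq_sym k' p) (eq_sym i p) (eq_sym j i) (eq_sym j p); ring.
    rewrite sum_radial_form2 /radial_form -/s (eq_sym k' j) (eq_sym k' i) !eqxx !mulr1n; ring.
  rewrite !big_split/= !sum_delta -mulr_suml sum_sqr_coord sumr_const card_ord -/s.
  rewrite -[_ *+ n]mulr_natl (eq_sym k' j) /bet; ring.
have E6 : S3 = T x * (2 * l x * (x 0 j * x 0 k') + 2 * s x * B x * (j == k')%:R
     + 2 * s x * C x * (x 0 j * x 0 k'))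
   - (4 * s x * l x * B x * (j == k')%:R + bet x * (x 0 j * x 0 k')).
  apply: (etrans _ (f_equal2 (fun u v : R => u - v) E4 E5)).
  by rewrite -sumrB; apply: eq_bigr => i _; rewrite -sumrB.
rewrite E1 E2 E6; ring.
Qed.

Lemma partial_radial_phi x : D x -> forall i, partial i phi x = w x * x 0 i.
Proof. by move=> Dx i; apply: partial_eq; exact: dphi. Qed.

Lemma radial_hessian x : D x -> forall i j,
  hessian g phi x i j = (w x * (1 - 2 * s x * B x)) * (i == j)%:R
   + (w1 x - w x * (2 * l x + 2 * s x * C x)) * (x 0 i * x 0 j).
Proof.
move=> Dx i j; rewrite mxE.
have -> : partial i (partial j phi) x = w1 x * (x 0 i * x 0 j) + w x * (i == j)%:R.
  apply: (partial_near_eq (D := D) (G := fun y => w y * y 0 j)) => //.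
    by move=> y Dy; rewrite (partial_radial_phi Dy).
  have h1 := dw Dx i; have h2 := is_derive_coord x i j.
  by derive_eq; ring.
have -> : \sum_p christoffel g p i j x * partial p phi x =
  w x * \sum_p x 0 p * radial_form x (l x * x 0 i) j (l x * x 0 j) i
     (B x * (i == j)%:R + C x * (x 0 i * x 0 j)) p.
  rewrite mulr_sumr; apply: eq_bigr => p _.
  rewrite (radial_christoffel Dx) (partial_radial_phi Dx) /radial_form (eq_sym j p) (eq_sym i p).
  by ring.
by rewrite sum_coord_radial_form -/s; ring.
Qed.

Lemma metric_trace_radial (S : 'rV[R]_n -> 'M[R]_n) x (al be : R) : D x ->
  (forall i j, S x i j = al * (i == j)%:R + be * (x 0 i * x 0 j)) ->
  metric_trace g S x = al * (n%:R * (1 + 2 * s x * k x) - 2 * s x * k x) + 2 * s x * be.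
Proof.
move=> Dx SE; rewrite /metric_trace.
transitivity (\sum_i (x 0 i * x 0 i * (be - k x * al) + al * (1 + 2 * s x * k x))).
  apply: eq_bigr => i _.
  transitivity (\sum_p radial_form x (1 + 2 * s x * k x) i 0 i (- k x * x 0 i) p *
     radial_form x al i 0 i (be * x 0 i) p).
    apply: eq_bigr => p _; rewrite (inverse_radial_metric Dx) SE /radial_form (eq_sym i p).
    by ring.
  rewrite sum_radial_form2 /radial_form !eqxx !mulr1n -/s; ring.
rewrite big_split/= -mulr_suml sum_sqr_coord sumr_const card_ord -/s -[_ *+ n]mulr_natl.
by ring.
Qed.

Lemma sq_norm_grad_radial x : D x -> sq_norm_grad g phi x = 2 * s x * w x ^+ 2.
Proof.
move=> Dx; rewrite /sq_norm_grad mxE.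
transitivity (\sum_j x 0 j * x 0 j * w x ^+ 2); last first.
  by rewrite -mulr_suml sum_sqr_coord.
apply: eq_bigr => j _; rewrite !mxE.
have -> : \sum_p differential phi x 0 p * invmx (g x) p j =
  w x * \sum_p x 0 p * radial_form x (1 + 2 * s x * k x) j 0 j (- k x * x 0 j) p.
  rewrite mulr_sumr; apply: eq_bigr => p _.
  rewrite mxE (partial_radial_phi Dx) (inverse_radial_metric Dx) /radial_form.
  by ring.
by rewrite sum_coord_radial_form (partial_radial_phi Dx) -/s; ring.
Qed.

Definition einstein_tangential x : R := - (3 * l x + 2 * s x * l1 x + 2 * s x * l x ^+ 2)
  + (n%:R - 2) * (k x - 2 * l x - 2 * s x * l x ^+ 2) + w x * (1 + 2 * s x * l x).

Definition einstein_radial (kappa : R) x : R :=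
  - (n%:R - 1) * (3 * l x + 2 * s x * l1 x + 2 * s x * l x ^+ 2)
  + w x + 2 * s x * w1 x - 2 * s x * kappa * w x ^+ 2.

(* The two einstein_ quantities are the eigenvalues of the tensor with respect to g,
   on the tangent spaces of the spheres and in the radial direction. *)
Lemma bakry_emery_radial (m : \bar R) x : D x -> exists2 Q : R,
  a x * einstein_tangential x + 2 * s x * Q = einstein_radial (fine m^-1%E) x &
  forall i j, bakry_emery_ricci g phi m x i j =
    a x * einstein_tangential x * (i == j)%:R + Q * (x 0 i * x 0 j).
Proof.
move=> Dx; set kappa := fine m^-1%E.
exists ((2 * l1 x + 2 * s x * C1 x + (n%:R + 2) * C x - T1 x + T x * (2 * l x + 2 * s x * C x) - bet x)
  + (w1 x - w x * (2 * l x + 2 * s x * C x)) - kappa * w x ^+ 2).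
  have p0 := pos Dx; have pn : 1 + 2 * s x * k x != 0 by rewrite gt_eqF.
  have kinx := kin Dx.
  rewrite /einstein_tangential /einstein_radial /T1 /T /bet /B1 /B /C /a.
  (* At the origin [k1] occurs only with the factor s, and [kin] reduces to l = - k. Elsewhere [kin]
     can be solved for [k1]. *)
  have [s0|s0] := eqVneq (s x) 0.
    move: kinx; rewrite s0 !mul0r mulr0 !mul0r subr0 => E.
    have -> : l x = - k x by lra.
    by rewrite !(addr0, subr0) invr1; ring.
  have -> : k1 x = (- k x - l x - 2 * s x * k x * l x) / s x.
    by apply: eq_divr_mull.
  by field; rewrite pn s0.
move=> i j; rewrite !mxE big_ord1 !mxE -/kappa (partial_radial_phi Dx i) (partial_radial_phi Dx j).
have -> : (\sum_p riemann_curvature g p p i j x) = ricci g x i j by rewrite mxE.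
have := radial_hessian Dx i j; rewrite mxE => ->.
rewrite (radial_ricci Dx).
set P0 := (2 * l x + _ + _ - _ + _ - _).
have -> : a x * einstein_tangential x = P0 + w x * (1 - 2 * s x * B x).
  have p0 := pos Dx; have pn : 1 + 2 * s x * k x != 0 by rewrite gt_eqF.
  have kinx := kin Dx.
  rewrite /P0 /einstein_tangential /T /B1 /B /C /a.
  have [s0|s0] := eqVneq (s x) 0.
    move: kinx; rewrite s0 !mul0r mulr0 !mul0r subr0 => E.
    have -> : l x = - k x by lra.
    by rewrite !(addr0, subr0) invr1; ring.
  have -> : k1 x = (- k x - l x - 2 * s x * k x * l x) / s x.
    by apply: eq_divr_mull.
  by field; rewrite pn s0.
by ring.
Qed.

(** The weighted scalar curvature is the trace of the Bakry-Emery tensor plus Lap phi - |d phi|^2.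
    On a quasi-Einstein space it is therefore free of second derivatives of the metric and becomes
    the equation for w. *)
Lemma weighted_scalar_radial (m : \bar R) x : D x ->
  weighted_scalar_curvature g phi m x = metric_trace g (bakry_emery_ricci g phi m) x
  + ((n%:R - 1) * w x * (1 + 2 * s x * l x) + w x + 2 * s x * w1 x - 2 * s x * w x ^+ 2).
Proof.
move=> Dx; set kappa := fine m^-1%E.
have lapE : laplacian g phi x = (n%:R - 1) * w x * (1 + 2 * s x * l x) + w x + 2 * s x * w1 x.
  rewrite /laplacian (metric_trace_radial Dx (radial_hessian Dx)).
  have p0 := pos Dx; have pn : 1 + 2 * s x * k x != 0 by rewrite gt_eqF.
  have kinx := kin Dx.
  rewrite /B /C /a.
  have [s0|s0] := eqVneq (s x) 0.
    by rewrite s0; field.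
  have -> : k1 x = (- k x - l x - 2 * s x * k x * l x) / s x.
    by apply: eq_divr_mull.
  by field; rewrite pn s0.
have trE : metric_trace g (bakry_emery_ricci g phi m) x =
   scalar_curvature g x + laplacian g phi x - kappa * sq_norm_grad g phi x.
  have sqE : sq_norm_grad g phi x = metric_trace g (fun x => (differential phi x)^T *m differential phi x) x.
    rewrite sq_norm_grad_radial// (metric_trace_radial (al := 0) (be := w x ^+ 2) Dx).
      by ring.
    move=> i j; rewrite !mxE big_ord1 !mxE (partial_radial_phi Dx i) (partial_radial_phi Dx j).
    by ring.
  rewrite sqE /scalar_curvature /laplacian /metric_trace mulr_sumr -!big_split/= -sumrB.
  apply: eq_bigr => i _; rewrite mulr_sumr -!big_split/= -sumrB; apply: eq_bigr => j _.
  by rewrite /bakry_emery_ricci !mxE -/kappa; ring.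
rewrite trE /weighted_scalar_curvature -/kappa sq_norm_grad_radial// lapE.
by ring.
Qed.

End RadialCurvature.

(** * The rotationally symmetric metric in Cartesian coordinates *)

Section RotationalMetric.
Context {R : realType} {n : nat}.
Implicit Types (x : 'rV[R]_n) (i j : 'I_n) (psi phi F : R -> R).

Lemma sqr_euclidean_norm x : euclidean_norm x ^+ 2 = 2 * half_sqnorm x.
Proof.
rewrite /euclidean_norm sqr_sqrtr; last by apply: sumr_ge0 => i _; exact: sqr_ge0.
by rewrite /half_sqnorm; field.
Qed.

Lemma euclidean_norm_ge0 x : 0 <= euclidean_norm x.
Proof. exact: sqrtr_ge0. Qed.

Lemma half_sqnorm_eq0 x : (half_sqnorm x == 0) = (x == 0).
Proof.
rewrite /half_sqnorm mulf_eq0 invr_eq0 pnatr_eq0 orbF psumr_eq0; last by move=> i _; exact: sqr_ge0.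
apply/idP/eqP => [/allP H|->]; last by apply/allP => i _; rewrite mxE expr0n/= eqxx.
apply/rowP => i; rewrite mxE; apply/eqP; rewrite -sqrf_eq0.
by have := H i (mem_index_enum i).
Qed.

Lemma euclidean_norm_gt0 x : (0 < euclidean_norm x) = (x != 0).
Proof.
rewrite lt_neqAle euclidean_norm_ge0 andbT eq_sym -half_sqnorm_eq0.
by rewrite -sqrf_eq0 sqr_euclidean_norm mulf_eq0 pnatr_eq0.
Qed.

Lemma euclidean_norm0 : euclidean_norm (0 : 'rV[R]_n) = 0.
Proof.
by apply/eqP; rewrite eq_le euclidean_norm_ge0 andbT leNgt euclidean_norm_gt0 eqxx.
Qed.

Lemma is_derive_euclidean_norm x i : x != 0 ->
  is_derive x (delta_mx 0 i : 'rV[R]_n) (@euclidean_norm R n) (x 0 i / euclidean_norm x).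
Proof.
move=> x0; have r0 : 0 < euclidean_norm x by rewrite euclidean_norm_gt0.
have h := is_derive_half_sqnorm x i.
have s0 : 0 < 2 * half_sqnorm x by rewrite -sqr_euclidean_norm exprn_gt0.
have h2 : is_derive x (delta_mx 0 i : 'rV[R]_n) (fun y => 2 * half_sqnorm y) (2 * x 0 i).
  by derive_eq; ring.
have := is_derive_comp1 (f := fun y => 2 * half_sqnorm y) (is_derive1_sqrt s0) h2.
have E (y : 'rV[R]_n) : Num.sqrt (2 * half_sqnorm y) = euclidean_norm y.
  by rewrite -sqr_euclidean_norm sqrtr_sqr ger0_norm// euclidean_norm_ge0.
have -> : (fun y => Num.sqrt (2 * half_sqnorm y)) = @euclidean_norm R n by apply/funext.
rewrite E => H; apply: (is_derive_eqf H); field; by rewrite gt_eqF.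
Qed.

Lemma is_derive_radial_fun F (dF : R) x i : x != 0 ->
  is_derive (euclidean_norm x) 1 F dF ->
  is_derive x (delta_mx 0 i : 'rV[R]_n) (fun y => F (euclidean_norm y))
    (dF / euclidean_norm x * x 0 i).
Proof.
move=> x0 hF; apply: (is_derive_eqf (is_derive_comp1 hF (is_derive_euclidean_norm i x0))).
by ring.
Qed.

(** d theta^2 is the Euclidean metric minus dr^2, divided by r^2; so the metric has eigenvalue 1
    along x and (psi/r)^2 on the complement. *)
Lemma rotational_metric_entry psi x : x != 0 -> forall i j,
  let r := euclidean_norm x in
  rotational_metric psi x i j = (psi r / r) ^+ 2 * (i == j)%:R
    + (1 - (psi r / r) ^+ 2) / r ^+ 2 * (x 0 i * x 0 j).
Proof.
move=> x0 i j r; have r0 : 0 < r by rewrite euclidean_norm_gt0.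
have rn0 : r != 0 by rewrite gt_eqF.
rewrite /rotational_metric (negbTE x0) /dr_sq /dtheta_sq !mxE big_ord1 summxE -/r.
have dr q : differential (@euclidean_norm R n) x 0 q = x 0 q / r.
  by rewrite mxE; apply: partial_eq; exact: is_derive_euclidean_norm.
have dth q p : differential (fun y : 'rV[R]_n => y 0 q / euclidean_norm y) x 0 p =
    (p == q)%:R / r - x 0 q * x 0 p / r ^+ 3.
  rewrite mxE; apply: partial_eq.
  have h1 := is_derive_coord x p q; have h2 := is_derive_euclidean_norm p x0.
  derive_eq; first by rewrite -/r.
  by rewrite -/r; field.
rewrite mxE !dr.
have -> : \sum_(q < n) ((differential (fun y : 'rV[R]_n => y 0 q / euclidean_norm y) x)^T *m
     differential (fun y : 'rV[R]_n => y 0 q / euclidean_norm y) x) i j =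
  \sum_q radial_form x r^-1 i 0 i (- x 0 i / r ^+ 3) q * radial_form x r^-1 j 0 j (- x 0 j / r ^+ 3) q.
  apply: eq_bigr => q _; rewrite mxE big_ord1 mxE !dth /radial_form (eq_sym i q) (eq_sym j q).
  by ring.
rewrite sum_radial_form2 /radial_form -sqr_euclidean_norm -/r.
by field.
Qed.

End RotationalMetric.

(** * From a global solution of the system to a quasi-Einstein metric on R^n *)

Section QuasiEinsteinFromFlow.
Context {R : realType} {n : nat}.
Variables (d : R) (l w k f : R -> R).
Hypotheses (d_gt0 : 0 < d)
  (smooth_l : forall j, ck j [set s : R | - d < s] l)
  (smooth_w : forall j, ck j [set s : R | - d < s] w)
  (smooth_k : forall j, ck j [set s : R | - d < s] k)
  (smooth_f : forall j, ck j [set s : R | - d < s] f)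
  (k_pos : forall s, 0 <= s -> 0 < 1 + 2 * s * k s).

Definition profile_psi (r : R) : R := r / Num.sqrt (1 + r ^+ 2 * k (r ^+ 2 / 2)).
Definition profile_phi (r : R) : R := f (r ^+ 2 / 2).

Lemma profile_psi_sqr r : profile_psi r ^+ 2 = r ^+ 2 / (1 + r ^+ 2 * k (r ^+ 2 / 2)).
Proof.
have : 0 < 1 + r ^+ 2 * k (r ^+ 2 / 2).
  have := k_pos (_ : 0 <= r ^+ 2 / 2); rewrite divr_ge0 ?sqr_ge0// => /(_ isT).
  by have -> : 2 * (r ^+ 2 / 2) = r ^+ 2 by field.
by move=> h; rewrite /profile_psi expr_div_n sqr_sqrtr// ltW.
Qed.

(** True at the origin too, where both sides are the identity; smoothness of the metric there rests
    on this formula. *)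
Lemma profile_metric_entry (x : 'rV[R]_n) : forall i j,
  rotational_metric profile_psi x i j =
  (1 + 2 * half_sqnorm x * k (half_sqnorm x))^-1 * (i == j)%:R
  + k (half_sqnorm x) * (1 + 2 * half_sqnorm x * k (half_sqnorm x))^-1 * (x 0 i * x 0 j).
Proof.
move=> i j; have [->|x0] := eqVneq x 0.
  have s0 : half_sqnorm (0 : 'rV[R]_n) = 0 by apply/eqP; rewrite half_sqnorm_eq0.
  by rewrite /rotational_metric eqxx s0 mulr0 mul0r addr0 invr1 !mxE; ring.
rewrite (rotational_metric_entry _ x0).
set r := euclidean_norm x; have r2 : r ^+ 2 = 2 * half_sqnorm x by exact: sqr_euclidean_norm.
have s0 : 0 < half_sqnorm x by rewrite lt_neqAle eq_sym half_sqnorm_eq0 x0 half_sqnorm_ge0.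
have hs : r ^+ 2 / 2 = half_sqnorm x by rewrite r2; field.
have kp := k_pos (ltW s0).
rewrite expr_div_n profile_psi_sqr hs r2.
by field; rewrite !gt_eqF.
Qed.

Lemma dom_ge0 (s : R) : 0 <= s -> - d < s.
Proof. by apply: lt_le_trans; rewrite oppr_lt0. Qed.

Lemma profile_phi_radial (x : 'rV[R]_n) : radial profile_phi x = f (half_sqnorm x).
Proof. by rewrite /radial /profile_phi sqr_euclidean_norm mulrAC divff ?mul1r// pnatr_eq0. Qed.

Lemma profile_riemannian : riemannian_metric (@rotational_metric R n profile_psi).
Proof.
split.
- move=> i j; rewrite (_ : (fun x => _) = (fun x =>
    (1 + 2 * half_sqnorm x * k (half_sqnorm x))^-1 * ((i == j)%:R + k (half_sqnorm x) * (x 0 i * x 0 j)))); last first.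
    by apply/funext => x; rewrite profile_metric_entry; ring.
  apply: dk_smooth => N; apply: dk_mul.
    pose U := [set s : R | 0 < 1 + 2 * s * k s] `&` [set s | - d < s].
    have cU M : ck M [set s | - d < s] (fun s => 1 + 2 * s * k s).
      by apply: ck_add; [exact: ck_cst|apply: ck_mul => //; apply: ck_scale; exact: ck_id].
    apply: (dk_comp_half_sqnorm (U := U) (f := fun s => (1 + 2 * s * k s)^-1)).
      by move=> s s0; split; [exact: k_pos|exact: dom_ge0].
    apply: ck_inv; first by move=> s [h _]; rewrite gt_eqF.
    have sub M (g : R -> R) : ck M [set s | - d < s] g -> ck M U g.
      elim: M g => [|M IH] g /=; first by move=> h s [_ /h].
      by move=> [g' [h1 h2]]; exists g'; split; [move=> s [_ /h1]|exact: IH].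
    exact: sub.
  apply: dk_add; first exact: dk_cst.
  apply: dk_mul; last by apply: dk_mul; exact: dk_coord.
  by apply: (dk_comp_half_sqnorm (U := [set s | - d < s])) => //; exact: dom_ge0.
- move=> x; apply/matrixP => i j; rewrite mxE !profile_metric_entry eq_sym; ring.
- move=> x v v0.
  pose a := (1 + 2 * half_sqnorm x * k (half_sqnorm x))^-1.
  pose xv := \sum_i x 0 i * v 0 i.
  have kp : 0 < 1 + 2 * half_sqnorm x * k (half_sqnorm x) by apply: k_pos; exact: half_sqnorm_ge0.
  have a0 : 0 < a by rewrite invr_gt0.
  have v2 : 0 < 2 * half_sqnorm v.
    by rewrite mulr_gt0// lt_neqAle eq_sym half_sqnorm_eq0 v0 half_sqnorm_ge0.
  have -> : (v *m rotational_metric profile_psi x *m v^T) 0 0 =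
      a * (2 * half_sqnorm v) + k (half_sqnorm x) * a * xv ^+ 2.
    rewrite mxE.
    transitivity (\sum_j (v 0 j * v 0 j * a + x 0 j * v 0 j * (k (half_sqnorm x) * a * xv))).
      apply: eq_bigr => j _; rewrite !mxE.
      transitivity ((\sum_i ((i == j)%:R * (a * v 0 i) + x 0 i * v 0 i * (k (half_sqnorm x) * a * x 0 j))) * v 0 j).
        by congr (_ * _); apply: eq_bigr => i _; rewrite profile_metric_entry -/a; ring.
      by rewrite big_split/= sum_delta -mulr_suml -/xv; ring.
    by rewrite big_split/= -!mulr_suml sum_sqr_coord -/xv; ring.
  have [s0|s0] := eqVneq (half_sqnorm x) 0.
    have x0 : x = 0 by apply/eqP; rewrite -half_sqnorm_eq0 s0.
    have -> : xv = 0 by rewrite /xv x0 big1// => i _; rewrite mxE mul0r.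
    by rewrite expr0n/= mulr0 addr0 mulr_gt0.
  have sp : 0 < half_sqnorm x by rewrite lt_neqAle eq_sym s0 half_sqnorm_ge0.
  (* Cauchy-Schwarz for x and v. Since a (1 + 2 s k) = 1, the quadratic form is a times this
     difference plus (x . v)^2 / |x|^2, which is positive whatever the sign of k. *)
  have CS : 0 <= 2 * half_sqnorm v - xv ^+ 2 / (2 * half_sqnorm x).
    have -> : 2 * half_sqnorm v - xv ^+ 2 / (2 * half_sqnorm x) =
      \sum_i (v 0 i - xv / (2 * half_sqnorm x) * x 0 i) ^+ 2.
      transitivity (\sum_i (v 0 i * v 0 i + x 0 i * v 0 i * (- (xv / half_sqnorm x))
         + x 0 i * x 0 i * (xv / (2 * half_sqnorm x)) ^+ 2)).
        rewrite !big_split/= -!mulr_suml !sum_sqr_coord -/xv.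
        by field.
      by apply: eq_bigr => i _; field.
    by apply: sumr_ge0 => i _; exact: sqr_ge0.
  have -> : a * (2 * half_sqnorm v) + k (half_sqnorm x) * a * xv ^+ 2 =
     a * (2 * half_sqnorm v - xv ^+ 2 / (2 * half_sqnorm x)) + xv ^+ 2 / (2 * half_sqnorm x).
    by rewrite /a; field; rewrite s0 gt_eqF.
  have [xv0|xv0] := eqVneq xv 0.
    by rewrite xv0 expr0n/= mul0r subr0 addr0 mulr_gt0.
  rewrite ltr_wpDl ?mulr_ge0 ?(ltW a0)//; apply: divr_gt0; last by rewrite mulr_gt0.
  by rewrite lt_neqAle eq_sym sqrf_eq0 xv0 sqr_ge0.
Qed.

Lemma profile_smooth_phi : smooth (@radial R n profile_phi).
Proof.
rewrite (_ : radial profile_phi = (fun x : 'rV[R]_n => f (half_sqnorm x))); last first.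
  by apply/funext => x; exact: profile_phi_radial.
apply: dk_smooth => N.
by apply: (dk_comp_half_sqnorm (U := [set s | - d < s])) => //; exact: dom_ge0.
Qed.

Variable m : \bar R.
Let kappa := fine m^-1%E.
Hypothesis flow : forall s, - d < s -> reduced_flow n%:R kappa l w k f s.
Hypothesis constraint : forall r, 0 < r ->
  hamiltonian n%:R kappa (fun r => l (r ^+ 2 / 2)) (fun r => w (r ^+ 2 / 2))
    (fun r => k (r ^+ 2 / 2)) (fun r => f (r ^+ 2 / 2)) r = 0.

(** The equation for l is the vanishing of the tangential eigenvalue. Together with the equation for
    w, the constraint then makes the radial eigenvalue vanish, so Q = 0 away from the origin. The
    equation for w alone gives the weighted scalar curvature. *)
Lemma profile_curvature (x : 'rV[R]_n) :
  bakry_emery_ricci (@rotational_metric R n profile_psi) (radial profile_phi) m x = 0 /\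
  weighted_scalar_curvature (@rotational_metric R n profile_psi) (radial profile_phi) m x =
    - potential_weight kappa (radial profile_phi x).
Proof.
have s_dom (y : 'rV[R]_n) : - d < half_sqnorm y by apply: dom_ge0; exact: half_sqnorm_ge0.
have [l' [hl _]] := smooth_l 1; have [w' [hw _]] := smooth_w 1.
have [k' [hk [k'' [hk' _]]]] := smooth_k 2; have [f' [hf _]] := smooth_f 1.
have grad (F F' : R -> R) : (forall s, - d < s -> is_derive s 1 F (F' s)) ->
    radial_gradient [set: 'rV[R]_n] (fun y => F (half_sqnorm y)) (fun y => F' (half_sqnorm y)).
  by move=> hF y _ i; apply: is_derive_comp1; [exact: hF|exact: is_derive_half_sqnorm].
have uniq (F : R -> R) (s u v : R) : is_derive s 1 F u -> is_derive s 1 F v -> u = v.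
  by move=> [_ <-] [_ <-].
have eqs s : - d < s ->
  [/\ 2 * s * l' s = (n%:R - 2) * k s - (2 * n%:R - 1) * l s + w s
        + 2 * s * (w s * l s - (n%:R - 1) * l s ^+ 2),
      2 * s * w' s = - n%:R * w s - potential_weight kappa (f s)
        + 2 * s * (w s ^+ 2 - (n%:R - 1) * l s * w s),
      2 * s * k' s = - 2 * k s - 2 * l s - 4 * s * k s * l s & f' s = w s].
  move=> sd; have [dl [dw [dk [[h1 h2 h3 h4] E1 E2 E3]]]] := flow sd.
  rewrite (uniq _ _ _ _ (hl s sd) h1) (uniq _ _ _ _ (hw s sd) h2) (uniq _ _ _ _ (hk s sd) h3).
  by rewrite (uniq _ _ _ _ (hf s sd) h4).
pose D := [set: 'rV[R]_n].
pose L1 (F : R -> R) (y : 'rV[R]_n) := F (half_sqnorm y).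
pose L := L1 l; pose K := L1 k; pose W := L1 w.
have gphi : radial_gradient D (@radial R n profile_phi) (fun y => w (half_sqnorm y)).
  rewrite (_ : radial profile_phi = (fun x : 'rV[R]_n => f (half_sqnorm x))); last first.
    by apply/funext => y; exact: profile_phi_radial.
  by apply: grad => s sd; have [_ _ _ <-] := eqs s sd; exact: hf.
have pos (y : 'rV[R]_n) : D y -> 0 < 1 + 2 * half_sqnorm y * k (half_sqnorm y).
  by move=> _; apply: k_pos; exact: half_sqnorm_ge0.
have gE (y : 'rV[R]_n) : D y -> forall i j, rotational_metric profile_psi y i j =
    (1 + 2 * half_sqnorm y * k (half_sqnorm y))^-1 * (i == j)%:R
    + k (half_sqnorm y) * (1 + 2 * half_sqnorm y * k (half_sqnorm y))^-1 * (y 0 i * y 0 j).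
  by move=> _; exact: profile_metric_entry.
have kin (y : 'rV[R]_n) : D y -> half_sqnorm y * k' (half_sqnorm y) = - k (half_sqnorm y)
    - l (half_sqnorm y) - 2 * half_sqnorm y * k (half_sqnorm y) * l (half_sqnorm y).
  move=> _; have [_ _ E _] := eqs _ (s_dom y).
  apply: (mulfI (_ : (2 : R) != 0)); first by rewrite pnatr_eq0.
  by rewrite mulrA E; ring.
have Dx : D x by [].
have gl := grad l l' hl; have gk := grad k k' hk; have gk' := grad k' k'' hk'.
have gw := grad w w' hw.
have B0 : bakry_emery_ricci (@rotational_metric R n profile_psi) (radial profile_phi) m x = 0.
  have [Q EQ ER] := @bakry_emery_radial R n D _ (radial profile_phi) L (L1 l') K (L1 k') (L1 k'') W (L1 w')
    openT pos gE gl gk gk' kin gphi gw m x Dx.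
  have [El Ew _ _] := eqs _ (s_dom x).
  have T0 : einstein_tangential (fun y => l (half_sqnorm y)) (fun y => l' (half_sqnorm y))
      (fun y => k (half_sqnorm y)) (fun y => w (half_sqnorm y)) x = 0.
    by rewrite /einstein_tangential El; ring.
  apply/matrixP => i j; rewrite ER T0 mulr0 mul0r add0r mxE.
  have [x0|x0] := eqVneq x 0; first by rewrite x0 !mxE mul0r mulr0.
  have s0 : 0 < half_sqnorm x by rewrite lt_neqAle eq_sym half_sqnorm_eq0 x0 half_sqnorm_ge0.
  suff -> : Q = 0 by rewrite mul0r.
  move: EQ; rewrite T0 mulr0 add0r /einstein_radial /W /L /L1.
  have := constraint (r := euclidean_norm x); rewrite euclidean_norm_gt0 => /(_ x0).
  rewrite /hamiltonian sqr_euclidean_norm.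
  have -> : 2 * half_sqnorm x / 2 = half_sqnorm x by field.
  rewrite El Ew -/kappa => H0 H1.
  have s2 : 2 * half_sqnorm x != 0 by rewrite gt_eqF// mulr_gt0.
  by apply: (mulfI s2); rewrite mulr0 H1 -[RHS]H0; ring.
split=> //.
rewrite (@weighted_scalar_radial R n D _ (radial profile_phi) L K (L1 k') W (L1 w')
    openT pos gE gk kin gphi gw m x Dx).
have -> : metric_trace (@rotational_metric R n profile_psi)
    (bakry_emery_ricci (@rotational_metric R n profile_psi) (radial profile_phi) m) x = 0.
  by rewrite /metric_trace big1// => i _; rewrite big1// => j _; rewrite B0 mxE mulr0.
have [_ Ew _ _] := eqs _ (s_dom x).
by rewrite profile_phi_radial /W /L /L1 Ew; ring.
Qed.

End QuasiEinsteinFromFlow.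

(** * Existence *)

Lemma fine_inv_bounds (R : realType) (m : \bar R) : (1 < m)%E -> 0 <= fine m^-1%E < 1.
Proof.
case: m => [r| |//]; last by rewrite invey/= lexx ltr01.
rewrite lte_fin => r1; have r0 : 0 < r by apply: lt_trans r1.
by rewrite inver gt_eqF//= invr_ge0 (ltW r0)/= invf_lt1.
Qed.

Lemma characteristic_constantE (R : realType) n (g : 'rV[R]_n -> 'M[R]_n) phi (m : \bar R) :
  (1 < m)%E -> characteristic_constant g phi m (normalized_constant m) <->
  forall x, weighted_scalar_curvature g phi m x = - potential_weight (fine m^-1%E) (phi x).
Proof.
case: m => [r| |//]; last first.
  move=> _; have E x : potential_weight (fine (+oo%E : \bar R)^-1) (phi x) = 1.
    by rewrite invey/= /potential_weight mulr0 mul0r expR0 subr0 divr1.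
  by split=> /= h x; rewrite h ?E.
rewrite lte_fin => r1; have r0 : 0 < r by apply: lt_trans r1.
have rn : r != 0 by rewrite gt_eqF.
have r1n : r - 1 != 0 by rewrite gt_eqF// subr_gt0.
have E x : potential_weight (fine (r%:E : \bar R)^-1) (phi x) = r * (1 / (r - 1)) * expR (2 / r * phi x).
  rewrite inver gt_eqF//= /potential_weight; field.
  by rewrite r1n rn.
split=> /= h x; last by rewrite h E addNr.
by apply/eqP; rewrite E -addr_eq0; apply/eqP; exact: h.
Qed.

(** The flow is returned along with the solution because the asymptotics are read from it. *)
Lemma normalized_solution_exists (R : realType) (n : nat) (m : \bar R) :
  (3 <= n)%N -> (1 < m)%E ->
  exists l w k f : R -> R,
    normalized_solution n m f (fun r => r / Num.sqrt (1 + r ^+ 2 * k r)) /\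
    forall T : R, admissible_flow n%:R (fine m^-1%E) l w k f T.
Proof.
move=> n3 m1; pose kappa := fine m^-1%E.
have k01 : 0 <= kappa < 1 := fine_inv_bounds m1.
have [_ k1] := andP k01.
have nu3 : 3 <= n%:R :> R by rewrite ler_nat.
have [d d0 [cl [cw [ck' [cf [l [w [k [f [[sl sw sk sf] germ f0 flow]]]]]]]]]] :=
  global_reduced_flow nu3 k01.
pose rl r := l (r ^+ 2 / 2); pose rw r := w (r ^+ 2 / 2).
pose rk r := k (r ^+ 2 / 2); pose rf r := f (r ^+ 2 / 2).
have dom (s : R) : 0 <= s -> - d < s by apply: lt_le_trans; rewrite oppr_lt0.
have [tm neg] : tame_at_origin rl rw rk rf /\ exists2 d : R, 0 < d & forall r : R, 0 < r < d -> rw r < 0.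
  by apply: (tame_reduced_flow nu3 k01 d0) => // s /andP[+ _]; exact: flow.
have adm (T : R) : admissible_flow n%:R kappa rl rw rk rf T.
  split=> // r _; apply: radial_flow_reduced; apply: flow; apply: dom.
  by rewrite divr_ge0// sqr_ge0.
exists rl, rw, rk, rf; split=> //.
have sgn (r : R) : 0 < r -> [/\ 0 < 1 + r ^+ 2 * rk r, 0 < 1 + r ^+ 2 * rl r & rw r < 0].
  by move=> r0; apply: (a_priori_signs (adm (r + 1))); rewrite r0 ltrDl ltr01.
have k_pos (s : R) : 0 <= s -> 0 < 1 + 2 * s * k s.
  rewrite le_eqVlt => /orP[/eqP <-|s0]; first by rewrite mulr0 mul0r addr0.
  have s2 : 0 < 2 * s by rewrite mulr_gt0.
  have [+ _ _] := sgn (Num.sqrt (2 * s)) (ltac:(by rewrite sqrtr_gt0)).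
  rewrite /rk sqr_sqrtr ?(ltW s2)//.
  by have -> : 2 * s / 2 = s by field.
have constraint (r : R) : 0 < r -> hamiltonian n%:R kappa rl rw rk rf r = 0.
  by move=> r0; apply: (hamiltonian_eq0 (adm (r + 1))); rewrite r0 ltrDl ltr01.
have smooth j : [/\ ck j [set s | - d < s] l, ck j [set s | - d < s] w,
    ck j [set s | - d < s] k & ck j [set s | - d < s] f].
  by apply: (@ck_reduced_flow R n%:R kappa d cl cw ck' cf).
have sml j : ck j [set s | - d < s] l by have [] := smooth j.
have smw j : ck j [set s | - d < s] w by have [] := smooth j.
have smk j : ck j [set s | - d < s] k by have [] := smooth j.
have smf j : ck j [set s | - d < s] f by have [] := smooth j.
have curv := @profile_curvature R n d l w k f d0 sml smw smk smf k_pos m flow constraint.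
have psi0 : (0 : R) / Num.sqrt (1 + 0 ^+ 2 * rk 0) = 0 by rewrite mul0r.
have psi_pos (r : R) : 0 < r -> 0 < r / Num.sqrt (1 + r ^+ 2 * rk r).
  by move=> r0; rewrite divr_gt0// sqrtr_gt0; have [] := sgn r r0.
have phi01 : rf 1 < rf 0.
  have dN (r : R) : is_derive r 1 (fun t => rf t) (r * rw r).
    have [? [? [? [[_ _ _ h] _ _ _]]]] : radial_flow n%:R kappa rl rw rk rf r.
      by apply: radial_flow_reduced; apply: flow; apply: dom; rewrite divr_ge0// sqr_ge0.
    exact: h.
  have [c /andP[c0 c1]] := mean_value (ltr01 : (0 : R) < 1) (fun z _ => dN z).
  rewrite subr0 mulr1 -subr_lt0 => ->.
  by rewrite nmulr_llt0//; have [] := sgn c c0.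
have rf0 : rf 0 = 1 by rewrite /rf expr0n/= mul0r.
split=> //; last first.
  apply/characteristic_constantE => // x; have [_ h] := curv x; exact: h.
split.
- by exists 0, 1; split=> //; apply/eqP; rewrite gt_eqF.
- by exists 0, 1; split=> //; apply/eqP; rewrite lt_eqF// psi0 psi_pos.
- by split.
- split=> //; first exact: (profile_riemannian d0 smk k_pos).
    exact: (profile_smooth_phi d0 smf).
  by move=> x; have [h _] := curv x; exact: h.
- have n0 : (0 < n)%N by apply: leq_trans n3.
  exists 0, (delta_mx 0 (Ordinal n0)).
  rewrite /radial euclidean_norm0.
  have -> : euclidean_norm (delta_mx 0 (Ordinal n0) : 'rV[R]_n) = 1.
    rewrite /euclidean_norm (bigD1 (Ordinal n0))//= big1 ?addr0.
      by rewrite mxE !eqxx expr1n sqrtr1.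
    by move=> i ni; rewrite mxE (negbTE ni) andbF expr0n.
  by apply/eqP; rewrite gt_eqF.
Qed.

(** * Uniqueness of normalized solutions *)

Section EvenFunctions.
Context {R : realType}.
Variable F : nat -> R -> R.
Hypotheses (derF : forall j (t : R), is_derive t 1 (F j) (F j.+1 t))
  (evenF : forall t : R, F 0%N (- t) = F 0%N t).

Lemma even_derive0 : F 1%N 0 = 0.
Proof.
have hN : is_derive (0 : R) 1 (fun t : R => - t) (-1).
  by apply: is_derive_oppf; exact: is_derive_idf.
have := is_derive_comp1 (f := fun t : R => - t) (derF 0 (- 0)) hN.
have -> : (fun t => F 0%N (- t)) = F 0%N by apply/funext.
move=> [_]; have [_ ->] := derF 0 0; rewrite oppr0 mulrN1 => h.
have e : F 1%N 0 + F 1%N 0 = 0 by rewrite {1}h addNr.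
lra.
Qed.

(** The derivative of an even function vanishes at 0, and the second derivative is bounded on
    [0, 1]; the mean value theorem is applied twice. These are the orders of vanishing behind
    [tame_at_origin]. *)
Lemma even_bounds : exists2 B : R, 0 <= B & forall r, 0 < r <= 1 ->
  `|F 1%N r| <= B * r /\ `|F 0%N r - F 0%N 0| <= B * r ^+ 2.
Proof.
have [B hB] : exists B : R, forall r, 0 <= r <= 1 -> `|F 2%N r| <= B.
  by apply: bounded_on_segment => // r _; have [] := derF 2 r.
have B0 : 0 <= B by apply: le_trans (normr_ge0 _) (hB 0 _); rewrite lexx ler01.
have h1 (r : R) : 0 < r <= 1 -> `|F 1%N r| <= B * r.
  move=> /andP[r0 r1].
  have [c /andP[c0 cr]] := mean_value r0 (fun z _ => derF 1 z).
  rewrite even_derive0 !subr0 => ->; rewrite normrM (gtr0_norm r0) ler_wpM2r ?(ltW r0)//.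
  by apply: hB; rewrite (ltW c0) (le_trans (ltW cr)).
exists B => // r /andP[r0 r1]; split; first by apply: h1; rewrite r0.
have [c /andP[c0 cr]] := mean_value r0 (fun z _ => derF 0 z).
rewrite subr0 => ->; rewrite normrM (gtr0_norm r0) expr2 mulrA ler_wpM2r ?(ltW r0)//.
have hc : `|F 1%N c| <= B * c by apply: h1; rewrite c0 (le_trans (ltW cr)).
by apply: le_trans hc _; rewrite ler_wpM2l// ltW.
Qed.

End EvenFunctions.

Lemma derivable_is_derive (R : realType) (F : R -> R) (r : R) :
  (exists a : R, is_derive r 1 F a) -> is_derive r 1 F ('D_1 F r).
Proof. by move=> [a [h _]]; apply: DeriveDef. Qed.

Section AxisRestriction.
Context {R : realType} {n : nat}.
Variable i0 : 'I_n.

Lemma is_derive_axis (F : 'rV[R]_n -> R) : smooth F -> forall j (t : R),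
  is_derive t 1 (fun t => iter j (partial i0) F (t *: delta_mx 0 i0))
    (iter j.+1 (partial i0) F (t *: delta_mx 0 i0)).
Proof.
move=> sF j t.
have E i : iter i (partial i0) F = foldr partial F (nseq i i0) by elim: i => //= i ->.
have [_ dF] := sF (nseq j i0).
have h : is_derive (t *: delta_mx 0 i0) (delta_mx 0 i0 : 'rV[R]_n) (iter j (partial i0) F)
    (iter j.+1 (partial i0) F (t *: delta_mx 0 i0)).
  by apply: DeriveDef => //; rewrite E; exact: dF.
move/is_derive_lineE: h => h.
have hs : is_derive t 1 (fun u : R => u - t) 1 by derive_eq; rewrite ?subr0 ?addr0.
have h' : is_derive (t - t) 1 (fun u : R => iter j (partial i0) F (u *: delta_mx 0 i0 + t *: delta_mx 0 i0))
   (iter j.+1 (partial i0) F (t *: delta_mx 0 i0)) by rewrite subrr.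
have := is_derive_comp1 (f := fun u : R => u - t) h' hs; rewrite mulr1.
congr (is_derive _ _ _ _); apply/funext => u.
by rewrite -scalerDl subrK.
Qed.

Lemma euclidean_norm_axis (t : R) : euclidean_norm (t *: delta_mx 0 i0 : 'rV[R]_n) = `|t|.
Proof.
rewrite /euclidean_norm (bigD1 i0)//= big1 ?addr0.
  by rewrite !mxE !eqxx mulr1 sqrtr_sqr.
by move=> i ni; rewrite !mxE (negbTE ni) andbF mulr0 expr0n.
Qed.

End AxisRestriction.

(** On the axis of [i0] the diagonal entry of index [i1], a direction tangent to the sphere, equals
    (psi/r)^2; as the restriction of a smooth function it extends smoothly through t = 0, and it is
    even. From it and from phi come l, w and k, and evenness gives tameness. *)
Lemma normalized_solution_flow (R : realType) (n : nat) (m : \bar R) (phi psi : R -> R) :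
  (3 <= n)%N -> (1 < m)%E -> normalized_solution n m phi psi ->
  exists l w k f : R -> R,
   [/\ forall r : R, 0 < r -> radial_flow n%:R (fine m^-1%E) l w k f r,
       tame_at_origin l w k f, forall r : R, 0 <= r -> phi r = f r &
       forall r : R, 0 < r -> psi r = r / Num.sqrt (1 + r ^+ 2 * k r)].
Proof.
move=> n3 m1 [[_ _ [psi0 psi_pos] [[smg _ _] smphi _ BE0] _] phi01].
move=> /(characteristic_constantE _ _ m1) WS.
have i0P : (0 < n)%N by apply: leq_trans n3.
have i1P : (1 < n)%N by apply: leq_trans n3.
pose i0 : 'I_n := Ordinal i0P; pose i1 : 'I_n := Ordinal i1P.
pose ax (t : R) : 'rV[R]_n := t *: delta_mx 0 i0.
have axN (t : R) : euclidean_norm (ax t) = `|t| by exact: euclidean_norm_axis.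
have ax0 (t : R) : t != 0 -> ax t != 0.
  by move=> t0; rewrite -euclidean_norm_gt0 axN normr_gt0.
have ax1 (t : R) : ax t 0 i1 = 0.
  by rewrite /ax mxE mxE (_ : (i1 == i0) = false) ?andbF ?mulr0.
pose G (x : 'rV[R]_n) := rotational_metric psi x i1 i1.
pose h j (t : R) := iter j (partial i0) G (ax t).
pose p j (t : R) := iter j (partial i0) (@radial R n phi) (ax t).
have dh j (t : R) : is_derive t 1 (h j) (h j.+1 t) by exact: (is_derive_axis i0 (smg i1 i1)).
have dp j (t : R) : is_derive t 1 (p j) (p j.+1 t) by exact: (is_derive_axis i0 smphi).
have hE (t : R) : t != 0 -> h 0%N t = (psi `|t| / `|t|) ^+ 2.
  move=> t0; rewrite /h /= /G (rotational_metric_entry _ (ax0 t t0)) axN eqxx.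
  by rewrite ax1 !mulr0 mulr1 addr0.
have h0 : h 0%N 0 = 1.
  by rewrite /h /= /G /rotational_metric /ax scale0r eqxx mxE eqxx.
have pE (t : R) : p 0%N t = phi `|t| by rewrite /p /= /radial axN.
have h_even (t : R) : h 0%N (- t) = h 0%N t.
  have [->|t0] := eqVneq t 0; first by rewrite oppr0.
  by rewrite !hE ?oppr_eq0// normrN.
have p_even (t : R) : p 0%N (- t) = p 0%N t by rewrite !pE normrN.
have h_pos (t : R) : 0 <= t -> 0 < h 0%N t.
  rewrite le_eqVlt => /orP[/eqP <-|t0]; first by rewrite h0.
  by rewrite hE ?gt_eqF// gtr0_norm// exprn_gt0// divr_gt0// psi_pos.
have h_neq (t : R) : 0 < t -> h 0%N t != 0 by move=> /ltW/h_pos t0; rewrite gt_eqF.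
(* With h = (psi/r)^2 one has 1 + r^2 k = 1/h, and psi'/psi = 1/r + h'/(2 h) dictates l = h'/(2 r
   h). *)
pose k (r : R) := ((h 0%N r)^-1 - 1) / r ^+ 2.
pose l (r : R) := h 1%N r / (2 * r * h 0%N r).
pose w (r : R) := p 1%N r / r.
have kh (r : R) : 0 < r -> 1 + r ^+ 2 * k r = (h 0%N r)^-1.
  by move=> r0; rewrite /k; field; rewrite h_neq// gt_eqF.
have dp0 (r : R) : 0 < r -> is_derive r 1 (p 0%N) (r * w r).
  move=> r0; apply: (is_derive_eqf (dp 0%N r)); rewrite /w; field; by rewrite gt_eqF.
pose dk (r : R) := - h 1%N r / (h 0%N r ^+ 2 * r ^+ 2) - 2 * ((h 0%N r)^-1 - 1) / r ^+ 3.
have der_k (r : R) : 0 < r -> is_derive r 1 k (dk r).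
  move=> r0; have H0 := dh 0%N r; have hn := h_neq r r0; have rn : r != 0 by rewrite gt_eqF.
  rewrite /k; derive_eq => //; first by rewrite expf_neq0.
  by rewrite /dk /=; field; rewrite rn hn.
have der_dk (r : R) : 0 < r -> is_derive r 1 (fun t => dk t / t) ('D_1 (fun t => dk t / t) r).
  move=> r0; apply: derivable_is_derive.
  have H0 := dh 0%N r; have H1 := dh 1%N r; have hn := h_neq r r0; have rn : r != 0 by rewrite gt_eqF.
  eexists; rewrite /dk; derive_auto => //; try by rewrite ?mulf_neq0 ?expf_neq0.
have der_l (r : R) : 0 < r -> is_derive r 1 l ('D_1 l r).
  move=> r0; apply: derivable_is_derive.
  have H0 := dh 0%N r; have H1 := dh 1%N r; have hn := h_neq r r0; have rn : r != 0 by rewrite gt_eqF.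
  by eexists; rewrite /l; derive_auto; rewrite !mulf_neq0.
have der_w (r : R) : 0 < r -> is_derive r 1 w ('D_1 w r).
  move=> r0; apply: derivable_is_derive.
  have H1 := dp 1%N r; have rn : r != 0 by rewrite gt_eqF.
  by eexists; rewrite /w; derive_auto.
pose D := [set x : 'rV[R]_n | x != 0].
have openD : open D.
  have -> : D = ~` [set 0] by apply/seteqP; split=> x /=; [move/eqP|move/eqP].
  by apply: closed_openC; apply: accessible_closed_set1; exact: hausdorff_accessible.
have grad (F F' : R -> R) : (forall r : R, 0 < r -> is_derive r 1 F (F' r)) ->
    radial_gradient D (fun x => F (euclidean_norm x)) (fun x => F' (euclidean_norm x) / euclidean_norm x).
  move=> hF x Dx i; apply: is_derive_radial_fun => //; apply: hF.
  by rewrite euclidean_norm_gt0.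
have gl := grad _ _ der_l; have gk := grad _ _ der_k; have gdk := grad _ _ der_dk.
have gw := grad _ _ der_w.
have gp : radial_gradient D (@radial R n phi) (fun x => w (euclidean_norm x)).
  have -> : @radial R n phi = (fun x => p 0%N (euclidean_norm x)).
    by apply/funext => x; rewrite pE ger0_norm// euclidean_norm_ge0.
  move=> x Dx i; have r0 : 0 < euclidean_norm x by rewrite euclidean_norm_gt0.
  by have := grad _ _ (fun r _ => dp 0%N r) x Dx i.
have r2 (x : 'rV[R]_n) : 2 * half_sqnorm x = euclidean_norm x ^+ 2 by rewrite sqr_euclidean_norm.
have pos (x : 'rV[R]_n) : D x -> 0 < 1 + 2 * half_sqnorm x * k (euclidean_norm x).
  move=> Dx; have r0 : 0 < euclidean_norm x by rewrite euclidean_norm_gt0.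
  by rewrite r2 kh// invr_gt0; apply: h_pos; exact: ltW.
have gE (x : 'rV[R]_n) : D x -> forall i j, rotational_metric psi x i j =
    (1 + 2 * half_sqnorm x * k (euclidean_norm x))^-1 * (i == j)%:R
    + k (euclidean_norm x) * (1 + 2 * half_sqnorm x * k (euclidean_norm x))^-1 * (x 0 i * x 0 j).
  move=> Dx i j; have r0 : 0 < euclidean_norm x by rewrite euclidean_norm_gt0.
  rewrite rotational_metric_entry// r2 kh// invrK.
  have := hE (euclidean_norm x); rewrite gt_eqF// gtr0_norm// => /(_ isT) <-.
  by rewrite /k; field; rewrite h_neq// gt_eqF.
have kin (x : 'rV[R]_n) : D x -> half_sqnorm x * (dk (euclidean_norm x) / euclidean_norm x)
    = - k (euclidean_norm x) - l (euclidean_norm x)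
      - 2 * half_sqnorm x * k (euclidean_norm x) * l (euclidean_norm x).
  move=> Dx; have r0 : 0 < euclidean_norm x by rewrite euclidean_norm_gt0.
  have -> : half_sqnorm x = euclidean_norm x ^+ 2 / 2 by rewrite -r2; field.
  by rewrite /dk /k /l; field; rewrite h_neq// gt_eqF.
exists l, w, k, (p 0%N); split.
- move=> r r0; have rn : r != 0 by rewrite gt_eqF.
  have Dx : D (ax r) by exact: ax0.
  have nr : euclidean_norm (ax r) = r by rewrite axN gtr0_norm.
  have s2 : 2 * half_sqnorm (ax r) = r ^+ 2 by rewrite r2 nr.
  have [Q _ ER] := bakry_emery_radial openD pos gE gl gk gdk kin gp gw m Dx.
  (* The coordinate [i1] of a point of the axis is 0, so [Q] drops out of this entry and the
     tangential eigenvalue remains. *)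
  have T0 : einstein_tangential (fun x => l (euclidean_norm x))
      (fun x => 'D_1 l (euclidean_norm x) / euclidean_norm x)
      (fun x => k (euclidean_norm x)) (fun x => w (euclidean_norm x)) (ax r) = 0.
    have := ER i1 i1; rewrite BE0 mxE eqxx ax1 !mulr0 addr0 mulr1 => /esym/eqP.
    by rewrite mulf_eq0 invr_eq0 gt_eqF/= ?pos// => /eqP.
  have W0 := weighted_scalar_radial openD pos gE gk kin gp gw m Dx.
  have TR : metric_trace (@rotational_metric R n psi)
      (bakry_emery_ricci (@rotational_metric R n psi) (radial phi) m) (ax r) = 0.
    by rewrite /metric_trace big1// => i _; rewrite big1// => j _; rewrite BE0 mxE mulr0.
  rewrite WS TR add0r s2 nr in W0.
  rewrite /einstein_tangential s2 nr in T0.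
  have fE : radial phi (ax r) = p 0%N r by rewrite pE /radial nr gtr0_norm.
  rewrite fE in W0.
  exists ('D_1 l r), ('D_1 w r), (dk r); split.
  + by split; [exact: der_l|exact: der_w|exact: der_k|exact: dp0].
  + have E : r * 'D_1 l r = r ^+ 2 * ('D_1 l r / r) by field.
    rewrite E; move: T0; set X := r ^+ 2 * ('D_1 l r / r) => T0.
    by rewrite -[LHS]addr0 -T0; ring.
  + have E : r * 'D_1 w r = r ^+ 2 * ('D_1 w r / r) by field.
    rewrite E; move: W0; set X := r ^+ 2 * ('D_1 w r / r) => ->; ring.
  + by rewrite /dk /k /l; field; rewrite h_neq// rn.
- have [Bh Bh0 bh] := even_bounds dh h_even.
  have [Bp Bp0 bp] := even_bounds dp p_even.
  have [Bi bi] : exists B : R, forall r, 0 <= r <= 1 -> `|(h 0%N r)^-1| <= B.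
    apply: bounded_on_segment => // r /andP[r0 _].
    have H0 := dh 0%N r; have hn : h 0%N r != 0 by rewrite gt_eqF// h_pos.
    by have [] := is_derive_invf hn H0.
  have Bi0 : 0 <= Bi by apply: le_trans (normr_ge0 _) (bi 0 _); rewrite lexx ler01.
  exists (Bh * Bi + Bp), 1; split=> // r /andP[r0 r1].
  have r01 : 0 < r <= 1 by rewrite r0 ltW.
  have [h1 h2] := bh r r01; have [p1 p2] := bp r r01.
  have hi : `|(h 0%N r)^-1| <= Bi by apply: bi; rewrite !ltW.
  have M0 : 0 <= Bh * Bi by rewrite mulr_ge0.
  have rn : r != 0 by rewrite gt_eqF.
  have q1 : `|h 1%N r / r| <= Bh by rewrite normrM normfV (gtr0_norm r0) ler_pdivrMr.
  have q2 : `|(h 0%N r - 1) / r ^+ 2| <= Bh.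
    by rewrite normrM normfV (gtr0_norm (exprn_gt0 2 r0)) ler_pdivrMr ?exprn_gt0// -h0.
  split.
  + have -> : l r = 2^-1 * (h 1%N r / r * (h 0%N r)^-1).
      by rewrite /l; field; rewrite h_neq.
    have := normrM_le q1 hi.
    rewrite [in X in _ -> X]normrM (gtr0_norm (_ : 0 < 2^-1 :> R)) ?invr_gt0// => q.
    by move: (normr_ge0 (h 1%N r / r / h 0%N r)) => q0; clear -q q0 M0 Bp0; lra.
  + rewrite /w normrM normfV (gtr0_norm r0) ler_pdivrMr//.
    by apply: le_trans p1 _; rewrite ler_wpM2r ?(ltW r0)// lerDr.
  + have -> : k r = - ((h 0%N r - 1) / r ^+ 2 * (h 0%N r)^-1).
      by rewrite /k; field; rewrite h_neq.
    by rewrite normrN; apply: le_trans (normrM_le q2 hi) _; rewrite lerDl.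
  + have p00 : p 0%N 0 = 1 by rewrite pE normr0.
    by rewrite -p00; apply: le_trans p2 _; rewrite ler_wpM2r ?sqr_ge0// lerDr.
- by move=> r r0; rewrite pE ger0_norm.
- move=> r r0; rewrite kh// sqrtrV ?(ltW (h_pos _ (ltW r0)))// invrK hE ?gt_eqF// gtr0_norm//.
  rewrite sqrtr_sqr ger0_norm ?divr_ge0 ?(ltW r0) ?(ltW (psi_pos _ r0))//.
  by field; rewrite gt_eqF.
Qed.

Lemma normalized_solution_unique (R : realType) (n : nat) (m : \bar R) (phi psi phi' psi' : R -> R) :
  (3 <= n)%N -> (1 < m)%E ->
  normalized_solution n m phi psi -> normalized_solution n m phi' psi' ->
  forall r : R, 0 <= r -> phi' r = phi r /\ psi' r = psi r.
Proof.
move=> n3 m1 sol sol' r.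
have [k0 k1] := andP (fine_inv_bounds m1).
have nu3 : 3 <= n%:R :> R by rewrite ler_nat.
have [l [w [k [f [flow tame phiE psiE]]]]] := normalized_solution_flow n3 m1 sol.
have [l' [w' [k' [f' [flow' tame' phiE' psiE']]]]] := normalized_solution_flow n3 m1 sol'.
rewrite le_eqVlt => /orP[/eqP <-|r0].
  have [[_ _ [-> _] _ _] -> _] := sol.
  by have [[_ _ [-> _] _ _] -> _] := sol'.
have [_ _ kE fE] := @radial_flow_unique R n%:R (fine m^-1%E) nu3 k0 k1 _ _ _ _ _ _ _ _ (r + 1) tame tame'
  (fun t tT => flow t (proj1 (andP tT))) (fun t tT => flow' t (proj1 (andP tT))) r
  (ltac:(by rewrite r0 ltrDl ltr01)).
by rewrite phiE ?ltW// phiE' ?ltW// fE psiE// psiE'// kE.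
Qed.

(** * Asymptotics *)

Section Eventually.
Context {R : realType}.
Implicit Types (f g y eta c rho P u du : R -> R).

Lemma near_pinfty_ge1 (Q : R -> Prop) : (\forall r \near +oo, Q r) ->
  exists2 M : R, 1 <= M & forall r, M <= r -> Q r.
Proof.
move=> [M [_ h]]; exists (Num.max (M + 1) 1); first by rewrite le_max lexx orbT.
move=> r hr; apply: h; apply: lt_le_trans hr.
by rewrite lt_max ltrDl ltr01.
Qed.

Lemma near_pinfty_of_ge (Q : R -> Prop) (M : R) : (forall r, M <= r -> Q r) ->
  \forall r \near +oo, Q r.
Proof. by move=> h; apply: filterS (nbhs_pinfty_ge (num_real M)) => r; exact: h. Qed.

Lemma cvgy_ext f g (a : R) : (forall r : R, 1 <= r -> f r = g r) ->
  f r @[r --> +oo] --> a -> g r @[r --> +oo] --> a.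
Proof.
move=> fg; apply: cvg_trans; apply: near_eq_cvg.
by apply: (near_pinfty_of_ge (M := 1)) => r r1; rewrite fg.
Qed.

Lemma cvgy_sqr0 f : f r ^+ 2 @[r --> +oo] --> (0 : R) -> f r @[r --> +oo] --> (0 : R).
Proof.
move=> /cvgrPdist_le h; apply/cvgrPdist_le => e e0.
have := h (e ^+ 2) (ltac:(by rewrite exprn_gt0)).
apply: filterS => r; rewrite !sub0r !normrN normrX => le.
by rewrite -(@ler_pXn2r _ 2)// ?nnegrE// ltW.
Qed.

Lemma cvgy_mul_bounded f g (B : R) : (forall r : R, 1 <= r -> `|g r| <= B) ->
  f r @[r --> +oo] --> (0 : R) -> f r * g r @[r --> +oo] --> (0 : R).
Proof.
move=> gB /cvgrPdist_le h; apply/cvgrPdist_le => e e0.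
have B1 : 0 < `|B| + 1 by rewrite ltr_wpDl.
have he := h (e / (`|B| + 1)) (ltac:(by rewrite divr_gt0)).
near=> r.
have r1 : 1 <= r by near: r; apply: nbhs_pinfty_ge; exact: num_real.
have hf : `|0 - f r| <= e / (`|B| + 1) by near: r; exact: he.
rewrite sub0r normrN in hf; rewrite sub0r normrN.
have hg : `|g r| <= `|B| + 1.
  by apply: le_trans (gB r r1) _; apply: le_trans (ler_norm _) _; rewrite lerDl.
apply: le_trans (normrM_le hf hg) _; rewrite divfK ?gt_eqF//.
Unshelve. all: by end_near. Qed.

(* Y = y^2 satisfies Y' <= - c0 rho (Y - (eta / c0)^2). *)
Lemma forced_decay y eta c rho P (c0 : R) : 0 < c0 ->
  (forall r : R, 1 <= r -> is_derive r 1 y (rho r * (- c r * y r + eta r))) ->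
  (forall r : R, 1 <= r -> is_derive r 1 P (rho r)) -> (forall r : R, 1 <= r -> 0 <= rho r) ->
  (\forall r \near +oo, c0 <= c r) -> P r @[r --> +oo] --> +oo ->
  eta r @[r --> +oo] --> (0 : R) -> y r @[r --> +oo] --> (0 : R).
Proof.
move=> c00 hy hP rho0 /near_pinfty_ge1[M1 M11 hc] /cvgryPge Pinf /cvgrPdist_le heta.
apply: cvgy_sqr0; apply/cvgrPdist_le => e e0.
have e2 : 0 < e / 2 by rewrite divr_gt0.
pose eps := Num.sqrt (e / 2) * c0.
have eps0 : 0 < eps by rewrite mulr_gt0// sqrtr_gt0.
have [M2 M21 he] := near_pinfty_ge1 (heta _ eps0).
pose M := Num.max M1 M2.
have M1M : M1 <= M by rewrite le_max lexx.
have M2M : M2 <= M by rewrite le_max lexx orbT.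
have M1' : 1 <= M by apply: le_trans M1M.
pose dY r := 2 * y r * (rho r * (- c r * y r + eta r)).
have dYle r : M <= r -> dY r <= - c0 * rho r * (y r ^+ 2 - e / 2).
  move=> Mr; have r1 := le_trans M1' Mr.
  have cr := hc r (le_trans M1M Mr); have er := he r (le_trans M2M Mr).
  have rr := rho0 r r1.
  have er2 : eta r ^+ 2 <= c0 ^+ 2 * (e / 2).
    have -> : c0 ^+ 2 * (e / 2) = eps ^+ 2 by rewrite /eps exprMn sqr_sqrtr ?(ltW e2)// mulrC.
    move: er; rewrite sub0r normrN -(real_normK (num_real (eta r))) => h.
    by rewrite ler_pXn2r// nnegrE ltW.
  have h1 : 0 <= (c0 * y r - eta r) ^+ 2 by exact: sqr_ge0.
  have h2 : 2 * y r * (- c r * y r + eta r) <= - c0 * (y r ^+ 2 - e / 2).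
    have h3 : c0 * y r ^+ 2 <= c r * y r ^+ 2 by rewrite ler_wpM2r// sqr_ge0.
    have h4 : c0 * (2 * y r * (- c r * y r + eta r)) <= c0 * (- c0 * (y r ^+ 2 - e / 2)).
      have h5 : c0 * (c0 * y r ^+ 2) <= c0 * (c r * y r ^+ 2) by rewrite ler_wpM2l// ltW.
      clear -h1 h5 er2; rewrite expr2 in h1; rewrite expr2 in er2.
      have -> : c0 * (2 * y r * (- c r * y r + eta r)) =
        - 2 * (c0 * (c r * y r ^+ 2)) + 2 * c0 * y r * eta r by ring.
      have -> : c0 * (- c0 * (y r ^+ 2 - e / 2)) = - (c0 * (c0 * y r ^+ 2)) + c0 * c0 * (e / 2) by ring.
      have E : (c0 * y r - eta r) * (c0 * y r - eta r) = c0 * (c0 * y r ^+ 2) - 2 * c0 * y r * eta r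
         + eta r * eta r by ring.
      rewrite E in h1; move: h1 h5 er2.
      set X1 := c0 * (c0 * y r ^+ 2); set X2 := c0 * (c r * y r ^+ 2).
      set X3 := 2 * c0 * y r * eta r; set X4 := eta r * eta r; set X5 := c0 * c0 * (e / 2).
      lra.
    by rewrite ler_pM2l in h4.
  have -> : dY r = rho r * (2 * y r * (- c r * y r + eta r)) by rewrite /dY; ring.
  have -> : - c0 * rho r * (y r ^+ 2 - e / 2) = rho r * (- c0 * (y r ^+ 2 - e / 2)) by ring.
  by rewrite ler_wpM2l.
pose T r := (y r ^+ 2 - e / 2) * expR (c0 * P r).
have T_noninc r : M <= r -> T r <= T M.
  move=> Mr; apply: (derive_le0_le (df := fun r => (dY r + c0 * rho r * (y r ^+ 2 - e / 2)) * expR (c0 * P r))) => //.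
    move=> z /andP[Mz _]; have z1 := le_trans M1' Mz.
    have h1 := hy z z1; have h2 := hP z z1.
    by rewrite /T; derive_eq; rewrite /dY /=; ring.
  move=> z /andP[Mz _]; rewrite mulr_le0_ge0 ?expR_ge0//.
  have h : dY z - - c0 * rho z * (y z ^+ 2 - e / 2) <= 0 by rewrite subr_le0; exact: dYle.
  have -> // : dY z + c0 * rho z * (y z ^+ 2 - e / 2) = dY z - - c0 * rho z * (y z ^+ 2 - e / 2).
  by ring.
have fin : \forall r \near +oo, P M + (y M ^+ 2 / (e / 2)) / c0 <= P r := Pinf _.
near=> r.
have Mr : M <= r by near: r; apply: nbhs_pinfty_ge; exact: num_real.
have Pr : P M + (y M ^+ 2 / (e / 2)) / c0 <= P r by near: r; exact: fin.
rewrite sub0r normrN ger0_norm ?sqr_ge0//.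
have := T_noninc r Mr; rewrite /T => h.
have E : expR (c0 * P r) = expR (c0 * P M) * expR (c0 * (P r - P M)).
  by rewrite -expRD; congr expR; ring.
have [//|big] := leP (y r ^+ 2) e.
exfalso; move: h; rewrite E mulrCA (mulrC (y M ^+ 2 - e / 2)) ler_pM2l ?expR_gt0// leNgt => /negP; apply.
have h1 : y M ^+ 2 / (e / 2) <= c0 * (P r - P M).
  by rewrite [leRHS]mulrC -ler_pdivrMr// lerBrDl.
have h2 : y M ^+ 2 / (e / 2) <= expR (c0 * (P r - P M)).
  by apply: le_trans h1 (le_trans _ (expR_ge1Dx _)); rewrite lerDr ler01.
have h3 : e / 2 * (y M ^+ 2 / (e / 2)) = y M ^+ 2 by field; rewrite gt_eqF.
have h4 : y M ^+ 2 - e / 2 < e / 2 * expR (c0 * (P r - P M)).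
  apply: (@lt_le_trans _ _ (y M ^+ 2)); first by rewrite ltrBlDr ltrDl.
  by rewrite -{1}h3 ler_wpM2l// ltW.
apply: lt_le_trans h4 _; rewrite ler_wpM2r ?expR_ge0//.
clear -big; lra.
Unshelve. all: by end_near. Qed.

Lemma cvgy_ln : @ln R r @[r --> +oo] --> +oo.
Proof.
apply/cvgryPge => A; apply: (near_pinfty_of_ge (M := expR A)) => r hr.
by rewrite -{1}(expRK A) ler_ln// ?posrE ?expR_gt0//; apply: lt_le_trans (expR_gt0 _) hr.
Qed.

(** y = u/r - a satisfies y' = (1/r)(- y + (du - a)), a case of [forced_decay] with rho = 1/r and P
    = ln. *)
Lemma cvgy_div_linear u du (a : R) : (forall r : R, 1 <= r -> is_derive r 1 u (du r)) ->
  du r @[r --> +oo] --> a -> u r / r @[r --> +oo] --> a.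
Proof.
move=> hu hdu.
have h0 : u r / r - a @[r --> +oo] --> (0 : R).
  apply: (@forced_decay _ (fun r => du r - a) (fun _ => 1) (fun r : R => r^-1) (@ln R) 1 ltr01).
  - move=> r r1; have r0 : 0 < r by apply: lt_le_trans r1.
    have rn : r != 0 by rewrite gt_eqF.
    by have h := hu r r1; derive_eq => //; field.
  - by move=> r r1; apply: is_derive1_ln; apply: lt_le_trans r1.
  - by move=> r r1; rewrite invr_ge0; apply: le_trans r1.
  - by apply: (near_pinfty_of_ge (M := 1)).
  - exact: cvgy_ln.
  - by rewrite -[X in _ --> X](subrr a); apply: cvgB => //; exact: cvg_cst.
have : (u r / r - a) + a @[r --> +oo] --> 0 + a by apply: cvgD => //; exact: cvg_cst.
by rewrite add0r; apply: cvgy_ext => r _; rewrite subrK.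
Qed.

(* F dominates 2 \int D H, while D^2 + C F is nonincreasing. *)
Lemma lyapunov_decay (D dD H P F : R -> R) (C : R) : 0 <= C ->
  (forall r : R, 1 <= r -> is_derive r 1 D (dD r)) ->
  (forall r : R, 1 <= r -> is_derive r 1 P (H r)) ->
  (forall r : R, 1 <= r -> is_derive r 1 F (- 2 * D r * H r)) ->
  (forall r : R, 1 <= r -> [/\ 0 <= D r, 0 <= H r, 0 <= F r & `|dD r| <= C * H r]) ->
  P r @[r --> +oo] --> +oo -> D r @[r --> +oo] --> (0 : R).
Proof.
move=> C0 hD hP hF sgn /cvgryPge Pinf.
apply: cvgy_sqr0; apply/cvgrPdist_le => e e0.
pose E := [set F r | r in [set r : R | 1 <= r]].
have lbE : has_lbound E by exists 0 => _ [r r1 <-]; have [] := sgn r r1.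
have infE : has_inf E by split => //; exists (F 1); exists 1 => //=.
(* Past M the function F varies by at most this amount, so C F varies by at most e / 2. *)
have d0 : 0 < e / (2 * (C + 1)) by rewrite divr_gt0// mulr_gt0// ltr_wpDl.
have [_ [M /= M1 <-] FM] := inf_adherent d0 infE.
have F_le r r' : 1 <= r -> r <= r' -> F r' <= F r.
  move=> r1 rr; apply: (derive_le0_le rr (df := fun r => - 2 * D r * H r)) => z /andP[rz _].
    by apply: hF; apply: le_trans rz.
  have [h1 h2 _ _] := sgn z (le_trans r1 rz).
  have -> : - 2 * D z * H z = - (2 * (D z * H z)) by ring.
  by rewrite oppr_le0 !mulr_ge0.
have F_osc r r' : M <= r -> r <= r' -> F r - F r' <= e / (2 * (C + 1)).
  move=> Mr rr; have h1 := F_le M r M1 Mr.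
  have h2 : inf E <= F r'.
    by apply: ge_inf => //; exists r' => //=; apply: le_trans M1 (le_trans Mr rr).
  clear -h1 h2 FM; lra.
pose eps := Num.sqrt (e / 2).
have eps0 : 0 < eps by rewrite sqrtr_gt0 divr_gt0.
(* Otherwise D > eps beyond M, so F + 2 eps P is nonincreasing there, and the divergence of P would
   make F negative. From r0 on, the monotone D^2 + C F keeps D^2 below e. *)
have [r0 Mr0 small] : exists2 r0, M <= r0 & D r0 <= eps.
  apply: contrapT => hN.
  have big r : M <= r -> eps < D r.
    by move=> Mr; rewrite ltNge; apply/negP => h; apply: hN; exists r.
  have dec r : M <= r -> F r + 2 * eps * P r <= F M + 2 * eps * P M.
    move=> Mr; apply: (derive_le0_le (f := fun r => F r + 2 * eps * P r) Mr (df := fun r => 2 * H r * (eps - D r))) => z /andP[Mz _].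
      have z1 := le_trans M1 Mz; have h1 := hF z z1; have h2 := hP z z1.
      by derive_eq; ring.
    have [_ h2 _ _] := sgn z (le_trans M1 Mz).
    by rewrite mulr_ge0_le0 ?mulr_ge0// subr_le0 ltW// big.
  have [M2 M21 hP2] := near_pinfty_ge1 (Pinf (P M + F M / (2 * eps) + 1)).
  pose r := Num.max M M2.
  have Mr : M <= r by rewrite le_max lexx.
  have Pr := hP2 r (ltac:(by rewrite le_max lexx orbT)).
  have := dec r Mr; have [_ _ Fr _] := sgn r (le_trans M1 Mr).
  have : 2 * eps * (P M + F M / (2 * eps) + 1) <= 2 * eps * P r by rewrite ler_wpM2l// mulr_ge0// ltW.
  have -> : 2 * eps * (P M + F M / (2 * eps) + 1) = 2 * eps * P M + F M + 2 * eps by field; rewrite gt_eqF.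
  clear -Fr eps0; move: (2 * eps * P r) (2 * eps * P M) => x y; lra.
apply: (near_pinfty_of_ge (M := r0)) => r rr0.
rewrite sub0r normrN ger0_norm ?sqr_ge0//.
have dec : D r ^+ 2 + C * F r <= D r0 ^+ 2 + C * F r0.
  apply: (derive_le0_le (f := fun r => D r ^+ 2 + C * F r) rr0 (df := fun r => 2 * D r * (dD r - C * H r))) => z /andP[zr _].
    have z1 := le_trans M1 (le_trans Mr0 zr); have h1 := hF z z1; have h2 := hD z z1.
    by derive_eq; rewrite /=; ring.
  have [h1 _ _ h2] := sgn z (le_trans M1 (le_trans Mr0 zr)).
  by rewrite mulr_ge0_le0 ?mulr_ge0// subr_le0 (le_trans (ler_norm _)).
have [Dr0 _ _ _] := sgn r0 (le_trans M1 Mr0).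
have h1 : D r0 ^+ 2 <= e / 2.
  by rewrite -(sqr_sqrtr (ltW (divr_gt0 e0 (ltr0n R 2)))) ler_pXn2r// nnegrE// ltW.
have h2 : C * (F r0 - F r) <= C * (e / (2 * (C + 1))) by rewrite ler_wpM2l// F_osc.
have h3 : C * (e / (2 * (C + 1))) <= e / 2.
  have C1 : 0 < C + 1 by rewrite ltr_wpDl.
  have -> : C * (e / (2 * (C + 1))) = e / 2 * (C / (C + 1)) by field; rewrite gt_eqF.
  by rewrite ler_piMr ?divr_ge0 ?(ltW e0)// ler_pdivrMr// mul1r lerDl ler01.
clear -dec h1 h2 h3; rewrite mulrBr in h2.
move: (C * F r) (C * F r0) (C * (e / (2 * (C + 1)))) dec h1 h2 h3 => x y z; lra.
Qed.

End Eventually.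

(** * Asymptotics in the variables L, V and K *)

Section PolarFlow.
Context {R : realType}.
Variables (nu kappa : R).

(* L = psi'/psi, V = - phi', K = psi^(-2). *)
Definition polar_flow (L V K e : R -> R) : Prop := forall r : R, 0 < r ->
  [/\ [/\ 0 < L r, 0 < V r, 0 < K r & 0 < e r],
      [/\ is_derive r 1 L ((nu - 2) * K r - (nu - 1) * L r ^+ 2 - V r * L r),
          is_derive r 1 V (e r - V r ^+ 2 - (nu - 1) * V r * L r),
          is_derive r 1 K (- 2 * L r * K r)
        & is_derive r 1 e (- 2 * kappa * V r * e r)]
    & (1 - kappa) * V r ^+ 2 + 2 * (nu - 1) * V r * L r
      + (nu - 1) * (nu - 2) * (L r ^+ 2 - K r) = e r].

Lemma admissible_polar_flow l w k f :
  (forall T : R, admissible_flow nu kappa l w k f T) ->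
  polar_flow (fun r => (1 + r ^+ 2 * l r) / r) (fun r => - (r * w r))
    (fun r => (1 + r ^+ 2 * k r) / r ^+ 2) (fun r => potential_weight kappa (f r)).
Proof.
move=> adm r r0; have rn : r != 0 by rewrite gt_eqF.
have rr : 0 < r < r + 1 by rewrite r0 ltrDl ltr01.
have [s1 s2 s3] := a_priori_signs (adm (r + 1)) rr.
have H0 := hamiltonian_eq0 (adm (r + 1)) rr.
have [_ /andP[k0 k1] flow _ _] := adm (r + 1).
have [dl [dw [dk [[hl hw hk hf] El Ew Ek]]]] := flow r rr.
split.
- split; [exact: divr_gt0|by rewrite oppr_gt0 pmulr_rlt0|by rewrite divr_gt0// exprn_gt0|].
  by rewrite /potential_weight divr_gt0 ?expR_gt0// subr_gt0.
- have dlE : dl = ((nu - 2) * k r - (2 * nu - 1) * l r + w r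
        + r ^+ 2 * (w r * l r - (nu - 1) * l r ^+ 2)) / r by rewrite -El; field.
  have dwE : dw = (- nu * w r - potential_weight kappa (f r)
        + r ^+ 2 * (w r ^+ 2 - (nu - 1) * l r * w r)) / r by rewrite -Ew; field.
  have dkE : dk = (- 2 * k r - 2 * l r - 2 * r ^+ 2 * k r * l r) / r by rewrite -Ek; field.
  split.
  + by derive_eq => //; rewrite dlE /=; field.
  + by derive_eq; rewrite dwE; field.
  + by derive_eq; [rewrite expf_neq0|rewrite dkE /=; field].
  + by apply: (is_derive_eqf (is_derive_potential_weight kappa hf)); ring.
- move: H0; rewrite /hamiltonian => H0.
  by apply/eqP; rewrite -subr_eq0 -H0; apply/eqP; field.
Qed.

End PolarFlow.

(* y = V'/K satisfies y' >= - (V + (nu - 3) L) y and tends to 0 at the origin. *)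
Lemma steady_V_derivative_ge0 (R : realType) (nu : R) (L V K e : R -> R) :
  3 <= nu -> polar_flow nu 0 L V K e -> (forall r, 0 < r -> e r = 1) ->
  (forall eps t : R, 0 < eps -> 0 < t -> exists2 a : R, 0 < a < t &
     `|(1 - V a ^+ 2 - (nu - 1) * V a * L a) / K a| < eps) ->
  forall r, 0 < r -> 0 <= 1 - V r ^+ 2 - (nu - 1) * V r * L r.
Proof.
move=> n3 flow e1 small r r0.
pose Z t := 1 - V t ^+ 2 - (nu - 1) * V t * L t; rewrite -/(Z r).
pose c t := V t + (nu - 3) * L t.
have hZ (t : R) : 0 < t -> is_derive t 1 (fun t => Z t / K t)
    (- c t * (Z t / K t) + (nu - 1) * V t * L t ^+ 2 / K t).
  move=> t0; have [[L0 V0 K0 _] [dL dV dK _] C] := flow t t0.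
  have Kn : K t != 0 by rewrite gt_eqF.
  have C' : (nu - 1) * (nu - 2) * K t = V t ^+ 2 + 2 * (nu - 1) * V t * L t
      + (nu - 1) * (nu - 2) * L t ^+ 2 - e t by rewrite -C; ring.
  rewrite /Z; derive_eq => //; rewrite (e1 t t0) /c /Z /=.
  transitivity ((- (2 * V t * (1 - V t ^+ 2 - (nu - 1) * V t * L t)) 
     - (nu - 1) * (1 - V t ^+ 2 - (nu - 1) * V t * L t) * L t
     - V t * ((nu - 1) * (nu - 2) * K t) + (nu - 1) * V t * ((nu - 1) * L t ^+ 2 + V t * L t)
     + 2 * L t * (1 - V t ^+ 2 - (nu - 1) * V t * L t)) / K t); first by field.
  by rewrite C' (e1 t t0); field.
suff : 0 <= Z r / K r.
  by have [[_ _ K0 _] _ _] := flow r r0; rewrite pmulr_lge0// invr_gt0.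
rewrite leNgt; apply/negP => neg.
have [a /andP[a0 ar] ha] := small (- (Z r / K r)) r (ltac:(by rewrite oppr_gt0)) r0.
pose eps := - (Z r / K r); have eps0 : 0 < eps by rewrite oppr_gt0.
have [B hB] : exists B : R, forall t, a <= t <= r -> `|c t| <= B.
  apply: bounded_on_segment; first exact: ltW.
  move=> t /andP[at_ _]; have [_ [dL dV _ _] _] := flow t (lt_le_trans a0 at_).
  have [] : is_derive t 1 c (e t - V t ^+ 2 - (nu - 1) * V t * L t
     + (nu - 3) * ((nu - 2) * K t - (nu - 1) * L t ^+ 2 - V t * L t)).
    by rewrite /c; derive_eq; ring.
  by [].
have : 0 < Z r / K r + eps; last by rewrite /eps subrr ltxx.
apply: (@derive_ge_linear_gt0 _ (fun t => Z t / K t + eps)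
   (fun t => - c t * (Z t / K t) + (nu - 1) * V t * L t ^+ 2 / K t) B a r (ltW ar)).
- move=> t /andP[at_ _]; have h := hZ t (lt_le_trans a0 at_).
  by derive_eq; ring.
- move=> t /andP[at_ tr] pt; have t0 := lt_le_trans a0 at_.
  have [[L0 V0 K0 _] _ _] := flow t t0.
  have cB : c t <= B by apply: le_trans (ler_norm _) (hB t _); rewrite at_ tr.
  have c0 : 0 <= c t by rewrite /c addr_ge0 ?mulr_ge0 ?(ltW V0) ?(ltW L0)//; clear -n3; lra.
  have h1 : 0 <= (nu - 1) * V t * L t ^+ 2 / K t.
    rewrite divr_ge0 ?(ltW K0)// mulr_ge0 ?sqr_ge0// mulr_ge0 ?(ltW V0)//; clear -n3; lra.
  have h2 : c t * (Z t / K t + eps) <= B * (Z t / K t + eps) by rewrite ler_wpM2r// ltW.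
  have h3 : 0 <= c t * eps by rewrite mulr_ge0// ltW.
  rewrite mulrDr in h2; move: h1 h2 h3; rewrite mulNr mulNr.
  move: (c t * (Z t / K t)) (c t * eps) (B * (Z t / K t + eps)) ((nu - 1) * V t * L t ^+ 2 / K t).
  by clear => x y z u; lra.
- by move: ha; rewrite -/(Z a) -/eps ltr_norml => /andP[h _]; rewrite -(opprK eps) subr_gt0.
Qed.

(** By the constraint, (1/L)' - 1 is V'/((nu - 1) L^2) >= 0, so 1/L >= r - 1 and L tends to 0. Then
    V - 1 and L/K - (nu - 2) satisfy linear equations with damping bounded below and forcing that
    tends to 0, as [forced_decay] requires. *)
Lemma steady_asymptotics (R : realType) (nu : R) (L V K e : R -> R) :
  3 <= nu -> polar_flow nu 0 L V K e -> (forall r, 0 < r -> e r = 1) ->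
  (forall r, 0 < r -> 0 <= 1 - V r ^+ 2 - (nu - 1) * V r * L r) ->
  (K r)^-1 / r @[r --> +oo] --> 2 * (nu - 2).
Proof.
move=> n3 flow e1 Z0.
have pos (r : R) : 1 <= r -> 0 < r by apply: lt_le_trans.
have V_ge (r : R) : 1 <= r -> V 1 <= V r.
  move=> r1; apply: (derive_ge0_le r1 (df := fun r => e r - V r ^+ 2 - (nu - 1) * V r * L r)) => z /andP[z1 _].
    by have [_ [] ] := flow z (pos z z1).
  by rewrite e1 ?pos// Z0 ?pos.
have V1 : 0 < V 1 by have [[_ ? _ _] _ _] := flow 1 ltr01.
have V_le1 (r : R) : 1 <= r -> V r <= 1.
  move=> r1; have [[L0 V0 _ _] _ _] := flow r (pos r r1).
  have h := Z0 r (pos r r1).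
  have h2 : 0 <= (nu - 1) * V r * L r by rewrite !mulr_ge0 ?(ltW V0) ?(ltW L0)//; clear -n3; lra.
  have : V r ^+ 2 <= 1 ^+ 2 by clear -h h2; rewrite expr1n; lra.
  by rewrite ler_pXn2r// nnegrE ltW.
have L_inv (r : R) : 1 <= r -> r - 1 <= (L r)^-1.
  move=> r1; have [[L1 _ _ _] _ _] := flow 1 ltr01.
  suff : (L 1)^-1 - 1 <= (L r)^-1 - r.
    have : 0 < (L 1)^-1 by rewrite invr_gt0.
    by move: (L 1)^-1 (L r)^-1; clear => x y; lra.
  apply: (derive_ge0_le (f := fun r => (L r)^-1 - r) r1 (df := fun r => - ((nu - 2) * K r - (nu - 1) * L r ^+ 2 - V r * L r) / L r ^+ 2 - 1)) => z /andP[z1 _].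
    have [[L0 _ _ _] [dL _ _ _] _] := flow z (pos z z1).
    by derive_eq => //; rewrite gt_eqF.
  have [[L0 V0 K0 _] _ C] := flow z (pos z z1); have hZ := Z0 z (pos z z1).
  have n1 : 0 < nu - 1 by clear -n3; lra.
  have Ln : L z != 0 by rewrite gt_eqF.
  have -> : - ((nu - 2) * K z - (nu - 1) * L z ^+ 2 - V z * L z) / L z ^+ 2 - 1 =
     (1 - V z ^+ 2 - (nu - 1) * V z * L z) / ((nu - 1) * L z ^+ 2).
    have -> : (nu - 2) * K z = (V z ^+ 2 + 2 * (nu - 1) * V z * L z
      + (nu - 1) * (nu - 2) * L z ^+ 2 - e z) / (nu - 1).
      by rewrite -C; field; rewrite gt_eqF.
    by rewrite (e1 z (pos z z1)); field; rewrite Ln gt_eqF.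
  by rewrite divr_ge0// mulr_ge0 ?sqr_ge0// ltW.
have L0 : L r @[r --> +oo] --> (0 : R).
  apply/cvgrPdist_le => eps eps0; apply: (near_pinfty_of_ge (M := 1 + eps^-1)) => r hr.
  have ei : 0 < eps^-1 by rewrite invr_gt0.
  have r1 : 1 <= r by apply: le_trans hr; rewrite lerDl ltW.
  have [[Lr _ _ _] _ _] := flow r (pos r r1).
  rewrite sub0r normrN gtr0_norm// -(invrK (L r)) -(invrK eps) lef_pV2 ?posrE ?invr_gt0//.
  by apply: le_trans (L_inv r r1); rewrite lerBrDl.
have LV0 (a : R) : a * (L r * V r) @[r --> +oo] --> (0 : R).
  rewrite -[X in _ --> X](mulr0 a); apply: cvgM; first exact: cvg_cst.
  apply: (cvgy_mul_bounded (B := 1)) => // r r1.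
  have [[_ V0 _ _] _ _] := flow r (pos r r1).
  by rewrite gtr0_norm// V_le1.
have idP (r : R) : 1 <= r -> is_derive r 1 (fun t : R => t) 1.
  by move=> _; exact: is_derive_idf.
have ge01 (r : R) : 1 <= r -> 0 <= (1 : R) by rewrite ler01.
have V_lim : V r - 1 @[r --> +oo] --> (0 : R).
  apply: (forced_decay ltr01 (c := fun r => 1 + V r) (rho := fun _ => 1)
     (eta := fun r => - (nu - 1) * (L r * V r)) (P := fun r => r)) => //.
  - move=> r r1; have [_ [_ dV _ _] _] := flow r (pos r r1).
    by derive_eq; rewrite e1 ?pos//; ring.
  - apply: (near_pinfty_of_ge (M := 1)) => r r1; rewrite lerDl ltW//.
    exact: lt_le_trans V1 (V_ge r r1).
have q_lim : L r / K r - (nu - 2) @[r --> +oo] --> (0 : R).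
  apply: (forced_decay V1 (c := fun r => V r + (nu - 3) * L r) (rho := fun _ => 1)
     (eta := fun r => - (nu - 2) * ((V r - 1) + (nu - 3) * L r)) (P := fun r => r)) => //.
  - move=> r r1; have [[_ _ K0 _] [dL dV dK _] _] := flow r (pos r r1).
    by derive_eq; rewrite ?gt_eqF//; field; rewrite gt_eqF.
  - apply: (near_pinfty_of_ge (M := 1)) => r r1.
    have [[Lr _ _ _] _ _] := flow r (pos r r1).
    apply: le_trans (V_ge r r1) _; rewrite lerDl mulr_ge0 ?(ltW Lr)//; clear -n3; lra.
  - rewrite -[X in _ --> X](mulr0 (- (nu - 2))); apply: cvgM; first exact: cvg_cst.
    rewrite -[X in _ --> X](addr0 0); apply: cvgD => //.
    by rewrite -[X in _ --> X](mulr0 (nu - 3)); apply: cvgM => //; exact: cvg_cst.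
apply: (cvgy_div_linear (du := fun r => 2 * (L r / K r))).
- move=> r r1; have [[_ _ K0 _] [dL dV dK _] _] := flow r (pos r r1).
  by derive_eq; rewrite ?gt_eqF//; field; rewrite gt_eqF.
- apply: cvgM; first exact: cvg_cst.
  have : (L r / K r - (nu - 2)) + (nu - 2) @[r --> +oo] --> 0 + (nu - 2).
    by apply: cvgD => //; exact: cvg_cst.
  by rewrite add0r; apply: cvgy_ext => r _; rewrite subrK.
Qed.

(** * Finite m: the Lyapunov function and the limits of L/H and K/H^2 *)

Section FiniteDimensionParameter.
Context {R : realType}.
Variables (nu kappa : R) (L V K e : R -> R).
Hypotheses (nu_ge3 : 3 <= nu) (kappa_gt0 : 0 < kappa) (kappa_lt1 : kappa < 1)
  (flow : polar_flow nu kappa L V K e).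

(** N + 1 = n + m is, for integral m, the dimension of the Einstein warped product behind the
    quasi-Einstein equation. [C0] is the leading coefficient (nu - 1)(1 + kappa (nu - 1)) of the
    quadratic polynomial in X in [LamE]. *)
Let N := nu - 1 + kappa^-1.
Let C0 := (nu - 1) * kappa * N.
Let H r := (nu - 1) * L r + V r.
Let X r := L r / H r.
Let A r := (nu - 2) * K r / H r ^+ 2.
(* Lam H^2 = (nu - 1) L^2 + kappa V^2, and D H^2 is what this exceeds its minimum
   by for given H, the minimum being attained at L / H = 1 / N. *)
Let D r := C0 * (X r - N^-1) ^+ 2.
Let Lam r := N^-1 + D r.
(** [b] is X'/H. Up to an additive constant [P] is the logarithm of the volume density v = psi^(nu -
    1) exp(- phi), because ln K = - 2 ln psi and ln e = 2 kappa phi + const; so P' = H, and [F] is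
    the logarithm of a multiple of v^(2/N) H^2. *)
Let b r := A r - X r * (1 - Lam r).
Let P r := - ((nu - 1) / 2) * ln (K r) - (2 * kappa)^-1 * ln (e r).
Let F r := 2 / N * P r + 2 * ln (H r).

Let nu1_gt0 : 0 < nu - 1. Proof. by have h := nu_ge3; lra. Qed.
Let nu2_ge1 : 1 <= nu - 2. Proof. by have h := nu_ge3; lra. Qed.

Let N_gt3 : 3 < N.
Proof.
have h := nu_ge3; have : 1 < kappa^-1 by rewrite invf_gt1.
rewrite /N; lra.
Qed.

Let N_gt0 : 0 < N. Proof. exact: lt_trans N_gt3. Qed.
Let N_neq0 : N != 0. Proof. by rewrite gt_eqF. Qed.
Let kappa_neq0 : kappa != 0. Proof. by rewrite gt_eqF. Qed.
Let C0_gt0 : 0 < C0. Proof. by rewrite /C0 !mulr_gt0. Qed.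

Let Ninv_le : N^-1 <= 3^-1.
Proof. by rewrite lef_pV2 ?posrE// ltW// N_gt3. Qed.

Let LamE r : Lam r = (nu - 1) * X r ^+ 2 + kappa * (1 - (nu - 1) * X r) ^+ 2.
Proof.
have kN : kappa * N = kappa * (nu - 1) + 1 by rewrite /N; field.
have nN : (nu - 1) = N - kappa^-1 by rewrite /N; ring.
rewrite /Lam /D /C0 nN; field.
by rewrite N_neq0 kappa_neq0.
Qed.

Let H_gt0 (r : R) : 0 < r -> 0 < H r.
Proof. by move=> r0; have [[? ? _ _] _ _] := flow r0; rewrite /H addr_gt0 ?mulr_gt0. Qed.

Let H_neq0 (r : R) : 0 < r -> H r != 0.
Proof. by move=> /H_gt0 h; rewrite gt_eqF. Qed.

Let LE (r : R) : 0 < r -> L r = X r * H r.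
Proof. by move=> r0; rewrite /X divfK ?H_neq0. Qed.

Let VE (r : R) : 0 < r -> V r = (1 - (nu - 1) * X r) * H r.
Proof. by move=> r0; rewrite mulrBl mul1r -mulrA -LE// /H; ring. Qed.

Let energy (r : R) : 0 < r -> (1 - Lam r) * H r ^+ 2 = (nu - 1) * (nu - 2) * K r + e r.
Proof.
move=> r0; have [_ _ <-] := flow r0.
by rewrite LamE (VE r0) (LE r0); ring.
Qed.

Let is_derive_H (r : R) : 0 < r -> is_derive r 1 H (- Lam r * H r ^+ 2).
Proof.
move=> r0; have [_ [dL dV _ _] C] := flow r0.
have -> : - Lam r * H r ^+ 2 = (1 - Lam r) * H r ^+ 2 - H r ^+ 2 by ring.
by rewrite energy// /H; derive_eq; ring.
Qed.

Let is_derive_X (r : R) : 0 < r -> is_derive r 1 X (H r * b r).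
Proof.
move=> r0; have [_ [dL _ _ _] _] := flow r0; have dH := is_derive_H r0.
have Hn := H_neq0 r0.
rewrite /X; derive_eq => //; rewrite /b /A (VE r0) (LE r0).
set x := X r; set la := Lam r; set h := H r.
by rewrite /=; field.
Qed.

Let is_derive_D (r : R) : 0 < r -> is_derive r 1 D (2 * C0 * (X r - N^-1) * (H r * b r)).
Proof.
move=> r0; have dX := is_derive_X r0.
by rewrite /D; derive_eq; rewrite /=; ring.
Qed.

Let D_ge0 r : 0 <= D r.
Proof. by rewrite /D mulr_ge0 ?sqr_ge0 ?(ltW C0_gt0). Qed.

Let Lam_lt1 (r : R) : 0 < r -> Lam r < 1.
Proof.
move=> r0; have [[_ _ K0 e0] _ _] := flow r0; have h := H_gt0 r0.
have n2 : 0 < nu - 2 by apply: lt_le_trans nu2_ge1.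
have : 0 < (1 - Lam r) * H r ^+ 2 by rewrite energy// addr_gt0 ?mulr_gt0.
by rewrite pmulr_lgt0 ?exprn_gt0// subr_gt0.
Qed.

Let Lam_ge r : N^-1 <= Lam r.
Proof. by rewrite /Lam lerDl D_ge0. Qed.

Let X_bounds (r : R) : 0 < r -> 0 <= X r <= 1.
Proof.
move=> r0; have [[L0 V0 _ _] _ _] := flow r0; have h := H_gt0 r0.
rewrite /X divr_ge0 ?(ltW L0) ?(ltW h)//= ler_pdivrMr// mul1r /H.
have : 0 <= (nu - 2) * L r by rewrite mulr_ge0 ?(ltW L0)// (le_trans ler01 nu2_ge1).
by rewrite !mulrBl; move: V0; move: (nu * L r) => x; lra.
Qed.

Let A_bounds (r : R) : 0 < r -> 0 <= A r <= 1.
Proof.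
move=> r0; have [[L0 V0 K0 e0] _ _] := flow r0; have h := H_gt0 r0.
have n2 : 0 <= nu - 2 by apply: le_trans nu2_ge1.
rewrite /A; apply/andP; split; first by rewrite divr_ge0 ?sqr_ge0// mulr_ge0// ltW.
rewrite ler_pdivrMr ?exprn_gt0// mul1r.
have E := energy r0.
have h1 : (1 - Lam r) * H r ^+ 2 <= H r ^+ 2.
  rewrite ler_piMl ?sqr_ge0// gerBl; apply: le_trans (Lam_ge r); by rewrite invr_ge0 ltW.
apply: le_trans h1; rewrite E.
have h2 : (nu - 2) * K r <= (nu - 1) * (nu - 2) * K r.
  rewrite -mulrA ler_peMl ?mulr_ge0 ?(ltW K0)//.
  by have := nu2_ge1; lra.
by apply: le_trans h2 _; rewrite lerDl ltW.
Qed.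

Let b_bound (r : R) : 0 < r -> `|b r| <= 1.
Proof.
move=> r0; have /andP[a0 a1] := A_bounds r0; have /andP[x0 x1] := X_bounds r0.
have l1 := Lam_lt1 r0; have l0 : 0 < Lam r by apply: lt_le_trans (Lam_ge r); rewrite invr_gt0.
have h0 : 0 <= X r * (1 - Lam r) by rewrite mulr_ge0// subr_ge0 ltW.
have h1 : X r * (1 - Lam r) <= 1.
  by rewrite mulr_ile1// ?subr_ge0 ?(ltW l1)// gerBl ltW.
by rewrite /b ler_norml; apply/andP; split; lra.
Qed.

Let XN_bound (r : R) : 0 < r -> `|X r - N^-1| <= 1.
Proof.
move=> r0; have /andP[x0 x1] := X_bounds r0; have := Ninv_le.
have : 0 < N^-1 by rewrite invr_gt0.
by move=> h1 h2; rewrite ler_norml; apply/andP; split; lra.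
Qed.

Let is_derive_P (r : R) : 0 < r -> is_derive r 1 P (H r).
Proof.
move=> r0; have [[L0 V0 K0 e0] [_ _ dK de] _] := flow r0.
have h1 := is_derive_comp1 (is_derive1_ln K0) dK.
have h2 := is_derive_comp1 (is_derive1_ln e0) de.
rewrite /P; derive_eq; rewrite /H; field.
by rewrite kappa_neq0 !gt_eqF.
Qed.

Let is_derive_F (r : R) : 0 < r -> is_derive r 1 F (- 2 * D r * H r).
Proof.
move=> r0; have h1 := is_derive_P r0.
have h2 := is_derive_comp1 (is_derive1_ln (H_gt0 r0)) (is_derive_H r0).
rewrite /F; derive_eq; rewrite /Lam; field.
by rewrite N_neq0 H_neq0.
Qed.

(** The constraint bounds both K and e by H^2. The exponential of 2 P / N is the product of K to the
    power - (nu - 1)/N and e to the power - 1/(kappa N), and these exponents sum to - 1. *)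
Let F_ge0 (r : R) : 0 < r -> 0 <= F r.
Proof.
move=> r0; have [[L0 V0 K0 e0] _ _] := flow r0; have h := H_gt0 r0.
have n2 : 0 <= nu - 2 by apply: le_trans nu2_ge1.
have H2 : (nu - 1) * (nu - 2) * K r + e r <= H r ^+ 2.
  rewrite -energy// ler_piMl ?sqr_ge0// gerBl; apply: le_trans (Lam_ge r); by rewrite invr_ge0 ltW.
have HK : K r <= H r ^+ 2.
  apply: le_trans H2; rewrite -[leLHS]addr0 lerD ?(ltW e0)//.
  rewrite ler_peMl ?(ltW K0)//; have := nu2_ge1 => k1.
  have : 1 * (nu - 2) <= (nu - 1) * (nu - 2) by rewrite ler_wpM2r//; lra.
  by rewrite mul1r; apply: le_trans.
have He : e r <= H r ^+ 2.
  by apply: le_trans H2; rewrite lerDr !mulr_ge0 ?(ltW K0) ?(ltW nu1_gt0).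
have lnH2 : ln (H r ^+ 2) = 2 * ln (H r) by rewrite lnXn// mulr_natl.
have q1 : 0 <= (nu - 1) / N by rewrite divr_ge0 ?ltW.
have q2 : 0 <= (kappa * N)^-1 by rewrite invr_ge0 mulr_ge0 ?ltW.
have q : (nu - 1) / N + (kappa * N)^-1 = 1.
  have -> : (nu - 1) = N - kappa^-1 by rewrite /N; ring.
  by field; rewrite N_neq0.
have i1 : (nu - 1) / N * ln (K r) <= (nu - 1) / N * (2 * ln (H r)).
  by rewrite ler_wpM2l// -lnH2 ler_ln// posrE exprn_gt0.
have i2 : (kappa * N)^-1 * ln (e r) <= (kappa * N)^-1 * (2 * ln (H r)).
  by rewrite ler_wpM2l// -lnH2 ler_ln// posrE exprn_gt0.
have -> : F r = ((nu - 1) / N + (kappa * N)^-1) * (2 * ln (H r))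
    - (nu - 1) / N * ln (K r) - (kappa * N)^-1 * ln (e r).
  by rewrite q /F /P; field; rewrite N_neq0 kappa_neq0.
rewrite mulrDl; move: i1 i2.
move: ((nu - 1) / N * (2 * ln (H r))) ((kappa * N)^-1 * (2 * ln (H r))) => x y.
move: ((nu - 1) / N * ln (K r)) ((kappa * N)^-1 * ln (e r)) => z t; lra.
Qed.

Let is_derive_Hinv (r : R) : 0 < r -> is_derive r 1 (fun t => (H t)^-1) (Lam r).
Proof.
move=> r0; have dH := is_derive_H r0; have Hn := H_neq0 r0.
by derive_eq => //; field.
Qed.

Let pos (r : R) : 1 <= r -> 0 < r. Proof. exact: lt_le_trans. Qed.

Let Hinv_ge (r : R) : 1 <= r -> (r - 1) / N <= (H r)^-1.
Proof.
move=> r1; suff : (H 1)^-1 - 1 / N <= (H r)^-1 - r / N.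
  have : 0 < (H 1)^-1 by rewrite invr_gt0 H_gt0.
  by rewrite mulrBl; move: (H 1)^-1 (H r)^-1 (1 / N) (r / N) => x y z t; lra.
apply: (derive_ge0_le (f := fun r => (H r)^-1 - r / N) r1 (df := fun r => Lam r - N^-1)) => z /andP[z1 _].
  by have h := is_derive_Hinv (pos z1); derive_eq; ring.
by rewrite subr_ge0 Lam_ge.
Qed.

(** [Hinv_ge] makes - ln H tend to +oo, and F >= 0 says P >= - N ln H. *)
Let P_infty : P r @[r --> +oo] --> +oo.
Proof.
apply/cvgryPge => a; apply: (near_pinfty_of_ge (M := 1 + N * expR (a / N))) => r hr.
have r1 : 1 <= r by apply: le_trans hr; rewrite lerDl mulr_ge0 ?expR_ge0 ?ltW.
have h1 : expR (a / N) <= (H r)^-1.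
  by apply: le_trans (Hinv_ge r1); rewrite ler_pdivlMr// lerBrDl mulrC.
have h2 : a / N <= - ln (H r).
  by rewrite -lnV ?posrE ?H_gt0 ?pos// -(expRK (a / N)) ler_ln ?posrE ?expR_gt0 ?invr_gt0 ?H_gt0 ?pos.
have h3 := F_ge0 (pos r1).
have h4 : a <= N * - ln (H r) by rewrite mulrC -ler_pdivrMr.
apply: le_trans h4 _; rewrite -subr_ge0.
have -> : P r - N * - ln (H r) = N / 2 * F r by rewrite /F; field.
by rewrite mulr_ge0// divr_ge0 ?ltW.
Qed.

Let D_lim : D r @[r --> +oo] --> (0 : R).
Proof.
apply: (@lyapunov_decay _ D (fun r => 2 * C0 * (X r - N^-1) * (H r * b r)) H P F (2 * C0)).
- by apply: mulr_ge0 => //; exact: ltW.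
- by move=> r /pos; exact: is_derive_D.
- by move=> r /pos; exact: is_derive_P.
- by move=> r /pos; exact: is_derive_F.
- move=> r /pos r0; split; [exact: D_ge0|exact/ltW/H_gt0|exact: F_ge0|].
  have -> : 2 * C0 * (X r - N^-1) * (H r * b r) = 2 * C0 * H r * ((X r - N^-1) * b r) by ring.
  have CH : 0 <= 2 * C0 * H r.
    by apply: mulr_ge0; [apply: mulr_ge0 => //; exact: ltW|exact/ltW/H_gt0].
  rewrite normrM (ger0_norm CH) ler_piMr//.
  by rewrite -(mulr1 1); apply: normrM_le; [exact: XN_bound|exact: b_bound].
- exact: P_infty.
Qed.

Let XN_lim : X r - N^-1 @[r --> +oo] --> (0 : R).
Proof.
apply: cvgy_sqr0.
have : C0^-1 * D r @[r --> +oo] --> C0^-1 * 0 by apply: cvgM; [exact: cvg_cst|exact: D_lim].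
by rewrite mulr0; apply: cvgy_ext => r _; rewrite /D mulKf ?gt_eqF.
Qed.

(** That X tends to 1/N does not by itself make X'/H tend to 0. But b obeys a linear equation in the
    time P, with damping 1 - Lam and a forcing that tends to 0 along with D and X - 1/N. *)
Let b_lim : b r @[r --> +oo] --> (0 : R).
Proof.
have half0 : 0 < 2^-1 :> R by rewrite invr_gt0.
apply: (@forced_decay _ b (fun r => 2 * (D r - (X r - N^-1)) * A r
   + 2 * C0 * ((X r - N^-1) * (X r * b r))) (fun r => 1 - Lam r) H P 2^-1 half0).
- move=> r /pos r0; have Hn := H_neq0 r0.
  have [_ [_ _ dK _] _] := flow r0; have dH := is_derive_H r0.
  have dX := is_derive_X r0; have dD := is_derive_D r0.
  rewrite /b /Lam /A; derive_eq; first by rewrite expf_neq0.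
  rewrite (LE r0) -/(A r) /Lam /b /=.
  set la := Lam r; have -> : D r = la - N^-1 by rewrite /la /Lam; ring.
  have -> : N^-1 + (la - N^-1) = la by ring.
  rewrite /A; move: (X r) (K r) (H r) Hn => x k h hn.
  by field; rewrite N_neq0 hn.
- by move=> r /pos; exact: is_derive_P.
- by move=> r /pos r0; exact/ltW/H_gt0.
- have /cvgrPdist_le h := D_lim.
  (* D <= 1/6 and 1/N <= 1/3 give the damping 1 - Lam >= 1/2. *)
  have e0 : 0 < 6^-1 :> R by rewrite invr_gt0.
  apply: filterS (h _ e0) => r; rewrite sub0r normrN ger0_norm ?D_ge0// => hD.
  by rewrite /Lam; have := Ninv_le; lra.
- exact: P_infty.
- rewrite -[X in _ --> X](addr0 0); apply: cvgD.
    apply: (cvgy_mul_bounded (B := 1)).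
      by move=> r /pos r0; have /andP[h1 h2] := A_bounds r0; rewrite ger0_norm.
    rewrite -[X in _ --> X](mulr0 2); apply: cvgM; first exact: cvg_cst.
    by rewrite -[X in _ --> X](subr0 0); apply: cvgB; [exact: D_lim|exact: XN_lim].
  rewrite -[X in _ --> X](mulr0 (2 * C0)); apply: cvgM; first exact: cvg_cst.
  apply: (cvgy_mul_bounded (B := 1)); last exact: XN_lim.
  move=> r /pos r0; rewrite -(mulr1 1); apply: normrM_le; last exact: b_bound.
  by have /andP[h1 h2] := X_bounds r0; rewrite ger0_norm.
Qed.

(** 1/(K r^2) = (nu - 2) A^-1 (1/(H r))^2, where A tends to (1/N)(1 - 1/N) and 1/(H r) to 1/N. The
    result is (nu - 2)/(N - 1), and N - 1 = m + n - 2. *)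
Lemma expanding_asymptotics :
  (K r)^-1 / r ^+ 2 @[r --> +oo] --> (nu - 2) / (kappa^-1 + nu - 2).
Proof.
have Lam_lim : Lam r @[r --> +oo] --> N^-1.
  by rewrite -[X in _ --> X](addr0 N^-1); apply: cvgD; [exact: cvg_cst|exact: D_lim].
have X_lim : X r @[r --> +oo] --> N^-1.
  have : (X r - N^-1) + N^-1 @[r --> +oo] --> 0 + N^-1 by apply: cvgD; [exact: XN_lim|exact: cvg_cst].
  by rewrite add0r; apply: cvgy_ext => r _; rewrite subrK.
have A_lim : A r @[r --> +oo] --> N^-1 * (1 - N^-1).
  have : b r + X r * (1 - Lam r) @[r --> +oo] --> 0 + N^-1 * (1 - N^-1).
    apply: cvgD; first exact: b_lim.
    by apply: cvgM => //; apply: cvgB => //; exact: cvg_cst.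
  by rewrite add0r; apply: cvgy_ext => r _; rewrite /b subrK.
have T_lim : (H r)^-1 / r @[r --> +oo] --> N^-1.
  by apply: (cvgy_div_linear (du := Lam)) => // r /pos; exact: is_derive_Hinv.
have N1 : N - 1 != 0 by rewrite gt_eqF// subr_gt0; apply: lt_trans N_gt3; rewrite ltr1n.
have -> : (nu - 2) / (kappa^-1 + nu - 2) = (nu - 2) * ((N^-1 * (1 - N^-1))^-1 * (N^-1 * N^-1)).
  have -> : kappa^-1 + nu - 2 = N - 1 by rewrite /N; ring.
  by field; rewrite N_neq0.
have a0 : N^-1 * (1 - N^-1) != 0.
  have -> : N^-1 * (1 - N^-1) = (N - 1) / N ^+ 2 by field.
  by rewrite mulf_neq0// invr_eq0 expf_neq0.
have : (nu - 2) * ((A r)^-1 * ((H r)^-1 / r * ((H r)^-1 / r))) @[r --> +oo] -->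
    (nu - 2) * ((N^-1 * (1 - N^-1))^-1 * (N^-1 * N^-1)).
  by apply: cvgM; [exact: cvg_cst|apply: cvgM; [exact: cvgV|exact: cvgM]].
apply: cvgy_ext => r /pos r0 /=.
have [[_ _ K0 _] _ _] := flow r0; have Hn := H_neq0 r0.
have n2 : nu - 2 != 0 by rewrite gt_eqF// (lt_le_trans ltr01 nu2_ge1).
by rewrite /A; field; rewrite n2 Hn !gt_eqF.
Qed.

End FiniteDimensionParameter.

(** The initial condition for [steady_V_derivative_ge0]: near the origin the numerator is bounded,
    while 1/K = r^2/(1 + r^2 k) tends to 0. *)
Lemma steady_small_at_origin (R : realType) (nu : R) (l w k f : R -> R) :
  3 <= nu -> tame_at_origin l w k f ->
  forall eps t : R, 0 < eps -> 0 < t -> exists2 a : R, 0 < a < t &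
    `|(1 - (- (a * w a)) ^+ 2 - (nu - 1) * - (a * w a) * ((1 + a ^+ 2 * l a) / a))
       / ((1 + a ^+ 2 * k a) / a ^+ 2)| < eps.
Proof.
move=> n3 [B [d [d0 hB]]] eps t eps0 t0.
have B0 : 0 <= B.
  have [h _ _ _] := hB (d / 2) (ltac:(by rewrite divr_gt0// ltr_pdivrMr// mulr_natr mulr2n ltrDl)).
  exact: le_trans (normr_ge0 _) h.
pose C := 1 + B ^+ 2 + (nu - 1) * (B * (1 + B)).
have nu1 : 0 <= nu - 1 by clear -n3; lra.
have C0 : 0 < C.
  have h1 : 0 <= B ^+ 2 by exact: sqr_ge0.
  have h2 : 0 <= (nu - 1) * (B * (1 + B)) by rewrite !mulr_ge0// addr_ge0.
  by rewrite /C; clear -h1 h2; lra.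
(* Small enough that a lies in the tame region and below t, that a^2 B <= 1/2 and hence 1 + a^2 k >=
   1/2, and that the final bound 2 a C is below eps. *)
pose a := Num.min (Num.min d t) (Num.min 1 (Num.min (2 * (B + 1))^-1 (eps / (2 * C)))) / 2.
have B10 : 0 < 2 * (B + 1) by rewrite mulr_gt0// ltr_wpDl.
have a0 : 0 < a by rewrite divr_gt0// !lt_min d0 t0 ltr01 invr_gt0 B10 divr_gt0// mulr_gt0.
have lt_a (x : R) : 2 * a <= x -> a < x by move=> h; clear -a0 h; lra.
have a2 : 2 * a = Num.min (Num.min d t) (Num.min 1 (Num.min (2 * (B + 1))^-1 (eps / (2 * C)))).
  by rewrite /a; field.
have ad : a < d by apply: lt_a; rewrite a2 !ge_min lexx.
have at_ : a < t by apply: lt_a; rewrite a2 !ge_min lexx ?orbT.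
have a1 : a < 1 by apply: lt_a; rewrite a2 !ge_min lexx ?orbT.
have aB : a < (2 * (B + 1))^-1 by apply: lt_a; rewrite a2 !ge_min lexx ?orbT.
have ae : a < eps / (2 * C) by apply: lt_a; rewrite a2 !ge_min lexx ?orbT.
exists a; first by rewrite a0.
have [hl hw hk _] := hB a (ltac:(by rewrite a0)).
have an : a != 0 by rewrite gt_eqF.
have a21 : a ^+ 2 <= a by rewrite expr2 ler_piMr ?(ltW a0)// ltW.
have a2B : a ^+ 2 * B <= 2^-1.
  have h : a * (B + 1) < 2^-1 by rewrite -ltr_pdivlMr ?ltr_wpDl// -invfM.
  apply: le_trans (ltW h); apply: ler_pM => //; first exact: sqr_ge0.
  by rewrite lerDl.
have na2 : `|a ^+ 2| <= 1 by rewrite ger0_norm ?sqr_ge0// (le_trans a21)// ltW.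
have K1 : 2^-1 <= 1 + a ^+ 2 * k a.
  have : `|a ^+ 2 * k a| <= a ^+ 2 * B.
    by apply: normrM_le => //; rewrite ger0_norm ?sqr_ge0.
  by rewrite ler_norml => /andP[h _]; clear -h a2B; lra.
have K0 : 0 < 1 + a ^+ 2 * k a by apply: lt_le_trans K1; rewrite invr_gt0.
pose Z := 1 - a ^+ 2 * (w a * w a) + (nu - 1) * (w a * (1 + a ^+ 2 * l a)).
have ZC : `|Z| <= C.
  have h1 : `|a ^+ 2 * (w a * w a)| <= B ^+ 2.
    by rewrite -(mul1r (B ^+ 2)) expr2; apply: normrM_le => //; apply: normrM_le.
  have h2 : `|(nu - 1) * (w a * (1 + a ^+ 2 * l a))| <= (nu - 1) * (B * (1 + B)).
    apply: normrM_le; first by rewrite ger0_norm.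
    apply: normrM_le => //; apply: le_trans (ler_normD _ _) _; rewrite normr1 lerD2l.
    by rewrite -(mul1r B); apply: normrM_le.
  rewrite /Z /C; apply: le_trans (ler_normD _ _) _; apply: lerD => //.
  by apply: le_trans (ler_normB _ _) _; rewrite normr1 lerD2l.
have -> : (1 - (- (a * w a)) ^+ 2 - (nu - 1) * - (a * w a) * ((1 + a ^+ 2 * l a) / a))
       / ((1 + a ^+ 2 * k a) / a ^+ 2) = Z * (a ^+ 2 / (1 + a ^+ 2 * k a)).
  by rewrite /Z; field; rewrite an gt_eqF.
have q : `|a ^+ 2 / (1 + a ^+ 2 * k a)| <= 2 * a.
  rewrite ger0_norm ?divr_ge0 ?sqr_ge0 ?(ltW K0)// ler_pdivrMr//.
  have h : 2 * a * 2^-1 <= 2 * a * (1 + a ^+ 2 * k a) by rewrite ler_wpM2l// mulr_ge0// ltW.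
  by apply: le_trans a21 (le_trans _ h); rewrite mulrC mulKf.
apply: le_lt_trans (normrM_le ZC q) _.
by move: ae; rewrite ltr_pdivlMr ?mulr_gt0// => h; rewrite mulrA mulrC (mulrC C).
Qed.

Theorem theorem5p7 (R : realType) (n : nat) (n_ge3 : (3 <= n)%N) :
  exists2 c : R, 0 < c & forall m : \bar R, (1 < m)%E ->
    (exists phi psi : R -> R, rotational_solution n m phi psi) /\
    (exists phi psi : R -> R,
      [/\ normalized_solution n m phi psi,
          forall phi' psi' : R -> R, normalized_solution n m phi' psi' ->
            forall r : R, 0 <= r -> phi' r = phi r /\ psi' r = psi r,
          forall mr : R, m = mr%:E ->
            asymptotic_at_infinity (fun r => psi r ^+ 2)
              (fun r => (n%:R - 2) / (mr + n%:R - 2) * r ^+ 2)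
        & m = +oo%E ->
            asymptotic_at_infinity (fun r => psi r ^+ 2) (fun r => c * r)]).
Proof.
have nu3 : 3 <= n%:R :> R by rewrite ler_nat.
have nu2 : 0 < n%:R - 2 :> R by clear -nu3; lra.
exists (2 * (n%:R - 2)); first by rewrite mulr_gt0.
move=> m m1.
have [l [w [k [f [sol adm]]]]] := normalized_solution_exists n_ge3 m1.
pose psi r := r / Num.sqrt (1 + r ^+ 2 * k r).
split; first by exists f, psi; have [] := sol.
have flow := admissible_polar_flow adm.
have psi2 (r : R) : 1 <= r -> psi r ^+ 2 = ((1 + r ^+ 2 * k r) / r ^+ 2)^-1.
  move=> r1; have r0 : 0 < r by apply: lt_le_trans r1.
  have rr : 0 < r < r + 1 by rewrite r0 ltrDl ltr01.
  have [s1 _ _] := a_priori_signs (adm (r + 1)) rr.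
  by rewrite /psi expr_div_n sqr_sqrtr ?(ltW s1)// invf_div.
have conv (p : nat) (c : R) : c != 0 ->
    ((1 + r ^+ 2 * k r) / r ^+ 2)^-1 / r ^+ p @[r --> +oo] --> c ->
    asymptotic_at_infinity (fun r => psi r ^+ 2) (fun r => c * r ^+ p).
  move=> c0 h; rewrite /asymptotic_at_infinity.
  have : ((1 + r ^+ 2 * k r) / r ^+ 2)^-1 / r ^+ p * c^-1 @[r --> +oo] --> c * c^-1.
    by apply: cvgM => //; exact: cvg_cst.
  rewrite divff//; apply: cvgy_ext => r r1.
  by rewrite psi2// (mulrC c) -mulrA -invfM.
exists f, psi; split=> //.
- by move=> phi' psi' sol'; exact: (normalized_solution_unique n_ge3 m1 sol sol').
- move=> mr mE; rewrite mE lte_fin in m1; have mr0 : 0 < mr by apply: lt_trans m1.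
  have kE : fine m^-1%E = mr^-1 by rewrite mE inver gt_eqF.
  have D0 : 0 < mr + n%:R - 2 :> R by rewrite -addrA addr_gt0.
  apply: conv => //; first by rewrite mulf_neq0 ?invr_eq0 ?gt_eqF.
  rewrite -{1}(invrK mr) -kE; apply: expanding_asymptotics flow => //.
  + by rewrite kE invr_gt0.
  + by rewrite kE invf_lt1.
- move=> mE; have kE : fine m^-1%E = 0 by rewrite mE invey.
  rewrite kE in flow adm.
  have e1 (r : R) : 0 < r -> potential_weight 0 (f r) = 1.
    by move=> _; rewrite /potential_weight mulr0 mul0r expR0 subr0 divr1.
  have [_ _ _ tame _] := adm 1.
  have Z0 := steady_V_derivative_ge0 nu3 flow e1 (steady_small_at_origin nu3 tame).
  apply: (conv 1%N) => //; first by rewrite gt_eqF// mulr_gt0.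
  exact: (steady_asymptotics nu3 flow e1 Z0).
Qed.
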